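(* Let $(f,(f)'_\beta)\in D(A)$. Then: (i) For $x\in[a,c)\cup(c,b]$, $$f(x)=\sum_{n=0}^{\infty}\left(\gamma_{1}\gamma_{2}\int_{a}^{c} f(t)\psi_{n}(t)\,dt+\delta_{1}\delta_{2}\int_{c}^{b}f(t)\psi_{n}(t)\,dt+\frac{\delta_{1}\delta_{2}}{\rho}(f)'_{\beta}(\psi_{n})'_{\beta}\right)\psi_{n}(x),$$ where the series converges absolutely and uniformly on the whole of $[a,c)\cup(c,b]$. (ii) The series in (i) may also be differentiated term by term, and the differentiated series is also absolutely and uniformly convergent on the whole of $[a,c)\cup(c,b]$.
   Context: Setting. Let $a<c<b$ be real. Let $q$ be real-valued, continuous on $[a,c)$ and on $(c,b]$, with finite limits $q(c\mp 0)$. Let $\alpha_i,\beta_i,\beta_i',\gamma_i,\delta_i$ $(i=1,2)$ be real numbers with $(\alpha_1,\alpha_2)\neq(0,0)$, $\gamma_i\ne 0$, $\delta_i\neq 0$, $\rho:=\beta_1'\beta_2-\beta_1\beta_2'>0$, $\gamma_1\gamma_2>0$ and $\delta_1\delta_2>0$. Write $\tau u:=-u''+q(x)u$, and $$(u)_\beta:=\beta_1u(b)-\beta_2u'(b),\qquad (u)'_\beta:=\beta_1'u(b)-\beta_2'u'(b).$$ Problem. The boundary value transmission problem is: $\tau u=\lambda u$ on $[a,c)\cup(c,b]$, with $\gamma_1u(c-0)=\delta_1u(c+0)$, $\gamma_2u'(c-0)=\delta_2u'(c+0)$, $\alpha_1u(a)+\alpha_2u'(a)=0$, and $(\beta_1'\lambda+\beta_1)u(b)-(\beta_2'\lambda+\beta_2)u'(b)=0$.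 An eigenvalue is a $\lambda\in\mathbb C$ for which there is a nontrivial solution. Hilbert space. $H_1$ is $L_2[a,b]\oplus\mathbb C$ with inner product $$\langle F,G\rangle_1:=|\gamma_1\gamma_2|\int_a^cF_1\overline{G_1}\,dx+|\delta_1\delta_2|\int_c^bF_1\overline{G_1}\,dx+\frac{|\delta_1\delta_2|}{\rho}F_2\overline{G_2},$$ for $F=(F_1,F_2)$, $G=(G_1,G_2)$, and $\|\cdot\|_1$ is the corresponding norm. Domain. $D(A)$ is the set of all $(F_1,(F_1)'_\beta)\in H_1$ such that $F_1$ and $F_1'$ are absolutely continuous in each of the intervals $[a,c)$ and $(c,b]$ and have finite limits $F_1(c\mp0)$, $F_1'(c\mp0)$, $\tau F_1\in L_2[a,b]$, $\alpha_1F_1(a)+\alpha_2F_1'(a)=0$, $\gamma_1F_1(c-0)=\delta_1F_1(c+0)$, $\gamma_2F_1'(c-0)=\delta_2F_1'(c+0)$. Solutions and eigenelements. For $\lambda\in\mathbb C$, $\phi(x,\lambda)$ is the function on $[a,c)\cup(c,b]$ which solves $\tau u=\lambda u$ on each of the two intervals and satisfies $\phi(a,\lambda)=\alpha_2$, $\phi'(a,\lambda)=-\alpha_1$, $\phi(c+0,\lambda)=\frac{\gamma_1}{\delta_1}\phi(c-0,\lambda)$, $\phi'(c+0,\lambda)=\frac{\gamma_2}{\delta_2}\phi'(c-0,\lambda)$ (prime denotes $\partial/\partial x$). The problem has infinitely many eigenvalues, all real; $\lambda_n$, $n=0,1,2,\dots$, is an enumeration without repetition of all of them. Put $\Phi_n:=(\phi(\cdot,\lambda_n),(\phi(\cdot,\lambda_n))'_\beta)\in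 H_1$ and $\psi_n(x):=\phi(x,\lambda_n)/\|\Phi_n\|_1$. *)

(* Defs.v *)
From HB Require Import structures.
From mathcomp Require Import all_boot all_order all_algebra.
From mathcomp Require Import all_classical all_reals all_analysis.
From mathcomp Require Import complex.

Set Implicit Arguments.
Unset Strict Implicit.
Unset Printing Implicit Defensive.

Import Order.TTheory GRing.Theory Num.Theory.
Import numFieldNormedType.Exports.

Local Open Scope classical_set_scope.
Local Open Scope ring_scope.
Local Open Scope complex_scope.

(* MathComp-Analysis puts the norm topology of a numFieldType on its regular
   algebra, hence R[i]^o rather than R[i]. *)
Notation Cplx R := (R[i]^o).

Section ComplexValued.
Context {R : realType}.
Implicit Types (D : set R) (f : R -> Cplx R).

Definition diff_quot f (x y : R) : Cplx R := ((y - x)^-1)%:C * (f y - f x).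

(* Derivative relative to D: one-sided at an endpoint of D that belongs to D. *)
Definition derivable_on D f (x : R) : Prop :=
  cvg (diff_quot f x @ within D x^').

Definition deriv_on D f : R -> Cplx R :=
  fun x => lim (diff_quot f x @ within D x^').

(* Absolute continuity on an interval D, by finite families of pairwise
   non-overlapping subintervals [u i, v i] of D. *)
Definition abs_cont D f : Prop :=
  forall e : R, 0 < e -> exists2 d : R, 0 < d &
    forall (n : nat) (u v : 'I_n -> R),
      (forall i, [/\ D (u i), D (v i) & u i <= v i]) ->
      (forall i j, i != j -> v i <= u j \/ v j <= u i) ->
      \sum_(i < n) (v i - u i) < d ->
      \sum_(i < n) `|f (v i) - f (u i)| < e%:C.

Definition Cintegral D f : Cplx R :=
  (\int[lebesgue_measure]_(x in D) complex.Re (f x))%R +i*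
  (\int[lebesgue_measure]_(x in D) complex.Im (f x))%R.

(* Measurable functions of the library are Borel; f itself need only be
   Lebesgue measurable, i.e. almost everywhere equal to a Borel g. *)
Definition in_L2 D f : Prop :=
  exists g : R -> Cplx R,
    [/\ measurable_fun setT (fun x => complex.Re (g x)),
        measurable_fun setT (fun x => complex.Im (g x)),
        {ae lebesgue_measure, forall x, D x -> f x = g x}
      & (\int[lebesgue_measure]_(x in D)
           (complex.Re (`|g x| ^+ 2))%:E < +oo)%E].

End ComplexValued.

Record transmission_data (R : realType) := TransmissionData {
  td_a : R; td_c : R; td_b : R;
  td_q : R -> R;
  alpha1 : R; alpha2 : R;
  beta1 : R; beta2 : R;
  beta1' : R; beta2' : R;
  gamma1 : R; gamma2 : R;
  delta1 : R; delta2 : R }.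

Section Problem.
Context {R : realType} (P : transmission_data R).

Local Notation a := (td_a P).
Local Notation c := (td_c P).
Local Notation b := (td_b P).
Local Notation q := (td_q P).

Definition rho : R := beta1' P * beta2 P - beta1 P * beta2' P.

Record admissible : Prop := Admissible {
  adm_ac : a < c;
  adm_cb : c < b;
  adm_q_left : {within `[a, c[, continuous q};
  adm_q_right : {within `]c, b], continuous q};
  adm_q_limits : cvg (q @ c^'-) /\ cvg (q @ c^'+);
  adm_alpha : (alpha1 P, alpha2 P) <> (0, 0);
  adm_gamma : gamma1 P <> 0 /\ gamma2 P <> 0;
  adm_delta : delta1 P <> 0 /\ delta2 P <> 0;
  adm_rho : 0 < rho;
  adm_gamma12 : 0 < gamma1 P * gamma2 P;
  adm_delta12 : 0 < delta1 P * delta2 P }.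

Definition J : set R := `[a, c[ `|` `]c, b].

Definition D_J (u : R -> Cplx R) : R -> Cplx R := deriv_on J u.

Definition tau (u : R -> Cplx R) : R -> Cplx R :=
  fun x => - D_J (D_J u) x + (q x)%:C * u x.

Definition lim_left (u : R -> Cplx R) : Cplx R := lim (u @ c^'-).
Definition lim_right (u : R -> Cplx R) : Cplx R := lim (u @ c^'+).

Definition has_limits (u : R -> Cplx R) : Prop :=
  cvg (u @ c^'-) /\ cvg (u @ c^'+).

Definition bdry (u : R -> Cplx R) : Cplx R :=
  (beta1 P)%:C * u b - (beta2 P)%:C * D_J u b.

Definition bdry' (u : R -> Cplx R) : Cplx R :=
  (beta1' P)%:C * u b - (beta2' P)%:C * D_J u b.

Definition solves (lam : R[i]) (u : R -> Cplx R) : Prop :=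
  forall x, J x ->
    [/\ derivable_on J u x, derivable_on J (D_J u) x & tau u x = lam * u x].

Definition transmission (u : R -> Cplx R) : Prop :=
  [/\ has_limits u, has_limits (D_J u),
      (gamma1 P)%:C * lim_left u = (delta1 P)%:C * lim_right u
    & (gamma2 P)%:C * lim_left (D_J u) = (delta2 P)%:C * lim_right (D_J u)].

Definition left_bc (u : R -> Cplx R) : Prop :=
  (alpha1 P)%:C * u a + (alpha2 P)%:C * D_J u a = 0.

Definition right_bc (lam : R[i]) (u : R -> Cplx R) : Prop :=
  ((beta1' P)%:C * lam + (beta1 P)%:C) * u b
  - ((beta2' P)%:C * lam + (beta2 P)%:C) * D_J u b = 0.

Definition is_eigenvalue (lam : R[i]) : Prop :=
  exists u : R -> Cplx R,
    [/\ solves lam u, transmission u, left_bc u, right_bc lam u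
      & exists2 x, J x & u x <> 0].

Definition inner1 (F G : (R -> Cplx R) * Cplx R) : Cplx R :=
  `|gamma1 P * gamma2 P|%:C * Cintegral `[a, c] (fun x => F.1 x * (G.1 x)^*)
  + `|delta1 P * delta2 P|%:C * Cintegral `[c, b] (fun x => F.1 x * (G.1 x)^*)
  + (`|delta1 P * delta2 P| / rho)%:C * (F.2 * G.2^*).

Definition norm1 (F : (R -> Cplx R) * Cplx R) : R :=
  Num.sqrt (complex.Re (inner1 F F)).

Definition dom_A (F : (R -> Cplx R) * Cplx R) : Prop :=
  [/\ in_L2 `[a, b] F.1 /\ F.2 = bdry' F.1,
      forall x, J x -> derivable_on J F.1 x,
      [/\ abs_cont `[a, c[ F.1, abs_cont `]c, b] F.1,
          abs_cont `[a, c[ (D_J F.1) & abs_cont `]c, b] (D_J F.1)],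
      in_L2 `[a, b] (tau F.1)
    & left_bc F.1 /\ transmission F.1].

(* u is phi(., lam); only its values on J are determined. *)
Definition fundamental_solution (lam : R[i]) (u : R -> Cplx R) : Prop :=
  [/\ solves lam u,
      u a = (alpha2 P)%:C /\ D_J u a = - (alpha1 P)%:C,
      has_limits u /\ has_limits (D_J u),
      lim_right u = (gamma1 P / delta1 P)%:C * lim_left u
    & lim_right (D_J u) = (gamma2 P / delta2 P)%:C * lim_left (D_J u)].

Definition eigenelement (phi : R -> R[i] -> Cplx R) (lam : R[i]) :
    (R -> Cplx R) * Cplx R :=
  (phi ^~ lam, bdry' (phi ^~ lam)).

Definition psi (phi : R -> R[i] -> Cplx R) (lam : nat -> R[i]) (n : nat) :
    R -> Cplx R :=
  fun x => phi x (lam n) / (norm1 (eigenelement phi (lam n)))%:C.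

(* As in the expansion formula, v is not conjugated. *)
Definition expansion_coef (f v : R -> Cplx R) : Cplx R :=
  (gamma1 P * gamma2 P)%:C * Cintegral `[a, c] (fun t => f t * v t)
  + (delta1 P * delta2 P)%:C * Cintegral `[c, b] (fun t => f t * v t)
  + (delta1 P * delta2 P / rho)%:C * bdry' f * bdry' v.

End Problem.

Section SeriesOfFunctions.
Context {R : realType}.

Definition abs_cvg_on (E : set R) (s : nat -> R -> Cplx R) : Prop :=
  forall x, E x -> cvgn [normed series (fun n => s n x)].

Definition unif_sum_on (E : set R) (s : nat -> R -> Cplx R) (f : R -> Cplx R)
    : Prop :=
  {uniform E, (fun N x => series (fun n => s n x) N) @ \oo --> f}.

Definition sum_on (E : set R) (s : nat -> R -> Cplx R) (f : R -> Cplx R)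
    : Prop :=
  forall x, E x -> series (fun n => s n x) @ \oo --> f x.

End SeriesOfFunctions.

(* Main.v *)
(** The problem is that of a symmetric operator A in a real Hilbert space:
    since q and all the coefficients are real, the real and imaginary parts of a
    complex function are treated separately. On the domain of A every u satisfies
    |u(x)|^2 + |u'(x)|^2 <= K ||(A - m) u||^2 for a real m which is not an
    eigenvalue (Gronwall's inequality, and the explicit correction by a multiple of
    phi(., m) for the condition at b). Hence the resolvent maps bounded sequences
    to bounded equi-Lipschitz ones, so it is compact, and a compact symmetric
    operator that is not zero on the orthogonal complement of the eigenelements
    would have an eigenvector there: the eigenelements are complete.
    For f in D(A), with Fourier coefficients c_n, apply the bound at a given x to
    v = sum_(N <= n < M) +- c_n psi_n, the signs being those of c_n psi_n(x): the
    square of the sum of the |c_n psi_n(x)| is at most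
    K sum_(N <= n < M) c_n^2 (lambda_n - m)^2, where c_n (lambda_n - m) is the n-th
    Fourier coefficient of (A - m) f, so that Bessel's inequality makes the tails
    uniformly small. The same argument holds with psi_n' for psi_n. The sum is f by
    completeness. *)
From HB Require Import structures.
Require Import Defs.
From mathcomp Require Import all_boot all_order all_algebra.
From mathcomp Require Import all_classical all_reals all_analysis.
From mathcomp Require Import complex.
From mathcomp Require Import measurable_realfun ring lra.
Import Order.TTheory GRing.Theory Num.Theory.
Import numFieldNormedType.Exports.
Local Open Scope classical_set_scope.
Local Open Scope ring_scope.

Set Implicit Arguments.
Unset Strict Implicit.
Unset Printing Implicit Defensive.

(** * Continuously differentiable functions on a segment *)

(** For f in D(A) the image A f is merely square integrable. The equation is therefore kept in
    integrated form, u' being the primitive of q u - g, and Green's formula rests on integration by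
    parts for primitives of integrable functions. No completion is formed. The inner product is a
    semi-definite form on predicates closed under linear combinations, and the resolvent is applied
    to continuous pairs only, on which the form is definite. This is enough: the limits that
    compactness provides are continuous, and so is the difference between f and the sum of its
    series, whose vanishing ends the proof. Nothing is known at c, so every function is replaced by
    two functions on closed segments, with the one-sided limits as values at c. The condition at a
    fixes the Cauchy data there up to a factor, so every eigenvector is a multiple of some phi(.,
    lambda_n). Hence an eigenvector orthogonal to all of these vanishes, which is what contradicts
    the eigenvector produced by compactness. A suitable real m exists because the eigenvalues are
    countable. *)

Section C1on.
Context {R : realType}.
Implicit Types (l r x : R) (f g h k : R -> R).

(** The derivative is carried as a continuous function, so that its values at l and r make sense
    without one-sided derivatives. *)
Definition C1on l r f h : Prop :=
  [/\ {within `[l, r], continuous f}, {within `[l, r], continuous h} &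
      forall x, x \in `]l, r[ -> is_derive x 1 f (h x)].

Lemma withinP l r f : {within `[l, r], continuous f} <->
  forall (x e : R), x \in `[l, r] -> 0 < e -> exists2 d : R, 0 < d &
    forall y, y \in `[l, r] -> `|x - y| < d -> `|f x - f y| < e.
Proof.
split=> [/subspace_continuousP cf x e xlr e0|cf].
  have /cvgrPdist_lt/(_ e e0) := cf x xlr.
  rewrite /prop_near1 /= /nbhs/= => -[d /= d0 H].
  by exists d => // y ylr xy; exact: (H y xy ylr).
apply/subspace_continuousP => x xlr; apply/cvgrPdist_lt => e e0.
have [d d0 H] := cf x e xlr e0.
rewrite /prop_near1 /= /nbhs/=; exists d => //= y /= xy ylr.
exact: H.
Qed.

Lemma within_cst l r (s : R) : {within `[l, r], continuous (fun=> s : R)}.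
Proof. by apply: continuous_subspaceT => x; exact: cvg_cst. Qed.

Lemma within_comb l r (s : R) f g :
  {within `[l, r], continuous f} -> {within `[l, r], continuous g} ->
  {within `[l, r], continuous (fun x => s * f x + g x)}.
Proof.
move=> cf cg x; apply: cvgD; last exact: cg.
by apply: cvgM; [exact: cvg_cst|exact: cf].
Qed.

Lemma within_mul l r f g :
  {within `[l, r], continuous f} -> {within `[l, r], continuous g} ->
  {within `[l, r], continuous (fun x => f x * g x)}.
Proof. by move=> cf cg x; apply: cvgM; [exact: cf|exact: cg]. Qed.

Lemma within_sub l r f g :
  {within `[l, r], continuous f} -> {within `[l, r], continuous g} ->
  {within `[l, r], continuous (fun x => f x - g x)}.
Proof. by move=> cf cg x; apply: cvgB; [exact: cf|exact: cg]. Qed.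

Lemma C1on_comb l r (s : R) f h g k : C1on l r f h -> C1on l r g k ->
  C1on l r (fun x => s * f x + g x) (fun x => s * h x + k x).
Proof.
move=> [cf ch fh] [cg ck gk]; split; [exact: within_comb..|].
move=> x xlr; have := fh x xlr; have := gk x xlr => ? ?.
apply: is_deriveD; exact: is_deriveZ.
Qed.

Lemma C1on_cst l r (s : R) : C1on l r (fun=> s) (fun=> 0).
Proof.
by split; [exact: within_cst..|move=> x _; exact: is_derive_cst].
Qed.

Lemma near_itv_oo l r x : x \in `]l, r[ -> \forall y \near x, y \in `]l, r[.
Proof. exact: near_in_itvoo. Qed.

Lemma C1on_ext l r f h g k : C1on l r f h ->
  {in `[l, r], f =1 g} -> {in `[l, r], h =1 k} -> C1on l r g k.
Proof.
move=> [cf ch fh] fg hk; split.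
- by apply: subspace_eq_continuous cf => x; rewrite inE; exact: fg.
- by apply: subspace_eq_continuous ch => x; rewrite inE; exact: hk.
move=> x xlr; rewrite -hk; last exact: subset_itv_oo_cc.
apply: near_eq_is_derive (fh x xlr).
near=> y; rewrite fg//; apply: subset_itv_oo_cc.
near: y; exact: near_itv_oo.
Unshelve. all: by end_near. Qed.

Lemma cont_bounded l r f : {within `[l, r], continuous f} ->
  exists2 M : R, 0 < M & forall x, x \in `[l, r] -> `|f x| <= M.
Proof.
move=> cf; have [lr|rl] := leP l r; last first.
  exists 1 => // x; rewrite in_itv/= => /andP[lx xr].
  by have := le_lt_trans (le_trans lx xr) rl; rewrite ltxx.
have cnf : {within `[l, r], continuous (fun x => `|f x|)}.
  by move=> x; apply: cvg_norm; exact: cf.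
have [m mlr hm] := EVT_max lr cnf.
exists (`|f m| + 1) => [|x /hm fx]; first by rewrite ltr_pwDr.
by rewrite (le_trans fx)// lerDl.
Qed.

(** Nearest-point projection of the line on [l, r]. Composition with it extends a function to the
    line and preserves continuity, monotonicity and Lipschitz constants. *)
Definition clamp l r (x : R) := Num.max l (Num.min x r).

Lemma clamp_itv l r x : l <= r -> clamp l r x \in `[l, r].
Proof. by move=> lr; rewrite /clamp in_itv/= le_max lexx/= ge_max lr ge_min lexx orbT. Qed.

Lemma clamp_id l r x : x \in `[l, r] -> clamp l r x = x.
Proof.
by rewrite in_itv/= => /andP[lx xr]; rewrite /clamp min_l// max_r.
Qed.

Lemma clamp_lip l r x y : `|clamp l r x - clamp l r y| <= `|x - y|.
Proof.
rewrite /clamp /Num.max /Num.min; have := lerNnormlW (lexx `|x - y|); have := ler_norm (x - y).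
by do ![case: ifPn]; rewrite -?leNgt => *; rewrite ler_norml; lra.
Qed.

Lemma continuous_clamp l r f : l <= r -> {within `[l, r], continuous f} ->
  continuous (f \o clamp l r).
Proof.
move=> lr /withinP cf x; apply/cvgrPdist_lt => e e0.
have [d d0 fd] := cf _ e (clamp_itv x lr) e0.
near=> y; apply: fd; first exact: clamp_itv.
by rewrite (le_lt_trans (clamp_lip _ _ _ _)).
Unshelve. all: by end_near. Qed.

Lemma derive_sign_le l r f df : l <= r -> {within `[l, r], continuous f} ->
  (forall x, x \in `]l, r[ -> is_derive x 1 f (df x)) ->
  (forall x, x \in `]l, r[ -> df x <= 0) ->
  forall x, x \in `[l, r] -> f x <= f l.
Proof.
move=> lr cf fd d0 x; rewrite in_itv/= => /andP[lx xr].
apply: (ler0_derive1_nincr _ _ cf (lexx _) lx xr) => y yi; first by have [] := fd y yi.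
by have := fd y yi => ?; rewrite derive1E derive_val; exact: d0.
Qed.

(** The energy p^2 + d^2 is weighted by exp(- (K + 2) (x - l)). The rate is the sum of K from 2 d (h
    + g), 1 from 2 p d and 1 from - 2 d g; the last estimate leaves a term g^2, which the
    subtraction of G absorbs. *)
Lemma ode_gronwall l r (K : R) (p d g h G : R -> R) : l <= r -> 0 <= K ->
  C1on l r p d -> C1on l r d h -> C1on l r G (fun x => g x ^+ 2) ->
  (forall x, x \in `]l, r[ -> `|h x + g x| <= K * `|p x|) ->
  forall x, x \in `[l, r] -> p x ^+ 2 + d x ^+ 2 <=
   expR ((K + 2) * (r - l)) * (p l ^+ 2 + d l ^+ 2 + (G x - G l)).
Proof.
move=> lr K0 [cp cd pd] [_ ch dh] [cG _ Gg] Kp x xlr.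
pose E y := expR (- (K + 2) * (y - l)).
have dE (y : R) : is_derive y 1 E (- (K + 2) * E y).
  rewrite /E; apply: is_derive_eq; rewrite /GRing.scale/=; lra.
pose w y := p y ^+ 2 + d y ^+ 2.
pose W y := E y * w y - G y.
pose dW y := - (K + 2) * E y * w y + E y * (2 * p y * d y + 2 * d y * h y) - g y ^+ 2.
have WdW (y : R) : y \in `]l, r[ -> is_derive y 1 W (dW y).
  move=> ylr; have ? := pd y ylr; have ? := dh y ylr; have ? := Gg y ylr; have ? := dE y.
  rewrite /W /w; apply: is_derive_eq; rewrite /dW /w /GRing.scale/=; lra.
have dW0 y : y \in `]l, r[ -> dW y <= 0.
  move=> ylr; have Kpy := Kp y ylr.
  have Ey0 : 0 < E y by exact: expR_gt0.
  have Ey1 : E y <= 1.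
    rewrite -expR0 ler_expR; move: ylr; rewrite in_itv/= => /andP[ly _].
    by rewrite mulNr oppr_le0 mulr_ge0// ?subr_ge0 ?ltW//; lra.
  have hd : 2 * d y * (h y + g y) <= K * (p y ^+ 2 + d y ^+ 2).
    apply: (@le_trans _ _ (2 * (`|d y| * (K * `|p y|)))).
      rewrite (le_trans (ler_norm _))// !normrM (ger0_norm (ler0n _ 2)) -mulrA.
      by rewrite ler_pM2l// ler_wpM2l.
    rewrite [leLHS](_ : _ = K * (2 * (`|p y| * `|d y|))); last by ring.
    rewrite ler_wpM2l// -(real_normK (num_real (p y))) -(real_normK (num_real (d y))).
    have := sqr_ge0 (`|p y| - `|d y|); rewrite sqrrB; lra.
  have pd2 : 2 * p y * d y <= p y ^+ 2 + d y ^+ 2.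
    by have := sqr_ge0 (p y - d y); rewrite sqrrB; lra.
  have dg2 : - (2 * d y * g y) <= d y ^+ 2 + g y ^+ 2.
    by have := sqr_ge0 (d y + g y); rewrite sqrrD; lra.
  have : E y * (- (K + 2) * w y + 2 * p y * d y + 2 * d y * h y) <= E y * g y ^+ 2.
    by have := sqr_ge0 (p y); rewrite ler_pM2l// /w; lra.
  have : E y * g y ^+ 2 <= g y ^+ 2 by rewrite ler_piMl// sqr_ge0.
  by rewrite /dW; lra.
have cE : {within `[l, r], continuous E}.
  apply: continuous_subspaceT => y.
  by apply/differentiable_continuous/derivable1_diffP; have [] := dE y.
have cW : {within `[l, r], continuous W}.
  apply: within_sub => //; apply: within_mul => //.
  rewrite (_ : w = fun y => 1 * (p y * p y) + d y * d y); last by apply/funext => y; rewrite /w; ring.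
  by apply: within_comb; exact: within_mul.
have := derive_sign_le lr cW WdW dW0 xlr.
rewrite /W {2}/E subrr mulr0 expR0 mul1r -/(w x) -/(w l) => Wle.
have Ex : E x * w x <= w l + (G x - G l) by lra.
rewrite -[leLHS](mulKf (lt0r_neq0 (expR_gt0 (- (K + 2) * (x - l))))) -/(E x).
have Gx : 0 <= w l + (G x - G l).
  by apply: le_trans Ex; rewrite mulr_ge0 ?expR_ge0// addr_ge0// sqr_ge0.
apply: (@le_trans _ _ ((E x)^-1 * (w l + (G x - G l)))).
  by rewrite ler_wpM2l// invr_ge0 expR_ge0.
rewrite ler_wpM2r// /E -expRN ler_expR mulNr opprK ler_wpM2l//; first lra.
by move: xlr; rewrite in_itv/= => /andP[_]; lra.
Qed.

(** The intervals of radius 2 B / 2^n around u n are nested, and the supremum of their left ends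
    lies in all of them. Limit and rate come together. *)
Lemma geometric_limit (u : nat -> R) (B : R) :
  (forall n, `|u n.+1 - u n| <= B / 2 ^+ n) ->
  exists s, forall n, `|u n - s| <= 2 * B / 2 ^+ n.
Proof.
move=> uB.
have h2 n : 0 < (2:R) ^+ n by rewrite exprn_gt0.
have E n : 2 * B / 2 ^+ n = 2 * (2 * B / 2 ^+ n.+1).
  by rewrite exprS invfM; field; rewrite gt_eqF.
have aS n : u n - 2 * B / 2 ^+ n <= u n.+1 - 2 * B / 2 ^+ n.+1.
  have := uB n; rewrite ler_norml => /andP[+ _]; have := E n; lra.
have bS n : u n.+1 + 2 * B / 2 ^+ n.+1 <= u n + 2 * B / 2 ^+ n.
  have := uB n; rewrite ler_norml => /andP[_]; have := E n; lra.
have B0 n : 0 <= 2 * B / 2 ^+ n.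
  by have := le_trans (normr_ge0 _) (uB n); lra.
have am m n : (m <= n)%N -> u m - 2 * B / 2 ^+ m <= u n - 2 * B / 2 ^+ n.
  elim: n => [|n IH]; first by rewrite leqn0 => /eqP ->.
  rewrite leq_eqVlt => /predU1P[->//|]; rewrite ltnS => /IH/le_trans; apply; exact: aS.
have bm m n : (m <= n)%N -> u n + 2 * B / 2 ^+ n <= u m + 2 * B / 2 ^+ m.
  elim: n => [|n IH]; first by rewrite leqn0 => /eqP ->.
  rewrite leq_eqVlt => /predU1P[->//|]; rewrite ltnS => /IH; apply: le_trans; exact: bS.
have ab m n : u m - 2 * B / 2 ^+ m <= u n + 2 * B / 2 ^+ n.
  have /orP[mn|nm] := leq_total m n.
    by have := am _ _ mn; have := B0 n; lra.
  by have := bm _ _ nm; have := B0 m; lra.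
pose A := [set u n - 2 * B / 2 ^+ n | n in [set: nat]].
exists (sup A) => n.
have hA : has_sup A.
  by split; [exists (u 0%N - 2 * B / 2 ^+ 0), 0%N|exists (u n + 2 * B / 2 ^+ n) => _ [m _ <-]].
have l1 : u n - 2 * B / 2 ^+ n <= sup A by apply: ub_le_sup; [case: hA|exists n].
have l2 : sup A <= u n + 2 * B / 2 ^+ n by apply: sup_le_ub => [|_ [m _ <-]]; [case: hA|].
by rewrite ler_norml; lra.
Qed.

Lemma within_interior l r f x : {within `[l, r], continuous f} ->
  x \in `]l, r[ -> {for x, continuous f}.
Proof.
move=> /withinP cf xlr; apply/cvgrPdist_lt => e e0.
have [d d0 fd] := cf x e (subset_itv_oo_cc xlr) e0.
near=> y; apply: fd.
  by apply: subset_itv_oo_cc; near: y; exact: near_itv_oo.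
by near: y; apply/nbhs_ballP; exists d.
Unshelve. all: by end_near. Qed.

Lemma C1on_int l r F : l <= r -> {within `[l, r], continuous F} ->
  C1on l r (fun x => \int[lebesgue_measure]_(t in `[l, x]) F t) F.
Proof.
move=> lr cF.
have iF : lebesgue_measure.-integrable `[l, r] (EFin \o F).
  by apply: continuous_compact_integrable => //; exact: segment_compact.
split => //; first exact: parameterized_integral_continuous.
move=> x xlr; have : l < x /\ x < r by move: xlr; rewrite in_itv/= => /andP.
move=> [lx xr]; have cx : {for x, continuous F}.
  exact: within_interior cF xlr.
have [dF F'] := @continuous_FTC1 R F (BLeft l) x r xr iF lx cx.
by split; [exact: dF|rewrite -derive1E].
Qed.

Lemma C1on_lip l r f h (e : R) : C1on l r f h ->
  (forall x, x \in `[l, r] -> `|h x| <= e) ->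
  forall x y, x \in `[l, r] -> y \in `[l, r] -> `|f y - f x| <= e * `|y - x|.
Proof.
move=> [cf _ fh] he x y.
wlog xy : x y / x <= y => [W xlr ylr|].
  have /orP[xy|yx] := le_total x y; first exact: W.
  by rewrite distrC (distrC y); exact: W.
rewrite !in_itv/= => /andP[lx xr] /andP[ly yr].
have sub : `[x, y] `<=` `[l, r].
  by move=> z /=; rewrite !in_itv/= => /andP[xz zy]; rewrite (le_trans lx)// (le_trans zy).
have fh' z : z \in `]x, y[ -> is_derive z 1 f (h z).
  rewrite in_itv/= => /andP[xz zy]; apply: fh.
  by rewrite in_itv/= (le_lt_trans lx)//= (lt_le_trans zy).
have [z zxy ->] := MVT_segment xy fh' (continuous_subspaceW sub cf).
by rewrite normrM ler_wpM2r// he//; exact: sub.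
Qed.

Lemma C1on_lipB l r f h g k (e : R) : C1on l r f h -> C1on l r g k ->
  (forall x, x \in `[l, r] -> `|h x - k x| <= e) ->
  forall x y, x \in `[l, r] -> y \in `[l, r] ->
  `|f y - f x - (g y - g x)| <= e * `|y - x|.
Proof.
move=> fh gk hk x y xlr ylr.
rewrite (_ : _ - _ = (-1 * g y + f y) - (-1 * g x + f x)); last by ring.
apply: (C1on_lip (C1on_comb (-1) gk fh)) => // z zlr.
by rewrite mulN1r addrC; exact: hk.
Qed.

Lemma dist_of_is_derive f x (df : R) : is_derive x 1 f df ->
  forall e : R, 0 < e -> \forall y \near x, `|f y - f x - df * (y - x)| <= e * `|y - x|.
Proof.
move=> /is_derive1_caratheodory[g [fg cg <-]] e e0.
near=> y; rewrite fg -mulrBl normrM ler_wpM2r// distrC ltW//.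
by near: y; move/cvgrPdist_lt : cg; exact.
Unshelve. all: by end_near. Qed.

Lemma is_derive_of_dist f x (df : R) :
  (forall e : R, 0 < e -> \forall y \near x, `|f y - f x - df * (y - x)| <= e * `|y - x|) ->
  is_derive x 1 f df.
Proof.
move=> H; apply/is_derive1_caratheodory.
exists (fun z => if z == x then df else (f z - f x) / (z - x)); split => [z||]; last by rewrite eqxx.
  by case: eqVneq => [->|zx]; rewrite ?subrr ?mulr0// divfK// subr_eq0.
apply/cvgrPdist_le => e e0; rewrite eqxx.
apply: filterS (H e e0) => y; case: eqVneq => [_ _|yx fy]; first by rewrite subrr normr0 ltW.
have yx0 : 0 < `|y - x| by rewrite normr_gt0 subr_eq0.
have yx1 : y - x != 0 by rewrite subr_eq0.
rewrite (_ : df - _ = - ((f y - f x - df * (y - x)) / (y - x))); last by field.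
by rewrite normrN normrM normfV ler_pdivrMr.
Qed.

(** Increments are compared instead of values: uniform convergence of the derivatives controls them
    by a multiple of |y - x|, which is what both continuity and differentiability of the limit
    require. *)
Lemma C1on_lim l r (u du : nat -> R -> R) f h :
  (forall n, C1on l r (u n) (du n)) ->
  (forall x, x \in `[l, r] -> u ^~ x @ \oo --> f x) ->
  (forall e : R, 0 < e -> exists N, forall n, (N <= n)%N ->
     forall x, x \in `[l, r] -> `|du n x - h x| <= e) ->
  C1on l r f h.
Proof.
move=> udu uf duh.
(* The mean value inequality for u m - u n, in which m then tends to infinity; pointwise convergence
   of u suffices for this. *)
have lip (e : R) : 0 < e -> exists N, forall n, (N <= n)%N -> (forall x, x \in `[l, r] -> `|du n x - h x| <= e) /\ forall x y, x \in `[l, r] ->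
    y \in `[l, r] -> `|(f y - f x) - (u n y - u n x)| <= e * `|y - x|.
  move=> e0; have [N NH] := duh (e / 2) (divr_gt0 e0 (ltr0n _ 2)).
  exists N => n Nn; split; first by move=> x xlr; rewrite (le_trans (NH _ Nn _ xlr))//; lra.
  move=> x y xlr ylr.
  have cv : (fun m => `|(u m y - u m x) - (u n y - u n x)|) @ \oo -->
      `|(f y - f x) - (u n y - u n x)|.
    apply: cvg_norm; apply: cvgB; last exact: cvg_cst.
    by apply: cvgB; exact: uf.
  apply: (ler_cvg_to (g := fun=> e * `|y - x|) cv); first exact: cvg_cst.
  exists N => // m /= Nm.
  apply: (C1on_lipB (udu m) (udu n) _ xlr ylr) => z zlr.
  rewrite [X in `|X|](_ : _ = (du m z - h z) - (du n z - h z)); last by ring.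
  by rewrite (le_trans (ler_normB _ _))//; have := NH _ Nm z zlr; have := NH _ Nn z zlr; lra.
have cf : {within `[l, r], continuous f}.
  apply/withinP => x e xlr e0; have [N NH] := lip 1 ltr01.
  have [_ {}NH] := NH _ (leqnn N).
  have [/withinP/(_ x (e / 2) xlr (divr_gt0 e0 (ltr0n _ 2)))[d d0 Hd] _ _] := udu N.
  exists (Num.min d (e / 2)); first by rewrite lt_min d0 divr_gt0.
  move=> y ylr; rewrite lt_min => /andP[xyd xye].
  have := NH y x ylr xlr; have := Hd y ylr xyd.
  rewrite mul1r => H1 H2.
  rewrite [X in `|X|](_ : _ = (f x - f y - (u N x - u N y)) + (u N x - u N y)); last by ring.
  by rewrite (le_lt_trans (ler_normD _ _))//; lra.
have ch : {within `[l, r], continuous h}.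
  apply/withinP => x e xlr e0; have [N NH] := lip (e / 3) (divr_gt0 e0 (ltr0n _ 3)).
  have [{}NH _] := NH _ (leqnn N).
  have [_ /withinP/(_ x (e / 3) xlr (divr_gt0 e0 (ltr0n _ 3)))[d d0 Hd] _] := udu N.
  exists d => // y ylr xyd; have := Hd y ylr xyd; have := NH y ylr; have := NH x xlr.
  rewrite -(normrN (du N x - h x)) => H1 H2 H3.
  rewrite [X in `|X|](_ : _ = - (du N x - h x) + (du N y - h y) + (du N x - du N y)); last by ring.
  by rewrite (le_lt_trans (ler_normD _ _))//; have := ler_normD (- (du N x - h x)) (du N y - h y); lra.
split=> // x xlr; apply: is_derive_of_dist => e e0.
have xlr' : x \in `[l, r] by exact: subset_itv_oo_cc.
have [N NH] := lip (e / 3) (divr_gt0 e0 (ltr0n _ 3)).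
have [NH1 NH2] := NH _ (leqnn N).
have [_ _ /(_ x xlr) ud] := udu N.
have /(_ (e / 3) (divr_gt0 e0 (ltr0n _ 3))) := dist_of_is_derive ud.
apply: filterS2 (near_itv_oo xlr) => y /subset_itv_oo_cc ylr H.
have H1 : `|(du N x - h x) * (y - x)| <= e / 3 * `|y - x|.
  by rewrite normrM ler_wpM2r// NH1.
have H2 := NH2 x y xlr' ylr.
rewrite [X in `|X|](_ : _ = (f y - f x - (u N y - u N x)) + (u N y - u N x - du N x * (y - x)) + (du N x - h x) * (y - x)); last by ring.
rewrite (le_trans (ler_normD _ _))// (le_trans (lerD (ler_normD _ _) (lexx _)))//.
rewrite [X in _ <= X](_ : _ = e / 3 * `|y - x| + e / 3 * `|y - x| + e / 3 * `|y - x|); last by field.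
by rewrite !lerD.
Qed.

(** In the open interval k - h is the derivative of the zero function; continuity carries the
    equality to the endpoints. *)
Lemma C1on_uniq l r f h k : l < r -> C1on l r f h -> C1on l r f k ->
  {in `[l, r], h =1 k}.
Proof.
move=> lr fh fk.
have [_ chk hk0] : C1on l r (fun x => -1 * f x + f x) (fun x => -1 * h x + k x) by exact: C1on_comb.
have hk x : x \in `]l, r[ -> -1 * h x + k x = 0.
  move=> /hk0 H; rewrite -(@derive_val _ _ _ _ _ _ _ H).
  rewrite (_ : (fun _ => _) = cst 0) ?derive_cst//.
  by apply/funext => y /=; ring.
move=> x xlr; suff: -1 * h x + k x = 0 by lra.
apply/eqP; rewrite -normr_le0; apply/ler_addgt0Pr => e e0; rewrite add0r.
have /withinP/(_ x e xlr e0)[d d0 Hd] := chk.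
(* x is moved towards the middle of the segment; a third of min(d, r - l) cannot overshoot. *)
have [y [ylr xyd]] : exists y, (y \in `]l, r[) /\ (`|x - y| < d).
  move: xlr; rewrite in_itv/= => /andP[lx xr].
  have m0 : 0 < Num.min d (r - l) by rewrite lt_min d0 subr_gt0.
  have md : Num.min d (r - l) <= d by rewrite ge_min lexx.
  have mr : Num.min d (r - l) <= r - l by rewrite ge_min lexx orbT.
  have [xm|xm] := leP x ((l + r) / 2).
    exists (x + Num.min d (r - l) / 3); rewrite in_itv/=; split; first by apply/andP; split; lra.
    by rewrite ltr_norml; apply/andP; split; lra.
  exists (x - Num.min d (r - l) / 3); rewrite in_itv/=; split; first by apply/andP; split; lra.
  by rewrite ltr_norml; apply/andP; split; lra.
by have := Hd y (subset_itv_oo_cc ylr) xyd; rewrite (hk _ ylr) subr0 => /ltW.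
Qed.

(** In the sup norm weighted by exp(k (x - l)), integration gains a factor 1 / k. This makes Picard
    iteration contract on the whole segment, whatever its length. *)
Lemma C1on_exp_bound l r G F (k B : R) : l <= r -> 0 < k -> 0 <= B ->
  C1on l r G F -> G l = 0 ->
  (forall x, x \in `]l, r[ -> `|F x| <= B * expR (k * (x - l))) ->
  forall x, x \in `[l, r] -> `|G x| <= B / k * expR (k * (x - l)).
Proof.
move=> lr k0 B0 [cG _ GF] G0 FB.
pose E x := B / k * expR (k * (x - l)).
have dE x : is_derive x 1 E (B * expR (k * (x - l))).
  rewrite /E; apply: is_derive_eq; rewrite /GRing.scale/=; field.
  by rewrite gt_eqF.
have cE : {within `[l, r], continuous E}.
  apply: continuous_subspaceT => y.
  by apply/differentiable_continuous/derivable1_diffP; have [] := dE y.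
have El : 0 <= E l by rewrite mulr_ge0 ?expR_ge0// divr_ge0// ltW.
have H (s : R) : `|s| = 1 -> forall x, x \in `[l, r] -> s * G x <= E x.
  move=> s1 x xlr.
  have := @derive_sign_le l r (fun x => s * G x - E x) (fun x => s * F x - B * expR (k * (x - l))) lr _ _ _ x xlr.
  rewrite G0 mulr0 sub0r => H; suff : s * G x - E x <= - E l by lra.
  apply: H.
  - by apply: within_sub => //; apply: within_mul => //; exact: within_cst.
  - move=> y ylr; have := GF y ylr => ?; have := dE y => ?.
    by apply: is_deriveB; apply: is_deriveZ.
  move=> y /FB; have : s * F y <= `|F y|.
    by rewrite (le_trans (ler_norm _))// normrM s1 mul1r.
  lra.
move=> x xlr; rewrite -/(E x) ler_norml.
have := H 1 (normr1 _) x xlr; have := H (-1) (normrN1 _) x xlr; lra.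
Qed.

(** Picard iteration for the system y' = z, z' = Q y - g, started at the constants y0, z0. *)
Lemma linear_ode_exists l r (Q g : R -> R) (y0 z0 : R) : l <= r ->
  {within `[l, r], continuous Q} -> {within `[l, r], continuous g} ->
  exists (y z : R -> R), [/\ C1on l r y z, C1on l r z (fun x => Q x * y x - g x), y l = y0 & z l = z0].
Proof.
move=> lr cQ cg.
pose I F x := \int[lebesgue_measure]_(t in `[l, x]) F t.
have Il F : I F l = 0 by rewrite /I set_itv1 Rintegral_set1.
pose step (u : (R -> R) * (R -> R)) : (R -> R) * (R -> R) :=
  (fun x => 1 * I u.2 x + y0, fun x => 1 * I (fun x => Q x * u.1 x - g x) x + z0).
pose u := fix u n := if n is m.+1 then step (u m) else ((fun=> y0), (fun=> z0)).
have C1 F s : {within `[l, r], continuous F} -> C1on l r (fun x => 1 * I F x + s) F.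
  move=> cF; have H := C1on_cst l r s.
  apply: C1on_ext (C1on_comb 1 (C1on_int lr cF) H) _ _ => // x _; ring.
have cu n : {within `[l, r], continuous (u n).1} /\ {within `[l, r], continuous (u n).2}.
  elim: n => [|n [IH1 IH2]] /=; first by split; exact: within_cst.
  have c3 : {within `[l, r], continuous (fun x => Q x * (u n).1 x - g x)}.
    by apply: within_sub => //; exact: within_mul.
  by have [] := C1 _ y0 IH2; have [] := C1 _ z0 c3.
have cQu n : {within `[l, r], continuous (fun x => Q x * (u n).1 x - g x)}.
  by apply: within_sub => //; apply: within_mul => //; exact: (cu n).1.
have u1 n : C1on l r (u n.+1).1 (u n).2 by apply: C1; exact: (cu n).2.
have u2 n : C1on l r (u n.+1).2 (fun x => Q x * (u n).1 x - g x) by exact: C1.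
have ul n : (u n).1 l = y0 /\ (u n).2 l = z0.
  by case: n => [|n] //=; rewrite !Il !mulr0 !add0r.
have [M M0 QM] := cont_bounded cQ.
have [B1 B10 HB1] := cont_bounded (within_sub (cu 1).1 (cu 0).1).
have [B2 B20 HB2] := cont_bounded (within_sub (cu 1).2 (cu 0).2).
(* With this rate each step halves the weighted increment: 1 is the Lipschitz constant of y' = z and
   M that of z' = Q y - g. B bounds the first increment. *)
pose B := Num.max B1 B2; pose k := 2 * Num.max 1 M.
have B0 : 0 < B by rewrite lt_max B10.
have k0 : 0 < k by rewrite mulr_gt0// lt_max ltr01.
have kM : M <= k / 2 by rewrite /k mulrC mulKf// le_max lexx orbT.
have k2 : 1 <= k / 2 by rewrite /k mulrC mulKf// le_max lexx.
have ub n x : x \in `[l, r] ->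
    `|(u n.+1).1 x - (u n).1 x| <= B / 2 ^+ n * expR (k * (x - l)) /\
    `|(u n.+1).2 x - (u n).2 x| <= B / 2 ^+ n * expR (k * (x - l)).
  elim: n x => [|n IH] x xlr.
    rewrite expr0 divr1.
    have e1 : 1 <= expR (k * (x - l)).
      rewrite -expR0 ler_expR mulr_ge0 ?(ltW k0)// subr_ge0.
      by move: xlr; rewrite in_itv/= => /andP[].
    have Be : B <= B * expR (k * (x - l)) by rewrite ler_peMr// ltW.
    have := HB1 x xlr; have := HB2 x xlr.
    have : B1 <= B by rewrite le_max lexx.
    have : B2 <= B by rewrite le_max lexx orbT.
    by split; lra.
  have Bn : 0 <= B / 2 ^+ n by rewrite divr_ge0 ?exprn_ge0// ltW.
  have En : B / 2 ^+ n.+1 = (k / 2) * (B / 2 ^+ n) / k.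
    have kn0 : k != 0 := lt0r_neq0 k0.
    have pn0 : (2 : R) ^+ n != 0 by rewrite expf_neq0.
    by rewrite exprS; field; rewrite kn0 pn0.
  rewrite En; split.
  - rewrite (_ : _ - _ = -1 * (u n.+1).1 x + (u n.+2).1 x); last by ring.
    apply: (C1on_exp_bound lr k0 _ (C1on_comb (-1) (u1 n) (u1 n.+1))) => //; first by rewrite mulr_ge0// divr_ge0// ltW.
    + by rewrite /= !Il; ring.
    move=> y /subset_itv_oo_cc ylr.
    rewrite [X in `|X|](_ : _ = (u n.+1).2 y - (u n).2 y); last by ring.
    apply: (le_trans (IH y ylr).2); rewrite ler_wpM2r ?expR_ge0//.
    by rewrite ler_peMl.
  - rewrite (_ : _ - _ = -1 * (u n.+1).2 x + (u n.+2).2 x); last by ring.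
    apply: (C1on_exp_bound lr k0 _ (C1on_comb (-1) (u2 n) (u2 n.+1))) => //; first by rewrite mulr_ge0// divr_ge0// ltW.
    + by rewrite /= !Il; ring.
    move=> y /subset_itv_oo_cc ylr.
    rewrite [X in `|X|](_ : _ = Q y * ((u n.+1).1 y - (u n).1 y)); last by ring.
    have H1 := (IH y ylr).1; have H2 := le_trans (QM y ylr) kM.
    by rewrite normrM -[leRHS]mulrA ler_pM.
pose B' := B * expR (k * (r - l)).
have ub' n x : x \in `[l, r] ->
    `|(u n.+1).1 x - (u n).1 x| <= B' / 2 ^+ n /\ `|(u n.+1).2 x - (u n).2 x| <= B' / 2 ^+ n.
  move=> xlr; have [H1 H2] := ub n x xlr.
  suff H : B / 2 ^+ n * expR (k * (x - l)) <= B' / 2 ^+ n.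
    by split; [exact: le_trans H1 H|exact: le_trans H2 H].
  rewrite /B' mulrAC ler_wpM2r ?invr_ge0 ?exprn_ge0// ler_wpM2l ?(ltW B0)//.
  rewrite ler_expR ler_pM2l// lerD2r.
  by move: xlr; rewrite in_itv/= => /andP[].
have /choice[y Hy] : forall x, exists s : R, x \in `[l, r] -> forall n, `|(u n).1 x - s| <= 2 * B' / 2 ^+ n.
  move=> x.
  have [xlr|xlr] := boolP (x \in `[l, r]); last by exists 0.
  have [s Hs] := @geometric_limit (fun n => (u n).1 x) B' (fun n => (ub' n x xlr).1).
  by exists s.
have /choice[z Hz] : forall x, exists s : R, x \in `[l, r] -> forall n, `|(u n).2 x - s| <= 2 * B' / 2 ^+ n.
  move=> x.
  have [xlr|xlr] := boolP (x \in `[l, r]); last by exists 0.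
  have [s Hs] := @geometric_limit (fun n => (u n).2 x) B' (fun n => (ub' n x xlr).2).
  by exists s.
have small (C e : R) : 0 < e -> exists N, forall n, (N <= n)%N -> C / 2 ^+ n <= e.
  move=> e0; have h1 : `|2^-1 : R| < 1 by rewrite ger0_norm// invf_lt1// ltr1n.
  have /cvgrPdist_le/(_ e e0)[N _ HN] := cvg_geometric C h1.
  exists N => n Nn; have := HN n Nn; rewrite /geometric/= sub0r normrN exprVn.
  exact: le_trans (ler_norm _).
have ptw (v : nat -> R) s : (forall n, `|v n - s| <= 2 * B' / 2 ^+ n) -> (fun n => v n.+1) @ \oo --> s.
  move=> H; apply/cvgrPdist_le => e e0; have [N HN] := small (2 * B') e e0.
  by exists N => // n /= Nn; rewrite distrC (le_trans (H n.+1))// HN// ltnW.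
have lxr : l \in `[l, r] by rewrite in_itv/= lexx.
have u0 (v : nat -> R) s t : (forall n, `|v n - s| <= 2 * B' / 2 ^+ n) -> (forall n, v n = t) -> s = t.
  move=> /ptw vs vt; rewrite (_ : (fun n => v n.+1) = cst t) in vs; last by apply/funext => n; exact: vt.
  by apply: (cvg_unique _ vs); [exact: Rhausdorff|exact: cvg_cst].
exists y, z; split.
- apply: (@C1on_lim l r (fun n => (u n.+1).1) (fun n => (u n).2)) => // [x xlr|e e0].
    exact: (ptw (fun n => (u n).1 x) (y x) (Hy x xlr)).
  have [N HN] := small (2 * B') e e0; exists N => n Nn x xlr.
  exact: le_trans (Hz x xlr n) (HN n Nn).
- apply: (@C1on_lim l r (fun n => (u n.+1).2) (fun n x => Q x * (u n).1 x - g x)) => // [x xlr|e e0].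
    exact: (ptw (fun n => (u n).2 x) (z x) (Hz x xlr)).
  have [N HN] := small (2 * B' * M) e e0; exists N => n Nn x xlr.
  rewrite (_ : _ - _ = ((u n).1 x - y x) * Q x); last by ring.
  rewrite normrM (le_trans _ (HN n Nn))// mulrAC ler_pM//; [exact: Hy|exact: QM].
- exact: (u0 _ _ _ (Hy l lxr) (fun n => (ul n).1)).
- exact: (u0 _ _ _ (Hz l lxr) (fun n => (ul n).2)).
Qed.

End C1on.

(** * Integration on segments and primitives of integrable functions *)

Section Integration.
Context {R : realType}.
Implicit Types (l r x : R) (f g h k : R -> R).
Local Notation mu := (@lebesgue_measure R).
Local Notation intg l r f := (mu.-integrable `[l, r] (EFin \o f)).
Local Notation "'Int' l r f" := (\int[mu]_(t in `[l, r]) f t) (at level 10, l, r, f at level 9).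

Lemma C1on_mul l r f h g k : C1on l r f h -> C1on l r g k ->
  C1on l r (fun x => f x * g x) (fun x => 1 * (h x * g x) + f x * k x).
Proof.
move=> [cf ch fh] [cg ck gk]; split; first exact: within_mul.
  by apply: within_comb; exact: within_mul.
move=> x xlr; have := fh x xlr; have := gk x xlr => ? ?.
by apply: is_derive_eq; rewrite /GRing.scale/=; ring.
Qed.

Lemma C1on_ftc l r f h : l <= r -> C1on l r f h -> Int l r h = f r - f l.
Proof.
move=> lr fh; have [_ ch _] := fh; have Ih := C1on_int lr ch.
have lr1 : l \in `[l, r] by rewrite in_itv/= lexx.
have lr2 : r \in `[l, r] by rewrite in_itv/= lexx andbT.
have := C1on_lipB (e := 0) fh Ih _ lr1 lr2.
rewrite mul0r set_itv1 Rintegral_set1 subr0 normr_le0 => H.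
by apply/esym/eqP; rewrite -subr_eq0; apply: H => x _; rewrite subrr normr0.
Qed.

Lemma within_measurable l r f : {within `[l, r], continuous f} -> measurable_fun `[l, r] f.
Proof. by move=> cf; apply: subspace_continuous_measurable_fun. Qed.

Lemma within_intg l r f : {within `[l, r], continuous f} -> intg l r f.
Proof.
by move=> cf; apply: continuous_compact_integrable => //; exact: segment_compact.
Qed.

Lemma intgP l r f g : measurable_fun `[l, r] f -> intg l r g ->
  (forall x, x \in `[l, r] -> `|f x| <= g x) -> intg l r f.
Proof.
move=> mf ig fg; apply: le_integrable ig => //; first exact/measurable_EFinP.
by move=> x /fg H; rewrite /= lee_fin (le_trans H)// ler_norm.
Qed.

Lemma intg_measurable l r f : intg l r f -> measurable_fun `[l, r] f.
Proof. by move=> /integrableP[/measurable_EFinP]. Qed.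

Lemma intg_comb l r (s : R) f g : intg l r f -> intg l r g ->
  intg l r (fun x => s * f x + g x).
Proof.
move=> fi gi; have := integrableD _ (integrableZl _ s fi) gi.
by apply.
Qed.

Lemma intg_norm l r f : intg l r f -> intg l r (fun x => `|f x|).
Proof. by move=> fi; exact: integrable_norm fi. Qed.

Lemma intg_mulc l r f g : intg l r f -> {within `[l, r], continuous g} ->
  intg l r (fun x => f x * g x).
Proof.
move=> fi cg; have [M M0 gM] := cont_bounded cg.
apply: (@intgP _ _ _ (fun x => M * `|f x| + 0)).
- by apply: measurable_funM; [exact: intg_measurable|exact: within_measurable].
- apply: intg_comb; first exact: intg_norm.
  by apply: within_intg; exact: within_cst.
by move=> x /gM gx; rewrite addr0 normrM mulrC ler_wpM2r.
Qed.

Lemma Int_comb l r (s : R) f g : intg l r f -> intg l r g ->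
  Int l r (fun x => s * f x + g x) = s * Int l r f + Int l r g.
Proof.
move=> fi gi; rewrite RintegralD//; first by rewrite RintegralZl.
by have := integrableZl _ s fi; apply.
Qed.

Lemma Int_le l r f g : intg l r f -> intg l r g ->
  (forall x, x \in `[l, r] -> f x <= g x) -> Int l r f <= Int l r g.
Proof. by move=> fi gi fg; apply: le_Rintegral. Qed.

Lemma Int_eq l r f g : {in `[l, r], f =1 g} -> Int l r f = Int l r g.
Proof. by move=> fg; apply: eq_Rintegral => x; rewrite inE => /fg. Qed.

Lemma Int_norm l r f : intg l r f -> `|Int l r f| <= Int l r (fun x => `|f x|).
Proof. by move=> fi; apply: le_normr_Rintegral. Qed.

Lemma intg_sub l r x f : intg l r f -> x \in `[l, r] -> intg l x f.
Proof.
move=> fi; rewrite in_itv/= => /andP[lx xr]; apply: integrableS fi => //.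
by apply: subset_itvl; rewrite bnd_simp.
Qed.

Lemma Int_sub_le l r x f : intg l r f -> x \in `[l, r] ->
  (forall x, x \in `[l, r] -> 0 <= f x) -> Int l x f <= Int l r f.
Proof.
move=> fi xlr f0; have [lx xr] : l <= x /\ x <= r by move: xlr; rewrite in_itv/= => /andP.
rewrite -subr_ge0 Rintegral_itvB ?bnd_simp//.
apply: Rintegral_ge0 => y /=; rewrite in_itv/= => /andP[xy yr]; apply: f0.
by rewrite in_itv/= yr (le_trans lx (ltW xy)).
Qed.

(** Absolute continuity in the form used by the analysis; h is determined only almost everywhere. *)
Definition primitive_on l r f h : Prop := intg l r h /\
  forall x, x \in `[l, r] -> f x = f l + Int l x h.

Lemma C1on_primitive l r f h : C1on l r f h -> primitive_on l r f h.
Proof.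
move=> fh; have [_ ch _] := fh; split; first exact: within_intg.
move=> x; rewrite in_itv/= => /andP[lx xr].
rewrite (@C1on_ftc l x f h lx) ?subrKC//; move: fh => [cf _ fh].
have sub : `[l, x] `<=` `[l, r] by apply: subset_itvl; rewrite bnd_simp.
split; [exact: continuous_subspaceW cf|exact: continuous_subspaceW ch|].
by move=> y; rewrite in_itv/= => /andP[ly yx]; apply: fh; rewrite in_itv/= ly (lt_le_trans yx).
Qed.

Lemma primitive_C1on l r f h : l <= r -> primitive_on l r f h ->
  {within `[l, r], continuous h} -> C1on l r f h.
Proof.
move=> lr [hi fh] ch.
have H := C1on_cst l r (f l).
apply: C1on_ext (C1on_comb 1 (C1on_int lr ch) H) _ _ => // x xlr; last by ring.
by rewrite [in RHS]fh//; ring.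
Qed.

Lemma primitive_comb l r (s : R) f h g k : primitive_on l r f h -> primitive_on l r g k ->
  primitive_on l r (fun x => s * f x + g x) (fun x => s * h x + k x).
Proof.
move=> [hi fh] [ki gk]; split; first exact: intg_comb.
move=> x xlr; rewrite Int_comb; [|exact: intg_sub hi xlr|exact: intg_sub ki xlr].
by rewrite fh// gk//; ring.
Qed.

Lemma primitive_ext l r f h g k : primitive_on l r f h ->
  {in `[l, r], f =1 g} -> {in `[l, r], h =1 k} -> primitive_on l r g k.
Proof.
move=> [hi fh] fg hk; split.
  apply: eq_integrable hi => // x; rewrite inE => /hk; by move=> /= ->.
move=> x xlr; have [lx xr] : l <= x /\ x <= r by move: xlr; rewrite in_itv/= => /andP.
have ll : l \in `[l, r] by rewrite in_itv/= lexx (le_trans lx).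
rewrite -(fg x xlr) -(fg l ll) (fh x xlr); congr (_ + _); apply: Int_eq => y; rewrite in_itv/= => /andP[ly yx]; apply: hk.
by rewrite in_itv/= ly (le_trans yx).
Qed.

Lemma primitive_cont l r f h : l <= r -> primitive_on l r f h -> {within `[l, r], continuous f}.
Proof.
move=> lr [hi fh].
have c := within_comb (s := 1) (parameterized_integral_continuous lr hi) (@within_cst R l r (f l)).
apply: subspace_eq_continuous c => x; rewrite inE => xlr.
have -> : from_subspace `[l, r] f x = f x by [].
by rewrite (fh x xlr) addrC -[X in X + _]mul1r.
Qed.

Lemma L1_approx l r h (e : R) : intg l r h -> 0 < e ->
  exists2 g, {within `[l, r], continuous g} & Int l r (fun x => `|h x - g x|) <= e.
Proof.
move=> hi e0.
have mE : measurable (`[l, r]%classic : set R) by exact: measurable_itv.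
have fE : (mu `[l, r]%classic < +oo)%E.
  by rewrite /= lebesgue_measure_itv; case: ifP => _; rewrite ?ltry// -EFinB ltry.
have [g [cg gi /fine_cvgP[_ /cvgrPdist_le/(_ e e0)[N _ /(_ N (leqnn N)) HN]]]] := approximation_continuous_integrable mE fE hi.
exists (g N); first exact: continuous_subspaceT.
by move: HN; rewrite /= sub0r normrN; exact: le_trans (ler_norm _).
Qed.

(** The formula is the product rule when h is continuous. In general h is approximated in L1 by a
    continuous h', which moves f uniformly by at most the same error. *)
Lemma primitive_ibp l r f h g k : l <= r -> primitive_on l r f h -> C1on l r g k ->
  Int l r (fun x => h x * g x) = f r * g r - f l * g l - Int l r (fun x => f x * k x).
Proof.
move=> lr [hi fh] gk; have [cg ck _] := gk.
have cf : {within `[l, r], continuous f} by exact: (@primitive_cont _ _ _ h).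
have [M M0 gM] := cont_bounded cg.
have [lxr rxr] : l \in `[l, r] /\ r \in `[l, r] by rewrite !in_itv/= !lexx lr.
have iM : intg l r (fun=> M) by apply: within_intg; exact: within_cst.
set D := LHS; set E := RHS.
apply/eqP; rewrite -subr_eq0 -normr_le0; apply/ler_addgt0Pr => e e0; rewrite add0r.
(* One summand for each error, namely in h g, in the boundary term at r and in f k; the 1 makes C
   positive. *)
pose C := M + `|g r| + Int l r (fun x => `|k x|) + 1.
have C0 : 0 < C.
  have : 0 <= Int l r (fun x => `|k x|) by apply: Rintegral_ge0.
  by move=> k0; rewrite /C ltr_pwDr// !addr_ge0// ltW.
have [h' ch' hh'] := L1_approx hi (divr_gt0 e0 C0).
set e' := e / C in hh'; have e'0 : 0 < e' by exact: divr_gt0.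
(* Starting the approximation at f l leaves no error in the boundary term at l. *)
pose f' x := 1 * Int l x h' + f l.
have f'h' : C1on l r f' h'.
  have H := C1on_cst l r (f l).
  by apply: C1on_ext (C1on_comb 1 (C1on_int lr ch') H) _ _ => // x _; ring.
have cf' : {within `[l, r], continuous f'} by case: f'h'.
have f'l : f' l = f l by rewrite /f' set_itv1 Rintegral_set1; ring.
have ff' x : x \in `[l, r] -> `|f x - f' x| <= e'.
  move=> xlr; apply: le_trans hh'; rewrite fh//.
  have hxi := intg_sub hi xlr; have hx'i := intg_sub (within_intg ch') xlr.
  rewrite (_ : _ - _ = -1 * Int l x h' + Int l x h); last by rewrite /f'; ring.
  rewrite -Int_comb// (le_trans (Int_norm (intg_comb _ _ _)))//.
  rewrite (Int_eq (g := fun x => `|h x - h' x|)); last by move=> y _; congr (`|_|); ring.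
  apply: Int_sub_le => //.
  apply: intg_norm; apply: eq_integrable (intg_comb (-1) (within_intg ch') hi) => //.
  by move=> y _ /=; congr (_%:E); ring.
have := C1on_ftc lr (C1on_mul f'h' gk).
have ih'g : intg l r (fun x => h' x * g x) by apply: within_intg; exact: within_mul.
have if'k : intg l r (fun x => f' x * k x) by apply: within_intg; exact: within_mul.
have ihg : intg l r (fun x => h x * g x) by exact: intg_mulc.
have ifk : intg l r (fun x => f x * k x) by apply: within_intg; exact: within_mul.
rewrite Int_comb// f'l mul1r => Eq.
have H1 : `|-1 * Int l r (fun x => h' x * g x) + D| <= M * e'.
  rewrite -Int_comb// (le_trans (Int_norm (intg_comb _ _ _)))//.
  have ihh' : intg l r (fun x => `|h x - h' x|).
    apply: intg_norm; apply: eq_integrable (intg_comb (-1) (within_intg ch') hi) => //.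
    by move=> y _ /=; congr (_%:E); ring.
  apply: (@le_trans _ _ (Int l r (fun x => M * `|h x - h' x| + 0))).
    apply: Int_le.
    - by apply: intg_norm; exact: intg_comb.
    - by apply: intg_comb => //; apply: within_intg; exact: within_cst.
    move=> x xlr; rewrite (_ : _ + _ = g x * (h x - h' x)); last by ring.
    by rewrite normrM addr0 ler_wpM2r// gM.
  rewrite Int_comb//; last by apply: within_intg; exact: within_cst.
  rewrite (_ : Int l r (fun=> 0) = 0); last by rewrite Rintegral_cst// mul0r.
  by rewrite addr0 ler_pM2l.
have H2 : `|-1 * Int l r (fun x => f' x * k x) + Int l r (fun x => f x * k x)| <= e' * Int l r (fun x => `|k x|).
  rewrite -Int_comb// (le_trans (Int_norm (intg_comb _ _ _)))//.
  have ik := intg_norm (within_intg ck).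
  have i0 : intg l r (fun=> 0) by apply: within_intg; exact: within_cst.
  apply: (@le_trans _ _ (Int l r (fun x => e' * `|k x| + 0))).
    apply: Int_le; [by apply: intg_norm; exact: intg_comb|exact: intg_comb|].
    move=> x xlr; rewrite (_ : _ + _ = (f x - f' x) * k x); last by ring.
    by rewrite normrM addr0 ler_wpM2r// ff'.
  by rewrite Int_comb// (_ : Int l r (fun=> 0) = 0) ?addr0// Rintegral_cst// mul0r.
have H3 : `|(f r - f' r) * g r| <= e' * `|g r| by rewrite normrM ler_wpM2r// ff'.
have -> : D - E = (-1 * Int l r (fun x => h' x * g x) + D) - (f r - f' r) * g r + (-1 * Int l r (fun x => f' x * k x) + Int l r (fun x => f x * k x)).
  by rewrite (canRL (addrK _) Eq) /E; ring.
have -> : e = M * e' + e' * `|g r| + e' * Int l r (fun x => `|k x|) + e'.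
  by rewrite -[LHS](divfK (lt0r_neq0 C0)) -/e' /C; ring.
apply: (le_trans (ler_normD _ _)); rewrite -[leLHS]addr0; apply: lerD (ltW e'0).
apply: lerD H2; exact: le_trans (ler_normB _ _) (lerD H1 H3).
Qed.

Definition L2on l r f : Prop := measurable_fun `[l, r] f /\ intg l r (fun x => f x ^+ 2).

Lemma L2_mul l r f g : L2on l r f -> L2on l r g -> intg l r (fun x => f x * g x).
Proof.
move=> [mf fi] [mg gi]; apply: (@intgP _ _ _ (fun x => 1 * f x ^+ 2 + g x ^+ 2)).
- exact: measurable_funM.
- exact: intg_comb.
move=> x _; rewrite normrM -(real_normK (num_real (f x))) -(real_normK (num_real (g x))).
have := sqr_ge0 (`|f x| - `|g x|); rewrite sqrrB.
have := mulr_ge0 (normr_ge0 (f x)) (normr_ge0 (g x)); lra.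
Qed.

Lemma L2_cont l r f : {within `[l, r], continuous f} -> L2on l r f.
Proof.
move=> cf; split; first exact: within_measurable.
rewrite (_ : (fun _ => _) = fun x => f x * f x); last by apply/funext => x; rewrite expr2.
by apply: within_intg; exact: within_mul.
Qed.

Lemma L2_comb l r (s : R) f g : L2on l r f -> L2on l r g -> L2on l r (fun x => s * f x + g x).
Proof.
move=> fi gi; have [mf f2] := fi; have [mg g2] := gi; split.
  by apply: measurable_funD => //; apply: measurable_funM.
have := intg_comb 1 (intg_comb (s ^+ 2) f2 g2) (intg_comb (2 * s) (L2_mul fi gi) (within_intg (@within_cst R l r 0))).
by apply: eq_integrable => // x _ /=; congr (_%:E); ring.
Qed.

End Integration.

(** * Absolutely continuous functions are primitives *)

Section AbsoluteContinuity.
Context {R : realType}.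
Implicit Types (l r : R) (f h : R -> R) (L : seq (R * R)).
Local Notation mu := (@lebesgue_measure R).

Definition apart (p q : R * R) := (p.2 <= q.1) || (q.2 <= p.1).

Definition itv_family l r L : bool :=
  all (fun p => [&& p.1 \in `[l, r], p.2 \in `[l, r] & p.1 <= p.2]) L && pairwise apart L.

Definition total_length L := \sum_(p <- L) (p.2 - p.1).

Definition family_variation f L := \sum_(p <- L) `|f p.2 - f p.1|.

Definition real_abs_cont l r f : Prop := forall e : R, 0 < e -> exists2 d : R, 0 < d &
  forall L, itv_family l r L -> total_length L < d -> family_variation f L < e.

Fixpoint steps (u : R) (s : seq R) : seq (R * R) :=
  if s is x :: s' then (u, x) :: steps x s' else [::].

Lemma apart_sym : symmetric apart.
Proof. by move=> p q; rewrite /apart orbC. Qed.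

Lemma variation_steps u v f s : variation u v f s = family_variation f (steps u s).
Proof.
rewrite /variation/= /family_variation.
elim: s u => [|x s IH] u; first by rewrite /= big_geq// big_nil.
by rewrite /= big_cons -IH big_nat_recl.
Qed.

Lemma total_length_steps u s : total_length (steps u s) = last u s - u.
Proof.
rewrite /total_length; elim: s u => [|x s IH] u /=; first by rewrite big_nil subrr.
by rewrite big_cons IH/=; ring.
Qed.

Lemma steps_itv u v s : path <%R u s -> last u s = v ->
  itv_family u v (steps u s).
Proof.
elim: s u => [|x s IH] u //= /andP[ux xs] sv.
have /andP[H1 H2] := IH x xs sv.
have xv : x <= v.
  move: xs sv => /order_path_min; case: (s) => [_ <-//|y t] /(_ lt_trans)/allP H <-.
  by apply/ltW/H/(mem_last y t).
apply/andP; split; rewrite /= ?H2 ?andbT.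
  rewrite !in_itv/= lexx (ltW ux) xv (le_trans (ltW ux) xv)/=.
  apply: sub_all H1 => p; rewrite !in_itv/= => /and3P[/andP[a b] /andP[c d] ->].
  by rewrite b d (le_trans (ltW ux) a) (le_trans (ltW ux) c).
apply: sub_all H1 => p; rewrite !in_itv/= => /and3P[/andP[a _] _ _].
by rewrite /apart/= a.
Qed.

(** The intervals of L1 are replaced one at a time by arbitrary partitions, which accumulate in L2;
    the second list is there for this induction. Subdivision changes neither the total length nor
    the absence of overlaps. *)
Lemma TV_family l r f (d e : R) :
  (forall L, itv_family l r L -> total_length L < d -> family_variation f L <= e) ->
  forall L1 L2, itv_family l r (L1 ++ L2) -> total_length (L1 ++ L2) < d ->
  (\sum_(p <- L1) total_variation p.1 p.2 f + (family_variation f L2)%:E <= e%:E)%E.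
Proof.
move=> H; elim=> [|[u v] L1 IH] L2 ok12 len12.
  by rewrite big_nil add0e lee_fin H.
move: ok12; rewrite /itv_family/= => /andP[/andP[/and3P[ulr vlr uv] a12] /andP[uv12 p12]].
have T0 : (0 <= \sum_(p <- L1) total_variation p.1 p.2 f)%E.
  rewrite big_seq; apply: sume_ge0 => p pL; apply: total_variation_ge0.
  by move/allP : a12 => /(_ p); rewrite mem_cat pL => /(_ isT)/and3P[].
rewrite big_cons/= -addeA.
set X := (_ + (family_variation f L2)%:E)%E.
(* In the extended reals the other terms can be moved across the inequality only once they are known
   to be finite. *)
have Xfin : X \is a fin_num.
  have : (X <= e%:E)%E.
    apply: IH; first by rewrite /itv_family a12 p12.
    rewrite (le_lt_trans _ len12)// /total_length/= big_cons/= lerDr subr_ge0//.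
  have : (0 <= X)%E by rewrite adde_ge0// lee_fin sumr_ge0.
  by case: (X) => // x _; rewrite leye_eq.
rewrite -leeBrDr//; apply: ge_ereal_sup => _ [_ [s [us /eqP sv] <-] <-].
rewrite leeBrDr// /X addeCA -EFinD variation_steps.
have -> : family_variation f (steps u s) + family_variation f L2 = family_variation f (steps u s ++ L2).
  by rewrite /family_variation big_cat.
have /andP[os ps] := steps_itv us sv.
have sub p : p \in steps u s -> [/\ u <= p.1, p.2 <= v & p.1 <= p.2].
  by move/allP : os => /(_ p)/[apply]; rewrite !in_itv/= => /and3P[/andP[? ?] /andP[? ?] ?].
have ap p q : p \in steps u s -> apart (u, v) q -> apart p q.
  move=> /sub[up pv pp]; rewrite /apart/= => /orP[vq|qu]; first by rewrite (le_trans pv vq).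
  by rewrite (le_trans qu up) orbT.
apply: IH.
  move: a12 p12 uv12; rewrite /itv_family !all_cat !pairwise_cat ps/= => /andP[-> ->] /and3P[r12 -> ->].
  move=> /andP[/allP ap1 /allP ap2]; rewrite /= !andbT; apply/and3P; split.
  - apply/allP => p /[dup] /sub[up pv pp] _; rewrite pp andbT !in_itv/=.
    move: ulr vlr; rewrite !in_itv/= => /andP[lu _] /andP[_ vr].
    by rewrite (le_trans lu up) (le_trans pp (le_trans pv vr)) (le_trans lu (le_trans up pp)) (le_trans pv vr).
  - rewrite allrel_catr r12 andbT; apply/allrelP => p q pL qs.
    by rewrite apart_sym; apply: ap => //; exact: ap1.
  - by apply/allrelP => p q ps' qL; apply: ap => //; exact: ap2.
move: len12; rewrite /total_length/= big_cons !big_cat/=; set A := \sum_(p <- L1) _.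
by rewrite -/(total_length (steps u s)) total_length_steps sv; lra.
Qed.

Lemma itv_family1 l r u v : u \in `[l, r] -> v \in `[l, r] -> u <= v -> itv_family l r [:: (u, v)].
Proof. by move=> ul vl uv; rewrite /itv_family/= ul vl uv. Qed.

(** A piece shorter than d has variation at most 1, and finitely many pieces of length d / 2 reach
    x. *)
Lemma abs_cont_TV_fin l r f : real_abs_cont l r f -> forall x, x \in `[l, r] ->
  total_variation l x f \is a fin_num.
Proof.
move=> acf; have [d d0 Hd] := acf 1 ltr01.
have H L : itv_family l r L -> total_length L < d -> family_variation f L <= 1.
  by move=> ? ?; apply/ltW/Hd.
have step y x : y \in `[l, r] -> x \in `[l, r] -> y <= x -> x - y < d -> (total_variation y x f <= 1)%E.
  move=> yl xl yx xyd; have := TV_family H (L1 := [:: (y, x)]) (L2 := [::]).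
  rewrite /total_length /family_variation /= !big_seq1 big_nil adde0; apply=> //.
  exact: itv_family1.
have ind (k : nat) x : x \in `[l, r] -> x <= l + k%:R * (d / 2) -> total_variation l x f \is a fin_num.
  elim: k x => [|k IH] x xl.
    rewrite mul0r addr0; move: (xl); rewrite in_itv/= => /andP[lx xr] xl'.
    have <- : l = x by apply/le_anti; rewrite lx xl'.
    by rewrite total_variationxx.
  move: (xl); rewrite in_itv/= => /andP[lx xr].
  rewrite -natr1 mulrDl mul1r => xk.
  pose y := Num.max l (x - d / 2).
  have ly : l <= y by rewrite le_max lexx.
  have yx : y <= x by rewrite ge_max lx/=; lra.
  have yl : y \in `[l, r] by rewrite in_itv/= ly (le_trans yx).
  have xyd : x - y < d.
    have : x - d / 2 <= y by rewrite le_max lexx orbT.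
    lra.
  rewrite (total_variationD f ly yx) fin_numD IH//=; last first.
    rewrite ge_max; apply/andP; split; last by lra.
    by rewrite lerDl mulr_ge0// divr_ge0// ltW.
  rewrite ge0_fin_numE ?total_variation_ge0//; exact: le_lt_trans (step _ _ yl xl yx xyd) (ltry _).
move=> x xl; apply: (ind (Num.truncn ((x - l) / (d / 2))).+1) => //.
have := truncnS_gt ((x - l) / (d / 2)).
by rewrite ltr_pdivrMr ?divr_gt0// => H1; lra.
Qed.

(** The increments of the variation function are the total variations over the intervals of the
    family, whose sum [TV_family] bounds. *)
Lemma abs_cont_TV l r f : real_abs_cont l r f ->
  real_abs_cont l r (fun x => fine (total_variation l x f)).
Proof.
move=> acf e e0; have [d d0 Hd] := acf (e / 2) (divr_gt0 e0 (ltr0n _ 2)).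
exists d => // L okL lenL.
have H L' : itv_family l r L' -> total_length L' < d -> family_variation f L' <= e / 2.
  by move=> ? ?; apply/ltW/Hd.
have := TV_family H (L1 := L) (L2 := [::]); rewrite cats0 => /(_ okL lenL).
rewrite /family_variation big_nil adde0 => Hle.
rewrite (@le_lt_trans _ _ (e / 2))//; last by lra.
rewrite -lee_fin (le_trans _ Hle)// -sumEFin big_seq [leRHS]big_seq.
apply: lee_sum => -[u v] pL /=.
move: okL => /andP[/allP/(_ _ pL)/= /and3P[ul vl uv] _].
have lu : l <= u by move: ul; rewrite in_itv/= => /andP[].
have ufin := abs_cont_TV_fin acf ul; have vfin := abs_cont_TV_fin acf vl.
have E := total_variationD f lu uv.
have uvfin : total_variation u v f \is a fin_num by move: vfin; rewrite E fin_numD => /andP[].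
rewrite E fineD// addrAC subrr add0r ger0_norm ?fine_ge0 ?total_variation_ge0//.
by rewrite fineK.
Qed.

Lemma abs_contB l r f h : real_abs_cont l r f -> real_abs_cont l r h ->
  real_abs_cont l r (fun x => f x - h x).
Proof.
move=> acf ach e e0.
have [d1 d10 H1] := acf (e / 2) (divr_gt0 e0 (ltr0n _ 2)).
have [d2 d20 H2] := ach (e / 2) (divr_gt0 e0 (ltr0n _ 2)).
exists (Num.min d1 d2); first by rewrite lt_min d10.
move=> L okL; rewrite lt_min => /andP[L1 L2].
have := H1 L okL L1; have := H2 L okL L2.
suff : family_variation (fun x => f x - h x) L <= family_variation f L + family_variation h L by lra.
rewrite /family_variation -big_split; apply: ler_sum => p _ /=.
rewrite (_ : _ - _ = (f p.2 - f p.1) - (h p.2 - h p.1)); last by ring.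
exact: ler_normB.
Qed.

Lemma abs_cont_within l r f : real_abs_cont l r f -> {within `[l, r], continuous f}.
Proof.
move=> acf; apply/withinP => x e xl e0; have [d d0 Hd] := acf e e0.
exists d => // y yl xyd.
have [xy|yx] := leP x y.
  have := Hd [:: (x, y)]; rewrite /total_length /family_variation !big_seq1/= distrC; apply.
    exact: itv_family1.
  by move: xyd; rewrite ltr_norml; lra.
have := Hd [:: (y, x)]; rewrite /total_length /family_variation !big_seq1/=; apply.
  by apply: itv_family1 => //; exact: ltW.
by move: xyd; rewrite ltr_norml; lra.
Qed.

Lemma clamp_homo l r : {homo @clamp R l r : x y / x <= y}.
Proof.
by move=> x y xy; rewrite /clamp /Num.max /Num.min; do ![case: ifPn]; rewrite -?leNgt; lra.
Qed.

(** * The density of a nondecreasing absolutely continuous function *)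

Section Monotone.
Variables (l r : R) (F : R -> R).
Hypotheses (lr : l <= r) (F_homo : {in `[l, r] &, {homo F : x y / x <= y}})
  (F_ac : real_abs_cont l r F).

(** Constant on both sides of [l, r], so that its Stieltjes measure is defined on the line and has
    no mass outside the segment. *)
Definition clamped_fun := F \o clamp l r.

Let cF : continuous clamped_fun.
Proof. by apply: continuous_clamp => //; exact: abs_cont_within. Qed.

Let nF : nondecreasing clamped_fun.
Proof.
by move=> x y xy; apply: F_homo; [exact: clamp_itv..|exact: clamp_homo].
Qed.

HB.instance Definition _ := isCumulative.Build R _ R clamped_fun nF (right_continuousW cF).

Definition increment_measure : {measure set (measurableTypeR R) -> \bar R} :=
  lebesgue_stieltjes_measure clamped_fun.

Local Notation nu := increment_measure.

Lemma increment_measure_itv u v : u <= v -> nu `]u, v]%classic = (clamped_fun v - clamped_fun u)%:E.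
Proof.
move=> uv; rewrite /increment_measure/= /lebesgue_stieltjes_measure/= /measure_extension/=.
rewrite measurable_mu_extE/=; last exact: is_ocitv.
by rewrite wlength_itv_bnd.
Qed.

(** The half-open interval containing I has a known Stieltjes measure; the open one inside I turns
    disjointness of sets into order of endpoints. The empty set receives the pair (0, 0). *)
Lemma open_itv_bounds (I : set R) : open I -> is_interval I -> (mu I < +oo)%E ->
  exists p : R * R, [/\ p.1 <= p.2, mu I = (p.2 - p.1)%:E, I `<=` `]p.1, p.2] & `]p.1, p.2[ `<=` I].
Proof.
move=> oI /is_intervalP; set i := Rhull I => Ii muI.
have [I0|/set0P[x Ix]] := eqVneq I set0.
  exists (0, 0); rewrite I0 measure0 subrr; split=> //= y /=.
  by rewrite in_itv/= => /andP[a b]; have := lt_trans a b; rewrite ltxx.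
have : x \in i by move: Ix; rewrite Ii.
move: muI; rewrite Ii lebesgue_measure_itv.
have oi : open [set` i] by rewrite -Ii.
case: i oi {Ii Ix} => -[bu u|[]] [bv v|[]] oi //=; rewrite ?itv_boundlr/= ?bnd_simp ?andbF ?ltNyr ?ltry ?ltxx//.
move=> _ /andP[ux xv].
have uv : u <= v.
  apply: (@le_trans _ _ x).
    by move: ux; case: (bu) => /=; rewrite bnd_simp// => /ltW.
  by move: xv; case: (bv) => /=; rewrite bnd_simp// => /ltW.
exists (u, v); split=> //=.
- by rewrite lte_fin; case: ltgtP uv => //= -> _; rewrite subrr.
- move=> y /= yi; have := yi; rewrite itv_boundlr => /andP[uy yv].
  rewrite in_itv/=; apply/andP; split; last first.
    by move: yv; case: (bv) => //=; exact: ltW.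
  move: uy; case: (bu) yi oi => /=; rewrite bnd_simp//.
  rewrite le_eqVlt => yi oi /predU1P[uy|//]; subst y.
  have /nbhs_ballP[e /= e0] := oi _ yi.
  move=> /(_ (u - e / 2)); rewrite /ball/= (_ : u - _ = e / 2); last by ring.
  rewrite ger0_norm ?divr_ge0 ?(ltW e0)// ltr_pdivrMr// => H.
  have /H : e < e * 2 by lra.
  rewrite itv_boundlr leBSide/= => /andP[+ _].
  by rewrite lerBrDr gerDl leNgt divr_gt0.
- by apply: subset_itv; rewrite bnd_simp; [case: (bu)|case: (bv)]; rewrite bnd_simp.
Qed.

(** A null set lies in an open set of measure less than d, a countable union of disjoint intervals.
    Any finite number of these is a family of total length less than d, on which F varies by less
    than e; the bound passes to the countable sum. *)
Lemma increment_measure_dominated : nu `<< mu.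
Proof.
apply/null_content_dominatesP => N mN N0.
apply/eqP; rewrite eq_le measure_ge0 andbT; apply/lee_addgt0Pr => e e0; rewrite add0e.
have [d d0 Hd] := F_ac e0.
have N1 : (mu N < +oo)%E by rewrite N0.
have [U [oU NU mUN]] := lebesgue_regularity_outer mN N1 d0.
have mU : (mu U < d%:E)%E.
  rewrite -(setDUK NU); apply: le_lt_trans mUN.
  have mUN' : measurable (U `\` N) by apply: measurableD => //; exact: open_measurable.
  have N0' : (mu N <= 0)%E by have -> : mu N = 0%E := N0.
  by rewrite -[leRHS]add0e; apply: le_trans (measureU2 mu mN mUN') _; exact: leeD.
have mU' : measurable U by exact: open_measurable.
have [I [oiI tI UI]] := OpenSetDisjointItvs.open_disjoint_itv oU.
have mI i : measurable (I i) by apply: open_measurable; exact: (oiI i).1.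
have muI i : (mu (I i) < +oo)%E.
  apply: le_lt_trans (lt_trans mU (ltry _)); apply: le_measure; rewrite ?inE//.
    exact: mI.
  by rewrite UI; exact: bigcup_sup.
have /choice[p Hp] : forall i, exists p : R * R, [/\ p.1 <= p.2, mu (I i) = (p.2 - p.1)%:E, I i `<=` `]p.1, p.2] & `]p.1, p.2[ `<=` I i].
  by move=> i; apply: open_itv_bounds => //; [exact: (oiI i).1|exact: (oiI i).2].
apply: (@le_trans _ _ (nu U)).
  by apply: le_measure; rewrite ?inE//; exact: open_measurable.
rewrite UI measure_bigcup//.
apply: lime_le; first exact: is_cvg_nneseries.
exists 0%N => // n _ /=.
(* Degenerate pairs are dropped because such a point could lie inside another interval. Clamping
   brings the endpoints into [l, r] and lengthens no interval. *)
pose L := [seq (clamp l r (p i).1, clamp l r (p i).2) | i <- [seq i <- iota 0 n | (p i).1 < (p i).2]].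
have LF : (\sum_(0 <= i < n | i \in [set: nat]) nu (I i) <= (family_variation F L)%:E)%E.
  rewrite /family_variation big_map big_filter -sumEFin /index_iota subn0.
  rewrite (eq_bigl predT); last by move=> i; rewrite in_setT.
  rewrite [leRHS]big_mkcond; apply: lee_sum => i _; have [pi _ Ip _] := Hp i.
  rewrite (@le_trans _ _ (nu `](p i).1, (p i).2]%classic))//.
    by apply: le_measure => //; rewrite inE; first [exact: mI|exact: measurable_itv].
  rewrite increment_measure_itv//; case: ifPn => [_|]; first by rewrite lee_fin ler_norm.
  by rewrite -leNgt => pi'; rewrite (@le_anti _ _ (p i).1 (p i).2) ?subrr// pi pi'.
apply: (le_trans LF); rewrite lee_fin ltW// Hd//.
  apply/andP; split.
    apply/allP => _ /mapP[i _ ->] /=; rewrite !clamp_itv//=.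
    by have [pi _ _ _] := Hp i; rewrite clamp_homo.
  rewrite /L; have : uniq [seq i <- iota 0 n | (p i).1 < (p i).2] by rewrite filter_uniq ?iota_uniq.
  have : all (fun i => (p i).1 < (p i).2) [seq i <- iota 0 n | (p i).1 < (p i).2] by exact: filter_all.
  elim: [seq _ <- _ | _] => //= i s IH /andP[ip ps] /andP[si us].
  rewrite IH// andbT; apply/allP => _ /mapP[j js ->].
  have jp := allP ps j js.
  have ij : i != j by apply: contraNneq si => ->.
  suff : apart (p i) (p j) by move=> /orP[] H; apply/orP; [left|right]; exact: clamp_homo.
  rewrite /apart leNgt leNgt -negb_and; apply/negP => /andP[ji ij'].
  have [_ _ _ Ii] := Hp i; have [_ _ _ Ij] := Hp j.
  pose u := Num.max (p i).1 (p j).1; pose v := Num.min (p i).2 (p j).2.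
  have uv : u < v by rewrite gt_max !lt_min ip jp ij' ji.
  have [u1 u2] : (p i).1 <= u /\ (p j).1 <= u by rewrite !le_max !lexx orbT.
  have [v1 v2] : v <= (p i).2 /\ v <= (p j).2 by rewrite !ge_min !lexx orbT.
  have iij : (I i `&` I j) ((u + v) / 2).
    by split; [apply: Ii|apply: Ij]; rewrite /= in_itv/=; apply/andP; split; lra.
  by move/eqP: ij; apply; apply: tI => //; exists ((u + v) / 2).
rewrite -lte_fin; apply: le_lt_trans mU; rewrite UI measure_bigcup//.
apply: (@le_trans _ _ (\sum_(0 <= i < n) mu (I i))%E).
  rewrite /total_length big_map big_filter -sumEFin big_mkcond /index_iota subn0; apply: lee_sum => i _.
  have [pi -> _ _] := Hp i; case: ifP => _; rewrite lee_fin/= ?subr_ge0//.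
  have := clamp_lip l r (p i).2 (p i).1; rewrite (ger0_norm (x := _ - (p i).1)) ?subr_ge0//.
  exact: le_trans (ler_norm _).
rewrite (eq_eseriesl (Q := xpredT)); last by move=> i; rewrite in_setT.
exact: nneseries_lim_ge.
all: by move=> i _; exact: mI.
Qed.

(** The Radon-Nikodym density of the finite restriction of the measure to ]l, r]; the measure of ]l,
    x] is F x - F l. *)
Lemma monotone_density : exists g, primitive_on l r F g.
Proof.
have mD : measurable (`]l, r]%classic : set (measurableTypeR R)) by exact: measurable_itv.
have nuD : (nu `]l, r]%classic < +oo)%E by rewrite increment_measure_itv// ltry.
have dom : mfrestr mD nuD `<< mu.
  apply: null_dominates_trans increment_measure_dominated.
  apply/null_content_dominatesP => A mA A0; rewrite /mfrestr/= /mrestr.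
  apply/eqP; rewrite eq_le measure_ge0 andbT -A0.
  by apply: le_measure; rewrite ?inE//; exact: measurableI.
have [g [g0 gfin gi gE]] := radon_nikodym_sigma_finite dom.
have fgE : EFin \o (fine \o g) = g by apply/funext => x /=; rewrite fineK.
exists (fine \o g); split; first by rewrite fgE; exact: integrableS gi.
move=> x xlr; have [lx xr] : l <= x /\ x <= r by move: xlr; rewrite in_itv/= => /andP.
have mx : measurable (`]l, x]%classic : set (measurableTypeR R)) by exact: measurable_itv.
have : nu (`]l, x]%classic `&` `]l, r]%classic) = (\int[mu]_(t in `]l, x]) g t)%E := gE _ mx.
rewrite (_ : _ `&` _ = `]l, x]%classic); last first.
  by apply: setIidl; apply: subset_itvl; rewrite bnd_simp.
rewrite increment_measure_itv// /clamped_fun/= !clamp_id//; last by rewrite in_itv/= lexx.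
rewrite -Rintegral_itv_obnd_cbnd; last first.
  by rewrite fgE; exact: integrableS gi.
have -> : (\int[mu]_(t in `]l, x]) g t = \int[mu]_(t in `]l, x]) (fine (g t))%:E)%E.
  by apply: eq_integral => t _; rewrite fineK.
by rewrite /Rintegral => <- /=; rewrite subrKC.
Qed.

End Monotone.

(* The variation V of h and V - h are nondecreasing; the Lebesgue-Stieltjes measure
   of each has a Radon-Nikodym density. *)
Lemma abs_cont_primitive l r h : l <= r -> real_abs_cont l r h ->
  exists d, primitive_on l r h d.
Proof.
move=> lr ach; pose V x := fine (total_variation l x h).
have acV := abs_cont_TV ach.
have TVfin := abs_cont_TV_fin ach.
have dV x y : x \in `[l, r] -> y \in `[l, r] -> x <= y -> `|h y - h x| <= V y - V x.
  move=> xl yl xy; have lx : l <= x by move: xl; rewrite in_itv/= => /andP[].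
  have := total_variationD h lx xy; have := TVfin _ yl; rewrite /V => + E.
  rewrite E fin_numD => /andP[xf xyf]; rewrite fineD// addrAC subrr add0r.
  by rewrite -lee_fin fineK// total_variation_ge.
have Vh : {in `[l, r] &, {homo V : x y / x <= y}}.
  by move=> x y xl yl xy; rewrite -subr_ge0 (le_trans _ (dV _ _ xl yl xy)).
have Wh : {in `[l, r] &, {homo (fun x => V x - h x) : x y / x <= y}}.
  move=> x y xl yl xy; have := dV _ _ xl yl xy; rewrite ler_norml => /andP[_]; lra.
have [g1 H1] := monotone_density lr Vh acV.
have [g2 H2] := monotone_density lr Wh (abs_contB acV ach).
exists (fun x => -1 * g2 x + g1 x).
by apply: primitive_ext (primitive_comb (-1) H2 H1) _ _ => // x _; ring.
Qed.

(** Lebesgue differentiation, applied to the density extended by 0 to the whole line. *)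
Lemma primitive_derive l r h d : primitive_on l r h d ->
  {ae mu, forall x, x \in `]l, r[ -> is_derive x 1 h (d x)}.
Proof.
move=> [di hd].
pose d0 := d \_ `[l, r].
have d0i : mu.-integrable setT (EFin \o d0).
  by rewrite /d0 -restrict_EFin; apply/integrable_restrict => //; rewrite setTI.
have d0l : locally_integrable setT d0 by exact: integrable_locally.
have d0y y : mu.-integrable `[l, y] (EFin \o d0) by exact: integrableS d0i.
have := @FTC1 R d0 (BLeft l) d0y d0l.
apply: filterS; first exact: (ae_filter_ringOfSetsType mu).
move=> x Hx xlr.
have lx : l < x by move: xlr; rewrite in_itv/= => /andP[].
have [dF F'] := Hx lx.
have -> : d x = d0 x by rewrite /d0 patchE mem_set//; exact: subset_itv_oo_cc xlr.
pose F y := h l + \int[mu]_(t in `[l, y]) d0 t.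
apply: (@near_eq_is_derive R R R F).
  near=> y; have ylr : y \in `[l, r].
    by apply: subset_itv_oo_cc; near: y; exact: near_itv_oo.
  rewrite /F (hd y ylr); congr (_ + _); apply: Int_eq => t tly.
  rewrite /d0 patchE mem_set//=; move: tly ylr; rewrite !in_itv/= => /andP[-> ty] /andP[_ yr].
  exact: le_trans yr.
rewrite -F' derive1E -[X in is_derive _ _ _ X]add0r.
have H1 : is_derive x 1 (cst (h l)) 0 by exact: is_derive_cst.
have H2 : is_derive x 1 (fun y => \int[mu]_(t in `[l, y]) d0 t) ('D_1 (fun y => \int[mu]_(t in `[l, y]) d0 t) x) by split.
exact: (is_deriveD H1 H2).
Unshelve. all: by end_near. Qed.

End AbsoluteContinuity.

(** * Compact symmetric operators on a pre-Hilbert space *)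

Section PreHilbert.
Context {R : realType} {V : lmodType R}.
Variables (S : V -> Prop) (ip : V -> V -> R).
Hypothesis S0 : S 0.
Hypothesis S_comb : forall (s : R) x y, S x -> S y -> S (s *: x + y).
Hypothesis ip_sym : forall x y, ip x y = ip y x.
Hypothesis ip_comb : forall (s : R) x y z, S x -> S y -> S z ->
  ip (s *: x + y) z = s * ip x z + ip y z.
Hypothesis ip_ge0 : forall x, S x -> 0 <= ip x x.

Lemma ip_combr (s : R) x y z : S x -> S y -> S z ->
  ip z (s *: x + y) = s * ip z x + ip z y.
Proof. by move=> Sx Sy Sz; rewrite !(ip_sym z) ip_comb. Qed.

Lemma ip_comb2 (s : R) x y : S x -> S y ->
  ip (s *: x + y) (s *: x + y) = s ^+ 2 * ip x x + 2 * s * ip x y + ip y y.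
Proof.
move=> Sx Sy; have Sxy := S_comb s Sx Sy.
by rewrite ip_comb// !ip_combr// (ip_sym y x); ring.
Qed.

Lemma ip_CS x y : S x -> S y -> ip x y ^+ 2 <= ip x x * ip y y.
Proof.
move=> Sx Sy.
have H (s : R) : 0 <= s ^+ 2 * ip x x + 2 * s * ip x y + ip y y.
  by rewrite -ip_comb2//; apply: ip_ge0; exact: S_comb.
have [x0|x0] := eqVneq (ip x x) 0.
  rewrite x0 mul0r; have [->|xy0] := eqVneq (ip x y) 0; first by rewrite expr0n.
  (* For a null x the quadratic polynomial in s is affine, and at this s it equals -1. *)
  have := H (- (ip y y + 1) / (2 * ip x y)).
  rewrite x0 mulr0 add0r (_ : _ + _ = -1); first by rewrite oppr_ge0 ler10.
  by field.
have xp : 0 < ip x x by rewrite lt_def x0 ip_ge0.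
have := H (- ip x y / ip x x); rewrite -(ler_pM2l xp) mulr0 -subr_ge0.
rewrite -[in X in _ -> X]subr_ge0; congr (0 <= _); field.
by rewrite gt_eqF.
Qed.

(** A semi-definite form does not identify vectors; a vector of norm 0 is treated as zero because
    every product with it vanishes. *)
Lemma ip_null x y : S x -> S y -> ip x x = 0 -> ip x y = 0.
Proof.
move=> Sx Sy x0; have := ip_CS Sx Sy; rewrite x0 mul0r => H.
by apply/eqP; rewrite -(sqrf_eq0) eq_le H sqr_ge0.
Qed.

Lemma S_sum (I : Type) (t : seq I) (P : pred I) (a : I -> R) (e : I -> V) :
  (forall i, S (e i)) -> S (\sum_(i <- t | P i) a i *: e i).
Proof.
move=> Se; elim: t => [|i t IH]; first by rewrite big_nil.
by rewrite big_cons; case: ifP => // _; exact: S_comb.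
Qed.

Lemma ip0l x : S x -> ip 0 x = 0.
Proof.
by move=> Sx; have := ip_comb 1 S0 S0 Sx; rewrite scaler0 addr0 mul1r; lra.
Qed.

Lemma ip_sum (I : Type) (t : seq I) (P : pred I) (a : I -> R) (e : I -> V) x :
  (forall i, S (e i)) -> S x ->
  ip (\sum_(i <- t | P i) a i *: e i) x = \sum_(i <- t | P i) a i * ip (e i) x.
Proof.
move=> Se Sx; elim: t => [|i t IH]; first by rewrite !big_nil ip0l.
by rewrite !big_cons; case: ifP => // _; rewrite ip_comb ?IH//; exact: S_sum.
Qed.

Section Orthonormal.
Variable e : nat -> V.
Hypothesis Se : forall n, S (e n).
Hypothesis e_on : forall m n, ip (e m) (e n) = (m == n)%:R.

Lemma ip_onsum (t : seq nat) (a : nat -> R) : uniq t ->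
  ip (\sum_(i <- t) a i *: e i) (\sum_(i <- t) a i *: e i) = \sum_(i <- t) a i ^+ 2.
Proof.
move=> ut; rewrite ip_sum//; last exact: S_sum.
rewrite !big_seq; apply: eq_bigr => i it; rewrite expr2; congr (_ * _).
rewrite -big_seq ip_sym ip_sum// (bigD1_seq i)//= e_on eqxx mulr1 big1 ?addr0// => j ji.
by rewrite e_on (negbTE ji) mulr0.
Qed.

(** The norm of x minus its orthogonal projection is nonnegative. *)
Lemma bessel (t : seq nat) x : uniq t -> S x ->
  \sum_(i <- t) ip x (e i) ^+ 2 <= ip x x.
Proof.
move=> ut Sx; set s := \sum_(i <- t) ip x (e i) *: e i.
have Ss : S s by exact: S_sum.
have := ip_ge0 (S_comb (-1) Ss Sx); rewrite ip_comb2// /s ip_onsum//.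
rewrite ip_sum// [in X in _ + X + _](eq_bigr (fun i => ip x (e i) ^+ 2)); last first.
  by move=> i _; rewrite (ip_sym (e i)) expr2.
lra.
Qed.

End Orthonormal.

Section CompactSymmetric.
Variables (M : V -> Prop) (K : V -> V).
Hypothesis MS : forall x, M x -> S x.
Hypothesis M_comb : forall (s : R) x y, M x -> M y -> M (s *: x + y).
Hypothesis MK : forall x, M x -> M (K x).
Hypothesis K_sym : forall x y, M x -> M y -> ip (K x) y = ip x (K y).
Hypothesis K_bounded : exists C : R, forall x, M x -> ip (K x) (K x) <= C * ip x x.
(** Compactness in terms of a cluster point, so that no subsequence has to be extracted. *)
Hypothesis K_compact : forall x : nat -> V, (forall n, M (x n) /\ ip (x n) (x n) <= 1) ->
  exists2 h, M h & forall (e : R) N, 0 < e -> exists2 n, (N <= n)%N &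
    ip (-1 *: K (x n) + h) (-1 *: K (x n) + h) < e.

(** Let s2 be the supremum of |K x|^2 on the unit ball. Along a maximizing sequence K^2 x - s2 x
    tends to 0, so a cluster point h of K x is an eigenvector of K^2; then K^2 - s2 = (K - s) (K +
    s) yields one of K. The map K is not assumed linear: it is always moved to the other side of the
    product by [K_sym]. *)
Lemma compact_symmetric_eigen : (exists2 x, M x & 0 < ip (K x) (K x)) ->
  exists v kappa, [/\ M v, 0 < ip v v, kappa != 0 &
    ip (- kappa *: v + K v) (- kappa *: v + K v) = 0].
Proof.
move=> [x0 Mx0 Kx0]; have [C HC] := K_bounded.
have N0 x : M x -> 0 <= ip x x by move=> /MS; exact: ip_ge0.
have M_scale (s : R) x : M x -> M (s *: x).
  move=> Mx; have -> : s *: x = (s - 1) *: x + x by rewrite scalerBl scale1r subrK.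
  exact: M_comb.
have ip_scale (s : R) x y : M x -> M y -> ip (s *: x) y = s * ip x y.
  move=> /MS Sx /MS Sy; have := ip_comb s Sx S0 Sy.
  by rewrite addr0 ip0l// addr0.
have NC x : M x -> ip x x <= 1 -> ip (K x) (K x) <= `|C|.
  move=> Mx x1; rewrite (le_trans (HC x Mx))//.
  apply: (@le_trans _ _ (`|C| * ip x x)); first by rewrite ler_wpM2r ?N0// ler_norm.
  by rewrite ler_piMr.
pose A := [set ip (K x) (K x) | x in [set x | M x /\ ip x x <= 1]].
have A0 : A 0.
  have M0 : M 0 by rewrite -(scale0r x0); exact: M_scale.
  exists 0; first by split=> //; rewrite ip0l.
  by rewrite K_sym ?ip0l//; [apply/MS; do 2 apply: MK|exact: MK].
have hA : has_sup A.
  by split; [exists 0|exists `|C| => _ [x [Mx x1] <-]; exact: NC].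
set s2 := sup A.
have As2 x : M x -> ip x x <= 1 -> ip (K x) (K x) <= s2.
  by move=> Mx x1; apply: ub_le_sup; [case: hA|exists x].
have Nx0 : 0 < ip x0 x0.
  rewrite lt_def N0// andbT; apply: contraTneq Kx0 => x00.
  by rewrite -leNgt (le_trans (HC _ Mx0))// x00 mulr0.
have s2x x : M x -> ip (K x) (K x) <= s2 * ip x x.
  move=> Mx; have [x00|x00] := eqVneq (ip x x) 0.
    by have := HC x Mx; rewrite x00 !mulr0.
  have xp : 0 < ip x x by rewrite lt_def x00 N0.
  pose t := (Num.sqrt (ip x x))^-1; have t2 : t ^+ 2 = (ip x x)^-1.
    by rewrite /t exprVn sqr_sqrtr// ltW.
  have My : M (t *: x) by exact: M_scale.
  have y1 : ip (t *: x) (t *: x) = 1.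
    rewrite ip_scale// ip_sym ip_scale// mulrA -expr2 t2 mulVf//.
  have := As2 _ My; rewrite y1 => /(_ (lexx _)).
  have KK (z : V) : M z -> ip (K (t *: x)) z = t * ip (K x) z.
    by move=> Mz; rewrite K_sym// ip_scale//; [rewrite K_sym|exact: MK].
  rewrite KK; last exact: MK.
  rewrite ip_sym KK; last exact: MK.
  by rewrite mulrA -expr2 t2 mulrC ler_pdivrMr.
have s20 : 0 < s2.
  by have := lt_le_trans Kx0 (s2x _ Mx0); rewrite pmulr_lgt0.
have /choice[x Hx] : forall n : nat, exists x, [/\ M x, ip x x <= 1 & s2 - n.+1%:R^-1 < ip (K x) (K x)].
  move=> n; have n0 : 0 < (n.+1%:R : R)^-1 by rewrite invr_gt0.
  by have [_ [x [Mx x1] <-] Hx] := sup_adherent n0 hA; exists x.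
have Mx n : M (x n) by have [] := Hx n.
have [h Mh Hh] := K_compact (fun n => conj (Mx n) (let: And3 _ H _ := Hx n in H)).
have small (e : R) : 0 < e -> exists2 n, n.+1%:R^-1 < e & ip (-1 *: K (x n) + h) (-1 *: K (x n) + h) < e.
  move=> e0; have [N _ HN] := near_infty_natSinv_lt (PosNum e0).
  by have [n Nn Hn] := Hh e N e0; exists n => //; exact: HN.
(* If h were null, |K (x n)|^2 would be less than s2 / 2 for some n at which it exceeds s2 - s2 /
   2. *)
have Nh : 0 < ip h h.
  rewrite lt_def N0// andbT; apply/eqP => h0.
  have [n n1 Hn] := small (s2 / 2) (divr_gt0 s20 (ltr0n _ 2)).
  have [_ _ Kn] := Hx n; have MKn := MK (Mx n).
  move: Hn; rewrite ip_comb2; [|exact: MS..].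
  have Kh0 : ip (K (x n)) h = 0 by rewrite ip_sym; exact: ip_null (MS Mh) (MS MKn) h0.
  rewrite h0 Kh0 mulr0 !addr0 sqrrN expr1n mul1r.
  by move: n1 Kn; move: (_^-1) (ip _ _) => p t; lra.
pose w := - s2 *: h + K (K h).
have Mw : M w by apply: M_comb => //; do 2 apply: MK.
have w0 : ip w w = 0.
  have MKw := MK Mw; have MKKw := MK MKw; have MKh := MK Mh; have MKKh := MK MKh.
  (* The three terms of [E] below are bounded by Cauchy-Schwarz; the factor comes from (p - q + r)^2
     <= 3 (p^2 + q^2 + r^2). *)
  pose B := 3 * (ip (K (K w)) (K (K w)) + s2 ^+ 2 * ip w w + s2 * ip (K w) (K w)).
  have B0 : 0 <= B by rewrite /B mulr_ge0// !addr_ge0 ?mulr_ge0 ?N0 ?sqr_ge0// ltW.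
  suff H (e : R) : 0 < e -> ip w w ^+ 2 <= e * B.
    apply/eqP; rewrite -sqrf_eq0 eq_le sqr_ge0 andbT.
    apply/ler_addgt0Pr => e e0; rewrite add0r.
    have B1 : 0 < B + 1 by rewrite ltr_pwDr.
    rewrite (le_trans (H _ (divr_gt0 e0 B1)))// -mulrA ler_piMr ?(ltW e0)//.
    by rewrite mulrC ler_pdivrMr// mul1r lerDl.
  move=> e0; have [n n1 Hn] := small e e0; have [_ xn1 Kxn] := Hx n.
  set y := K (x n) in Hn; have My : M y by exact: MK.
  set d := -1 *: y + h in Hn; have Md : M d by exact: M_comb.
  pose z := - s2 *: x n + K y; have Mz : M z by apply: M_comb => //; exact: MK.
  have MKy := MK My.
  (* Formally w = (K^2 - s2) d + K z, since h = d + K (x n). Here d is small by the choice of n, and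
     z is small because x n nearly attains the supremum. *)
  have E : ip w w = ip d (K (K w)) - s2 * ip d w + ip z (K w).
    rewrite {1}/w /d /z !ip_comb; try exact: MS.
    rewrite K_sym// K_sym// (K_sym My MKw) -(K_sym (Mx n) Mw) -/y; ring.
  have Hz : ip z z <= s2 * e.
    have SKy : S (K y) by apply: MS; exact: MK.
    rewrite /z ip_comb2//; last exact: MS.
    rewrite (ip_sym (x n)) K_sym//.
    have h1 : ip (K y) (K y) <= s2 * ip y y by exact: s2x.
    have h2 : s2 ^+ 2 * ip (x n) (x n) <= s2 ^+ 2 by rewrite ler_piMr ?sqr_ge0.
    have h3 : s2 * (s2 - ip y y) <= s2 * e by rewrite ler_pM2l//; move: n1 Kxn; rewrite -/y; move: (_^-1) (ip _ _) => p t; lra.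
    rewrite sqrrN -/y; lra.
  have c1 := ip_CS (MS Md) (MS MKKw); have c2 := ip_CS (MS Md) (MS Mw); have c3 := ip_CS (MS Mz) (MS MKw).
  have c1' : ip d (K (K w)) ^+ 2 <= e * ip (K (K w)) (K (K w)).
    by rewrite (le_trans c1)// ler_wpM2r ?N0// ltW.
  have c2' : (s2 * ip d w) ^+ 2 <= e * (s2 ^+ 2 * ip w w).
    rewrite exprMn [leRHS]mulrCA ler_pM2l ?exprn_gt0// (le_trans c2)// ler_wpM2r ?N0// ltW//.
  have c3' : ip z (K w) ^+ 2 <= e * (s2 * ip (K w) (K w)).
    by rewrite (le_trans c3)// mulrA (mulrC e) ler_wpM2r ?N0.
  rewrite [in leLHS]E /B; move: c1' c2' c3'.
  move: (ip d _) (s2 * ip d _) (ip z _) => p q r c1' c2' c3'.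
  apply: (@le_trans _ _ (3 * (p ^+ 2 + q ^+ 2 + r ^+ 2))); last by lra.
  have := sqr_ge0 (p + q); have := sqr_ge0 (p - r); have := sqr_ge0 (q + r).
  rewrite !sqrrD; lra.
pose s := Num.sqrt s2; have s0 : 0 < s by rewrite sqrtr_gt0.
have ss : s * s = s2 by rewrite -expr2 sqr_sqrtr// ltW.
have MKh := MK Mh; pose v := s *: h + K h; have Mv : M v by exact: M_comb.
(* Either (K + s) h is null and h belongs to - s, or (K + s) h is an eigenvector for s, because (K -
   s) (K + s) h is the null vector w. *)
have [v0|v0] := eqVneq (ip v v) 0.
  exists h, (- s); split=> //; first by rewrite oppr_eq0 gt_eqF.
  by rewrite opprK.
exists v, s; split=> //; [by rewrite lt_def v0 N0|by rewrite gt_eqF|].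
set z := - s *: v + K v; have MKv := MK Mv; have Mz : M z by exact: M_comb.
have MKKh := MK MKh; have MKz := MK Mz.
rewrite {1}/z ip_comb; try exact: MS.
rewrite K_sym// {1 2}/v !ip_comb; try exact: MS.
rewrite -(K_sym MKh Mz) -(K_sym Mh Mz).
have := ip_null (MS Mw) (MS Mz) w0; rewrite /w ip_comb; try exact: MS.
rewrite -ss; lra.
Qed.

End CompactSymmetric.
End PreHilbert.

(* Tychonoff's theorem gives a pointwise cluster point; the common Lipschitz constant
   makes the approximation uniform. *)
Lemma lipschitz_cluster {R : realType} (I : finType) (u : nat -> I -> R -> R) (C L B : R) :
  0 < L ->
  (forall n i x, `|u n i x| <= C) ->
  (forall n i x y, `|u n i x - u n i y| <= L * `|x - y|) ->
  exists2 h : I -> R -> R, (forall i x y, `|h i x - h i y| <= L * `|x - y|) &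
    forall (e : R) (N : nat), 0 < e -> exists2 n, (N <= n)%N &
      forall i x, `|x| <= B -> `|u n i x - h i x| < e.
Proof.
move=> L0 uC uL.
pose X := prod_topology (fun _ : (I * R)%type => R : topologicalType).
pose v (n : nat) : X := fun t => u n t.1 t.2.
have cK := @tychonoff (I * R)%type (fun=> R : topologicalType) (fun=> `[- C, C]%classic) (fun=> @segment_compact R (- C) C).
have [h [_ hcl]] : exists h : X,
    [set f : X | forall t, `[- C, C]%classic (f t)] h /\ cluster (v @ \oo) h.
  have [|h [Kh hcl]] := cK (v @ \oo) _; last by exists h.
  exists 0%N => // n _ t; rewrite /= in_itv/= -ler_norml; exact: uC.
have near_h (s : seq (I * R)) (e : R) N : 0 < e ->
    exists2 n, (N <= n)%N & forall t, t \in s -> `|v n t - h t| < e.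
  move=> e0.
  have nb : nbhs h [set g : X | forall t, t \in s -> `|g t - h t| < e].
    elim: s => [|t s IH]; first by apply: filterS filterT => g _ t; rewrite in_nil.
    have ht : nbhs h [set g : X | `|h t - g t| < e].
      have pc := @proj_continuous (I * R)%type (fun=> R : topologicalType) t h.
      apply: (pc [set r : R | `|h t - r| < e]).
      by apply/nbhs_ballP; exists e.
    apply: filterS2 ht IH => g gt gs t'; rewrite inE => /predU1P[->|]; last exact: gs.
    by rewrite distrC.
  have [_ [[n Nn <-] H]] : [set v n | n in [set n | (N <= n)%N]] `&` [set g : X | forall t, t \in s -> `|g t - h t| < e] !=set0.
    by apply: hcl nb; exists N => // n Nn; exists n.
  by exists n.
exists (fun i x => h (i, x)) => [i x y|e N e0].
  apply/ler_addgt0Pr => e e0.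
  have [n _ Hn] := near_h [:: (i, x); (i, y)] (e / 2) 0%N (divr_gt0 e0 (ltr0n _ 2)).
  have := Hn (i, x); have := Hn (i, y); rewrite !inE !eqxx orbT => /(_ isT) H1 /(_ isT) H2.
  rewrite (_ : _ - _ = (v n (i, x) - v n (i, y)) + (- (v n (i, x) - h (i, x)) + (v n (i, y) - h (i, y)))); last by ring.
  rewrite (le_trans (ler_normD _ _))//; apply: lerD; first exact: uL.
  rewrite (le_trans (ler_normD _ _))// normrN; lra.
(* The mesh of a finite grid: within one mesh u n and h each vary by at most e / 4, and at the grid
   points they differ by less than e / 2. *)
pose eta := e / (4 * L); have eta0 : 0 < eta by rewrite divr_gt0// mulr_gt0.
pose m := (Num.truncn (2 * `|B| / eta)).+1.
pose s := [seq (i, - B + k%:R * eta) | i <- enum I, k <- iota 0 m].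
have [n Nn Hn] := near_h s (e / 2) N (divr_gt0 e0 (ltr0n _ 2)).
exists n => // i x xB.
have lB : `|B| = B by rewrite ger0_norm// (le_trans (normr_ge0 x)).
have xB0 : 0 <= x + B by move: xB; rewrite ler_norml; lra.
pose k := Num.truncn ((x + B) / eta).
have /andP[k1 k2] : k%:R <= (x + B) / eta < k.+1%:R.
  by apply: truncn_itv; rewrite divr_ge0// ltW.
have km : (k < m)%N.
  rewrite ltnS; apply: le_truncn; rewrite ler_pM2r ?invr_gt0// lB.
  by move: xB; rewrite ler_norml; lra.
pose y := - B + k%:R * eta.
have ys : (i, y) \in s.
  by apply/allpairsP; exists (i, k); rewrite mem_enum mem_iota.
have xy : `|x - y| <= eta.
  move: k1 k2; rewrite ler_pdivlMr// ltr_pdivrMr// -natr1 mulrDl mul1r /y => k1 k2.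
  by rewrite ler_norml; lra.
have hL : `|h (i, y) - h (i, x)| <= L * eta.
  apply/ler_addgt0Pr => d d0.
  have [n' _ Hn'] := near_h [:: (i, x); (i, y)] (d / 2) 0%N (divr_gt0 d0 (ltr0n _ 2)).
  have := Hn' (i, x); have := Hn' (i, y); rewrite !inE !eqxx orbT => /(_ isT) H1 /(_ isT) H2.
  rewrite (_ : _ - _ = (v n' (i, y) - v n' (i, x)) + ((v n' (i, x) - h (i, x)) - (v n' (i, y) - h (i, y)))); last by ring.
  rewrite (le_trans (ler_normD _ _))//; apply: lerD.
    by rewrite (le_trans (uL _ _ _ _))// ler_pM2l// distrC.
  rewrite (le_trans (ler_normB _ _))//; lra.
have uLx : `|u n i x - u n i y| <= L * eta by rewrite (le_trans (uL _ _ _ _))// ler_pM2l.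
have := Hn _ ys; rewrite /v/= => H3.
have E : L * eta = e / 4 by rewrite /eta; field; rewrite gt_eqF.
rewrite E in hL uLx.
rewrite (_ : _ - _ = (u n i x - u n i y) + ((u n i y - h (i, y)) + (h (i, y) - h (i, x)))); last by ring.
rewrite (le_lt_trans (ler_normD _ _))//.
have := ler_normD (u n i y - h (i, y)) (h (i, y) - h (i, x)); lra.
Qed.

(** * Uniformly and absolutely convergent series of real functions *)

Section UniformSums.
Context {R : realType}.
Implicit Types (s : nat -> R -> R) (F : R -> R).

Lemma bounded_sum_tail (d : nat -> R) (B : R) : (forall n, 0 <= d n) ->
  (forall M, \sum_(0 <= n < M) d n <= B) -> forall t : R, 0 < t ->
  exists N, forall M, (N <= M)%N -> \sum_(N <= n < M) d n <= t.
Proof.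
move=> d0 dB t t0; pose E := range (fun M => \sum_(0 <= n < M) d n).
have hE : has_sup E.
  by split; [exists (\sum_(0 <= n < 0) d n); exists 0%N|exists B => _ [M _ <-]; exact: dB].
have [_ [N _ <-] HN] := sup_adherent t0 hE.
exists N => M NM; have : \sum_(0 <= n < M) d n <= sup E by apply: sup_upper_bound => //; exists M.
rewrite (big_cat_nat _ NM)//=; lra.
Qed.

(** Pointwise, absolute and uniform convergence of the complex series are all drawn from this one
    condition on the parts. *)
Definition usum l r s F : Prop := forall t : R, 0 < t ->
  exists N, forall M x, (N <= M)%N -> x \in `[l, r] ->
    \sum_(N <= n < M) `|s n x| <= t /\ `|\sum_(0 <= n < M) s n x - F x| <= t.

(** The Cauchy criterion: the error of a partial sum is at most the tail of the absolute values,
    which is small uniformly in x. *)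
Lemma usum_ex l r s : (forall t : R, 0 < t ->
  exists N, forall M x, (N <= M)%N -> x \in `[l, r] -> \sum_(N <= n < M) `|s n x| <= t) ->
  exists F, usum l r s F.
Proof.
move=> hs; exists (fun x => limn (series (fun n => s n x))) => t t0.
have [N HN] := hs t t0; exists N => M x NM xlr; split; first exact: HN.
have scvg : cvgn (series (fun n => s n x)).
  have normE M' : [normed series (fun n => s n x)] M' = \sum_(0 <= n < M') `|s n x|.
    by [].
  apply: normed_cvg; apply: nondecreasing_is_cvgn.
    by move=> i j ij; rewrite !normE (big_cat_nat _ ij)//= lerDl sumr_ge0.
  exists (\sum_(0 <= n < N) `|s n x| + t) => _ [K _ <-]; rewrite normE.
  have [NK|/ltnW KN] := leqP N K; first by rewrite (big_cat_nat _ NK)//= lerD2l HN.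
  by rewrite (big_cat_nat _ KN)//= -addrA lerDl addr_ge0 ?(ltW t0)// sumr_ge0.
apply/ler_addgt0Pr => e e0.
have [K _ HK] := (cvgrPdist_le _ _).1 scvg e e0.
have := HK (maxn K M) (leq_maxl _ _); set L := maxn K M => H1.
have ML : (M <= L)%N by exact: leq_maxr.
have H2 : `|\sum_(M <= n < L) s n x| <= t.
  apply: le_trans (ler_norm_sum _ _ _) _.
  apply: le_trans (HN L x (leq_trans NM ML) xlr).
  by rewrite [leRHS](big_cat_nat NM ML)//= lerDr sumr_ge0.
rewrite distrC; move: H1; rewrite /series/= (big_cat_nat _ ML)//=.
move: (limn _) (\sum_(0 <= n < M) s n x) (\sum_(M <= n < L) s n x) H2 => w A B H2 H3.
rewrite (_ : w - A = (w - (A + B)) + B); last by ring.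
by rewrite (le_trans (ler_normD _ _))// addrC lerD.
Qed.

Lemma usum_cvg l r s F x : usum l r s F -> x \in `[l, r] ->
  (fun M => \sum_(0 <= n < M) s n x) @ \oo --> F x.
Proof.
move=> sF xlr; apply/cvgrPdist_le => t t0; have [N HN] := sF t t0.
by exists N => // M NM; rewrite distrC; exact: (HN M x NM xlr).2.
Qed.

Lemma usum_ext l r s F G : usum l r s F -> {in `[l, r], F =1 G} -> usum l r s G.
Proof.
move=> sF FG t t0; have [N HN] := sF t t0; exists N => M x NM xlr.
by rewrite -FG//; exact: HN.
Qed.

End UniformSums.

(** * The real transmission problem *)

Section RealProblem.
Context {R : realType} (P : transmission_data R) (hP : admissible P).
Variables q1 q2 : R -> R.

Local Notation mu := (@lebesgue_measure R).
Local Notation "'Int' l r f" := (\int[mu]_(t in `[l, r]) f t) (at level 10, l, r, f at level 9).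
Local Notation intg l r f := (mu.-integrable `[l, r] (EFin \o f)).
Local Notation a := (td_a P).
Local Notation c := (td_c P).
Local Notation b := (td_b P).
Local Notation cont l r f := {within `[l, r], continuous f}.

Hypothesis cq1 : cont a c q1.
Hypothesis cq2 : cont c b q2.

Local Notation hspace := (((R -> R) * (R -> R)) * R)%type.
Local Notation jets := (((R -> R) * (R -> R)) * ((R -> R) * (R -> R)))%type.

Implicit Types (F G g h : hspace) (u v : jets).

(* An element of the Hilbert space is given by its restrictions to [a, c] and [c, b]
   and its last component; a jet is (u, u') on [a, c] and on [c, b]. *)
Definition weight1 := gamma1 P * gamma2 P.
Definition weight2 := delta1 P * delta2 P.
Definition weight3 := delta1 P * delta2 P / rho P.

Definition ip F G : R := weight1 * Int a c (fun x => F.1.1 x * G.1.1 x)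
  + weight2 * Int c b (fun x => F.1.2 x * G.1.2 x) + weight3 * (F.2 * G.2).

Definition square_int F : Prop := L2on a c F.1.1 /\ L2on c b F.1.2.
Definition cont_pair F : Prop := cont a c F.1.1 /\ cont c b F.1.2.

Definition rbdry u : R := beta1 P * u.2.1 b - beta2 P * u.2.2 b.
Definition rbdry' u : R := beta1' P * u.2.1 b - beta2' P * u.2.2 b.
Definition jet0 u : hspace := ((u.1.1, u.2.1), rbdry' u).

(* - p'' + Q p = f with p' = d, in integrated form since f need not be continuous. *)
Definition sturm l r (Q f p d : R -> R) : Prop :=
  C1on l r p d /\ primitive_on l r d (fun x => Q x * p x - f x).

Definition interface u : Prop :=
  gamma1 P * u.1.1 c = delta1 P * u.2.1 c /\ gamma2 P * u.1.2 c = delta2 P * u.2.2 c.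

(** The graph of A, which sends (u, (u)'_beta) to (tau u, - (u)_beta). For g equal to lambda times
    [jet0 u] the last equation is the boundary condition at b. *)
Definition operator u g : Prop :=
  [/\ square_int g, sturm a c q1 g.1.1 u.1.1 u.1.2 /\ sturm c b q2 g.1.2 u.2.1 u.2.2,
      alpha1 P * u.1.1 a + alpha2 P * u.1.2 a = 0, interface u & g.2 = - rbdry u].

Let ac : a < c := adm_ac hP.
Let cb : c < b := adm_cb hP.
Let w1 : 0 < weight1 := adm_gamma12 hP.
Let w2 : 0 < weight2 := adm_delta12 hP.
Let w3 : 0 < weight3.
Proof. by rewrite /weight3 divr_gt0//; exact: (adm_rho hP). Qed.

Lemma hspace_comb (s : R) F G : s *: F + G =
  ((fun x => s * F.1.1 x + G.1.1 x, fun x => s * F.1.2 x + G.1.2 x), s * F.2 + G.2).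
Proof. rewrite /GRing.scale/= /GRing.add/=; reflexivity. Qed.

Lemma hspace_scale (s : R) F :
  s *: F = ((fun x => s * F.1.1 x, fun x => s * F.1.2 x), s * F.2).
Proof. rewrite /GRing.scale/=; reflexivity. Qed.

Lemma jets_comb (s : R) u v : s *: u + v =
  ((fun x => s * u.1.1 x + v.1.1 x, fun x => s * u.1.2 x + v.1.2 x),
   (fun x => s * u.2.1 x + v.2.1 x, fun x => s * u.2.2 x + v.2.2 x)).
Proof. rewrite /GRing.scale/= /GRing.add/=; reflexivity. Qed.

Lemma ipC F G : ip F G = ip G F.
Proof.
rewrite /ip (mulrC F.2); congr (_ * _ + _ * _ + _); apply: Int_eq => x _; exact: mulrC.
Qed.

Lemma ip_lin (s : R) F G h : square_int F -> square_int G -> square_int h ->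
  ip (s *: F + G) h = s * ip F h + ip G h.
Proof.
move=> [F1 F2] [G1 G2] [h1 h2]; rewrite hspace_comb /ip/=.
rewrite (@Int_eq _ a c _ (fun x => s * (F.1.1 x * h.1.1 x) + G.1.1 x * h.1.1 x)); last first.
  by move=> x _; rewrite /= mulrDl -mulrA.
rewrite Int_comb; [|exact: L2_mul..].
rewrite (@Int_eq _ c b _ (fun x => s * (F.1.2 x * h.1.2 x) + G.1.2 x * h.1.2 x)); last first.
  by move=> x _; rewrite /= mulrDl -mulrA.
rewrite Int_comb; [|exact: L2_mul..].
ring.
Qed.

Lemma square_int_comb (s : R) F G : square_int F -> square_int G -> square_int (s *: F + G).
Proof. by move=> [F1 F2] [G1 G2]; rewrite hspace_comb; split; exact: L2_comb. Qed.

Lemma cont_pair_comb (s : R) F G : cont_pair F -> cont_pair G -> cont_pair (s *: F + G).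
Proof. by move=> [F1 F2] [G1 G2]; rewrite hspace_comb; split; exact: within_comb. Qed.

Lemma cont_square_int F : cont_pair F -> square_int F.
Proof. by move=> [F1 F2]; split; exact: L2_cont. Qed.

Lemma cont_pair0 : cont_pair 0.
Proof. by split; exact: within_cst. Qed.

Lemma ip_parts_ge0 F : [/\ 0 <= Int a c (fun x => F.1.1 x * F.1.1 x),
  0 <= Int c b (fun x => F.1.2 x * F.1.2 x) & 0 <= F.2 * F.2].
Proof. by split; [apply: Rintegral_ge0 => x _..|]; rewrite -expr2 sqr_ge0. Qed.

Lemma ip_ge0 F : square_int F -> 0 <= ip F F.
Proof.
by have [h1 h2 h3] := ip_parts_ge0 F; rewrite /ip !addr_ge0// mulr_ge0// ltW.
Qed.

Lemma sturm_comb l r Q (s : R) (f g p d p' d' : R -> R) : sturm l r Q f p d -> sturm l r Q g p' d' ->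
  sturm l r Q (fun x => s * f x + g x) (fun x => s * p x + p' x) (fun x => s * d x + d' x).
Proof.
move=> [pd df] [pd' dg]; split; first exact: C1on_comb.
by apply: primitive_ext (primitive_comb s df dg) _ _ => // x _; ring.
Qed.

Lemma sturm_C1 l r (Q f p d : R -> R) : l <= r -> cont l r Q -> cont l r f -> sturm l r Q f p d ->
  C1on l r d (fun x => Q x * p x - f x).
Proof.
move=> lr cQ cf [[cp cd pd] dd]; apply: primitive_C1on => //.
by apply: within_sub => //; exact: within_mul.
Qed.

Lemma interface_comb (s : R) u v : interface u -> interface v -> interface (s *: u + v).
Proof.
move=> [u1 u2] [v1 v2]; rewrite jets_comb; split; rewrite /= mulrDr mulrCA.
  by rewrite u1 v1; ring.
by rewrite u2 v2; ring.
Qed.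

Lemma operator_comb (s : R) u v g h : operator u g -> operator v h ->
  operator (s *: u + v) (s *: g + h).
Proof.
move=> [Sg [u1 u2] ua ui gb] [Sh [v1 v2] va vi hb].
split; [exact: square_int_comb| | |exact: interface_comb|]; rewrite jets_comb ?hspace_comb/=.
- by split; exact: sturm_comb.
- rewrite (_ : _ + _ = s * (alpha1 P * u.1.1 a + alpha2 P * u.1.2 a) + (alpha1 P * v.1.1 a + alpha2 P * v.1.2 a)); last by ring.
  by rewrite ua va mulr0 addr0.
- by rewrite gb hb /rbdry/=; ring.
Qed.

Lemma rbdry_comb (s : R) u v : rbdry (s *: u + v) = s * rbdry u + rbdry v.
Proof. by rewrite jets_comb /rbdry/=; ring. Qed.

Lemma rbdry'_comb (s : R) u v : rbdry' (s *: u + v) = s * rbdry' u + rbdry' v.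
Proof. by rewrite jets_comb /rbdry'/=; ring. Qed.

Lemma jet0_comb (s : R) u v : jet0 (s *: u + v) = s *: jet0 u + jet0 v.
Proof. by rewrite /jet0 rbdry'_comb jets_comb hspace_comb. Qed.

Lemma operator_cont_pair u g : operator u g -> cont_pair (jet0 u).
Proof. by move=> [_ [[[? _ _] _] [[? _ _] _]] _ _ _]. Qed.

(** Lagrange's identity. Each of the two integrations by parts produces the integrals of d d' and Q
    p p', which cancel. *)
Lemma green l r (Q f f' p d p' d' : R -> R) : l <= r -> cont l r Q -> L2on l r f -> L2on l r f' ->
  sturm l r Q f p d -> sturm l r Q f' p' d' ->
  Int l r (fun x => f x * p' x) - Int l r (fun x => p x * f' x) =
  (p r * d' r - d r * p' r) - (p l * d' l - d l * p' l).
Proof.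
move=> lr cQ Lf Lf' [pd df] [pd' df'].
have [cp _ _] := pd; have [cp' _ _] := pd'.
have I1 := primitive_ibp lr df pd'; have I2 := primitive_ibp lr df' pd.
have J1 : Int l r (fun x => (Q x * p x - f x) * p' x) = Int l r (fun x => Q x * p x * p' x) - Int l r (fun x => f x * p' x).
  rewrite (Int_eq (g := fun x => -1 * (f x * p' x) + Q x * p x * p' x)); last by move=> x _; ring.
  rewrite Int_comb; first by ring.
  - by apply: L2_mul => //; exact: L2_cont.
  - by apply: within_intg; apply: within_mul => //; exact: within_mul.
have J2 : Int l r (fun x => (Q x * p' x - f' x) * p x) = Int l r (fun x => Q x * p x * p' x) - Int l r (fun x => p x * f' x).
  rewrite (Int_eq (g := fun x => -1 * (p x * f' x) + Q x * p x * p' x)); last by move=> x _; ring.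
  rewrite Int_comb; first by ring.
  - by apply: L2_mul => //; exact: L2_cont.
  - by apply: within_intg; apply: within_mul => //; exact: within_mul.
have J3 : Int l r (fun x => d x * d' x) = Int l r (fun x => d' x * d x).
  by apply: Int_eq => x _; exact: mulrC.
rewrite J1 in I1; rewrite J2 -J3 in I2.
set A := Int l r (fun x => f x * p' x) in I1 *; set B := Int l r (fun x => p x * f' x) in I2 *.
set X := Int l r (fun x => Q x * p x * p' x) in I1 I2; set Y := Int l r (fun x => d x * d' x) in I1 I2.
move: A B X Y I1 I2 => A B X Y I1 I2; lra.
Qed.

(** The boundary terms are brackets u v' - u' v. At a the bracket vanishes by the common boundary
    condition; at c the weights of the two segments make the one-sided brackets cancel; at b the
    last components contribute rho times the bracket, and the weight contains 1 / rho. *)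
Lemma operator_sym u v g h : operator u g -> operator v h -> ip g (jet0 v) = ip (jet0 u) h.
Proof.
move=> [[g1 g2] [u1 u2] ua [ui1 ui2] gb] [[h1 h2] [v1 v2] va [vi1 vi2] hb].
have G1 := green (ltW ac) cq1 g1 h1 u1 v1; have G2 := green (ltW cb) cq2 g2 h2 u2 v2.
rewrite /ip/= gb hb /rbdry /rbdry' /weight3.
have r0 : rho P != 0 by rewrite gt_eqF// (adm_rho hP).
have Wa : u.1.1 a * v.1.2 a - u.1.2 a * v.1.1 a = 0.
  have [a0|a0] := eqVneq (alpha1 P) 0.
    have a2 : alpha2 P != 0.
      by apply/eqP => a2; apply: (adm_alpha hP); rewrite a0 a2.
    move: ua va; rewrite a0 !mul0r !add0r => /eqP; rewrite mulf_eq0 (negbTE a2)/= => /eqP ->.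
    by move=> /eqP; rewrite mulf_eq0 (negbTE a2)/= => /eqP ->; ring.
  apply: (mulfI a0); rewrite mulr0.
  have -> : alpha1 P * (u.1.1 a * v.1.2 a - u.1.2 a * v.1.1 a) = (alpha1 P * u.1.1 a) * v.1.2 a - u.1.2 a * (alpha1 P * v.1.1 a) by ring.
  have -> : alpha1 P * u.1.1 a = - (alpha2 P * u.1.2 a) by lra.
  have -> : alpha1 P * v.1.1 a = - (alpha2 P * v.1.2 a) by lra.
  ring.
have Wc : weight1 * (u.1.1 c * v.1.2 c - u.1.2 c * v.1.1 c) = weight2 * (u.2.1 c * v.2.2 c - u.2.2 c * v.2.1 c).
  rewrite /weight1 /weight2.
  have -> : gamma1 P * gamma2 P * (u.1.1 c * v.1.2 c - u.1.2 c * v.1.1 c) = (gamma1 P * u.1.1 c) * (gamma2 P * v.1.2 c) - (gamma2 P * u.1.2 c) * (gamma1 P * v.1.1 c) by ring.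
  by rewrite ui1 ui2 vi1 vi2; ring.
rewrite Wa subr0 in G1.
move: G1 G2; 
set A1 := Int a c (fun x => g.1.1 x * v.1.1 x); set B1 := Int a c (fun x => u.1.1 x * h.1.1 x).
set A2 := Int c b (fun x => g.1.2 x * v.2.1 x); set B2 := Int c b (fun x => u.2.1 x * h.1.2 x).
move: A1 B1 A2 B2 => A1 B1 A2 B2 G1 G2.
apply/eqP; rewrite -subr_eq0; apply/eqP.
transitivity (weight1 * (A1 - B1) + weight2 * (A2 - B2) + weight2 / rho P * (rho P * (u.2.2 b * v.2.1 b - u.2.1 b * v.2.2 b))).
  by rewrite /weight2; set ir := (rho P)^-1; rewrite /rho; ring.
rewrite G1 G2 Wc; field; exact: r0.
Qed.

Lemma sturm_bound l r (Q : R -> R) (m : R) : l <= r -> cont l r Q ->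
  exists2 C : R, 0 <= C & forall f p d : R -> R, cont l r f ->
    sturm l r Q (fun x => m * p x + f x) p d ->
    forall x, x \in `[l, r] ->
      p x ^+ 2 + d x ^+ 2 <= C * (p l ^+ 2 + d l ^+ 2 + Int l r (fun x => f x * f x)).
Proof.
move=> lr cQ; have [M M0 QM] := cont_bounded (within_sub cQ (@within_cst R l r m)).
exists (expR ((M + 2) * (r - l))) => [|f p d cf pd x xlr]; first exact: expR_ge0.
have cp : cont l r p by case: pd => -[].
have dh : C1on l r d (fun x => Q x * p x - (m * p x + f x)).
  by apply: sturm_C1 pd => //; exact: within_comb.
have cff : cont l r (fun x => f x * f x) by exact: within_mul.
have G : C1on l r (fun x => Int l x (fun x => f x * f x)) (fun x => f x ^+ 2).
  by apply: C1on_ext (C1on_int lr cff) _ _ => // y _; rewrite expr2.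
have [pd' _] := pd.
have := ode_gronwall lr (ltW M0) pd' dh G _ xlr; rewrite set_itv1 Rintegral_set1 subr0.
move=> H; apply: le_trans (H _) _.
  move=> y /subset_itv_oo_cc/QM ylr.
  rewrite [X in `|X| <= _](_ : _ = (Q y - m) * p y); last by ring.
  by rewrite normrM ler_wpM2r.
rewrite ler_wpM2l ?expR_ge0// lerD2l; apply: Int_sub_le => //; first exact: within_intg.
by move=> y _; rewrite -expr2 sqr_ge0.
Qed.

Definition jet_bound u (B : R) : Prop :=
  (forall x, x \in `[a, c] -> u.1.1 x ^+ 2 + u.1.2 x ^+ 2 <= B) /\
  (forall x, x \in `[c, b] -> u.2.1 x ^+ 2 + u.2.2 x ^+ 2 <= B).

(** The equation (A - m) u = F without the conditions at a and b. *)
Definition initial_value (m : R) u F : Prop :=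
  [/\ cont_pair F, sturm a c q1 (fun x => m * u.1.1 x + F.1.1 x) u.1.1 u.1.2,
      sturm c b q2 (fun x => m * u.2.1 x + F.1.2 x) u.2.1 u.2.2 & interface u].

Lemma sqr_mass_le F : cont_pair F ->
  Int a c (fun x => F.1.1 x * F.1.1 x) <= weight1^-1 * ip F F /\
  Int c b (fun x => F.1.2 x * F.1.2 x) <= weight2^-1 * ip F F /\
  F.2 ^+ 2 <= weight3^-1 * ip F F.
Proof.
move=> _; have [h1 h2 h3] := ip_parts_ge0 F; rewrite expr2 /ip.
set A := Int a c (fun x => F.1.1 x * F.1.1 x) in h1 *.
set B := Int c b (fun x => F.1.2 x * F.1.2 x) in h2 *; set D := F.2 * F.2 in h3 *.
have H1 : 0 <= weight1 * A by rewrite mulr_ge0// ltW.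
have H2 : 0 <= weight2 * B by rewrite mulr_ge0// ltW.
have H3 : 0 <= weight3 * D by rewrite mulr_ge0// ltW.
split; first by rewrite ler_pdivlMl// -addrA lerDl addr_ge0.
by split; rewrite ler_pdivlMl//; [rewrite addrAC lerDr addr_ge0|rewrite lerDr addr_ge0].
Qed.

(** Gronwall on each segment: D1 carries the Cauchy data from a to c, k bounds their change under
    the transmission conditions, and D2 combines both with the estimate from c to b. *)
Lemma initial_value_bound (m : R) : exists2 C : R, 0 <= C & forall u F,
  initial_value m u F -> jet_bound u (C * (u.1.1 a ^+ 2 + u.1.2 a ^+ 2 + ip F F)).
Proof.
have [C1 C10 H1] := @sturm_bound a c q1 m (ltW ac) cq1.
have [C2 C20 H2] := @sturm_bound c b q2 m (ltW cb) cq2.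
pose k := (gamma1 P / delta1 P) ^+ 2 + (gamma2 P / delta2 P) ^+ 2.
have k0 : 0 <= k by rewrite addr_ge0// sqr_ge0.
pose D1 := C1 * (1 + weight1^-1).
have D10 : 0 <= D1 by rewrite mulr_ge0// addr_ge0// invr_ge0 ltW.
pose D2 := C2 * (k * D1 + weight2^-1).
have w2i : 0 <= weight2^-1 by rewrite invr_ge0 ltW.
have D20 : 0 <= D2 by rewrite mulr_ge0// addr_ge0// mulr_ge0.
exists (D1 + D2); first exact: addr_ge0.
move=> u F [cF S1 S2 [i1 i2]].
have [M1 [M2 _]] := sqr_mass_le cF; have [cF1 cF2] := cF.
have N0 : 0 <= ip F F by apply: ip_ge0; exact: cont_square_int.
set X := u.1.1 a ^+ 2 + u.1.2 a ^+ 2.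
have X0 : 0 <= X by rewrite addr_ge0// sqr_ge0.
have B1 x : x \in `[a, c] -> u.1.1 x ^+ 2 + u.1.2 x ^+ 2 <= D1 * (X + ip F F).
  move=> xac; rewrite (le_trans (H1 _ _ _ cF1 S1 x xac))// /D1 -mulrA ler_wpM2l// -/X.
  rewrite (le_trans (lerD (lexx _) M1))//.
  have -> : (1 + weight1^-1) * (X + ip F F) = X + weight1^-1 * ip F F + (weight1^-1 * X + ip F F).
    by move: (ip F F) => N; ring.
  have wX : 0 <= weight1^-1 * X by rewrite mulr_ge0// invr_ge0 ltW.
  by rewrite lerDl addr_ge0.
have [d1 d2] := adm_delta hP.
have E1 : u.2.1 c = gamma1 P / delta1 P * u.1.1 c.
  by rewrite mulrAC i1 mulrAC mulfV ?mul1r//; exact/eqP.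
have E2 : u.2.2 c = gamma2 P / delta2 P * u.1.2 c.
  by rewrite mulrAC i2 mulrAC mulfV ?mul1r//; exact/eqP.
have Bc : u.2.1 c ^+ 2 + u.2.2 c ^+ 2 <= k * (D1 * (X + ip F F)).
  have cac : c \in `[a, c] by rewrite in_itv/= lexx ltW.
  rewrite (le_trans _ (ler_wpM2l k0 (B1 c cac)))// E1 E2 /k.
  move: (gamma1 P / delta1 P) (gamma2 P / delta2 P) => s t.
  rewrite -subr_ge0 (_ : _ - _ = (s * u.1.2 c) ^+ 2 + (t * u.1.1 c) ^+ 2); last by ring.
  by rewrite addr_ge0// sqr_ge0.
split=> x xI.
  apply: le_trans (B1 x xI) _; apply: ler_wpM2r; first exact: addr_ge0.
  by rewrite lerDl.
rewrite (le_trans (H2 _ _ _ cF2 S2 x xI))//.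
apply: (@le_trans _ _ (D2 * (X + ip F F))); last first.
  apply: ler_wpM2r; first exact: addr_ge0.
  by rewrite lerDr.
rewrite /D2 -mulrA ler_wpM2l// mulrDl lerD//; first by rewrite -mulrA.
by apply: le_trans M2 _; apply: ler_wpM2l => //; rewrite lerDr.
Qed.

Lemma sqr_comb_le (s p d f e X Y : R) : s ^+ 2 * (p ^+ 2 + d ^+ 2) <= X ->
  f ^+ 2 + e ^+ 2 <= Y -> (s * p + f) ^+ 2 + (s * d + e) ^+ 2 <= 2 * X + 2 * Y.
Proof.
move=> H1 H2; have H3 := sqr_ge0 (s * p - f); have H4 := sqr_ge0 (s * d - e).
have -> : (s * p + f) ^+ 2 + (s * d + e) ^+ 2 = 2 * (s ^+ 2 * (p ^+ 2 + d ^+ 2)) +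
  2 * (f ^+ 2 + e ^+ 2) - ((s * p - f) ^+ 2 + (s * d - e) ^+ 2) by ring.
lra.
Qed.

(** * The resolvent at a real number m *)

Section Resolvent.
Variables (m : R) (phi : jets).
Hypothesis phi_ivp : initial_value m phi 0.
Hypothesis phi_a : phi.1.1 a = alpha2 P /\ phi.1.2 a = - alpha1 P.

(** It vanishes exactly when u satisfies the boundary condition at b with lambda = m; for phi it is
    the characteristic function of the problem. *)
Definition char_value u := rbdry u + m * rbdry' u.
Hypothesis phi_char : char_value phi != 0.

Let alpha_gt0 : 0 < alpha1 P ^+ 2 + alpha2 P ^+ 2.
Proof.
rewrite lt_def addr_ge0 ?sqr_ge0// andbT paddr_eq0 ?sqr_ge0// !sqrf_eq0.
by apply/negP => /andP[/eqP a1 /eqP a2]; apply: (adm_alpha hP); rewrite a1 a2.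
Qed.

Lemma char_comb (s : R) u v : char_value (s *: u + v) = s * char_value u + char_value v.
Proof. by rewrite /char_value rbdry_comb rbdry'_comb; ring. Qed.

Lemma initial_value_comb (s : R) u v F G : initial_value m u F -> initial_value m v G ->
  initial_value m (s *: u + v) (s *: F + G).
Proof.
move=> [cF F1 F2 Fi] [cG G1 G2 Gi].
split; [exact: cont_pair_comb| | |exact: interface_comb]; rewrite jets_comb hspace_comb/=.
- have [H1 H2] := sturm_comb s F1 G1; split=> //; apply: primitive_ext H2 _ _ => // x _; ring.
- have [H1 H2] := sturm_comb s F2 G2; split=> //; apply: primitive_ext H2 _ _ => // x _; ring.
Qed.

(** [operator u (m *: jet0 u + g)] is the form in which (A - m) u = g is stated throughout. *)
Lemma initial_value_operator u g : initial_value m u g -> alpha1 P * u.1.1 a + alpha2 P * u.1.2 a = 0 ->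
  char_value u = - g.2 -> operator u (m *: jet0 u + g).
Proof.
move=> [cg S1 S2 ui] ua ug; rewrite hspace_comb; split=> //=.
  have [[[c1 _ _] _] [[c2 _ _] _]] := (S1, S2); have [cg1 cg2] := cg.
  by apply: cont_square_int; split; exact: within_comb.
by move: ug; rewrite /char_value; lra.
Qed.

Lemma operator_initial_value u g : cont_pair g -> operator u (m *: jet0 u + g) ->
  initial_value m u g /\ char_value u = - g.2.
Proof.
move=> cg; rewrite hspace_comb => -[_ [S1 S2] _ ui] /= ug; split=> //.
by move: ug; rewrite /char_value; lra.
Qed.

(** The equation is solved with zero data at a; adding a multiple of phi keeps the condition at a
    and can be tuned to the one at b. *)
Lemma resolvent_exists g : cont_pair g -> exists u, operator u (m *: jet0 u + g).
Proof.
move=> cg; have [cg1 cg2] := cg.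
have cQ1 := within_sub cq1 (@within_cst R a c m); have cQ2 := within_sub cq2 (@within_cst R c b m).
have [p1 [e1 [C1 C1' p1a e1a]]] := linear_ode_exists 0 0 (ltW ac) cQ1 cg1.
have [p2 [e2 [C2 C2' p2c e2c]]] := linear_ode_exists (gamma1 P / delta1 P * p1 c) (gamma2 P / delta2 P * e1 c) (ltW cb) cQ2 cg2.
have [d1 d2] := adm_delta hP.
pose y : jets := ((p1, e1), (p2, e2)).
have yi : initial_value m y g.
  split=> //.
  - split=> //; apply: primitive_ext (C1on_primitive C1') _ _ => // x _; rewrite /=; ring.
  - split=> //; apply: primitive_ext (C1on_primitive C2') _ _ => // x _; rewrite /=; ring.
  - by split; rewrite /= ?p2c ?e2c mulrA mulrCA mulfV ?mulr1//; exact/eqP.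
pose t := (- g.2 - char_value y) / char_value phi.
exists (t *: phi + y); apply: initial_value_operator.
- have := initial_value_comb t phi_ivp yi; rewrite scaler0 add0r; exact.
- by rewrite jets_comb/= p1a e1a !addr0 phi_a.1 phi_a.2; ring.
- by rewrite char_comb /t divfK// subrK.
Qed.

(** The condition at a makes (u(a), u'(a)) orthogonal to (alpha1, alpha2), hence a multiple of
    (alpha2, - alpha1); s is the coefficient of the orthogonal projection. *)
Lemma left_bc_multiple u : alpha1 P * u.1.1 a + alpha2 P * u.1.2 a = 0 ->
  exists s : R, u.1.1 a = s * phi.1.1 a /\ u.1.2 a = s * phi.1.2 a.
Proof.
move=> ua; pose s := (alpha2 P * u.1.1 a - alpha1 P * u.1.2 a) / (alpha1 P ^+ 2 + alpha2 P ^+ 2).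
have an0 := lt0r_neq0 alpha_gt0.
have sn : s * (alpha1 P ^+ 2 + alpha2 P ^+ 2) = alpha2 P * u.1.1 a - alpha1 P * u.1.2 a by exact: divfK.
exists s; rewrite phi_a.1 phi_a.2; split; apply: (mulfI an0); rewrite [in RHS]mulrCA mulrA sn;
  apply/eqP; rewrite -subr_eq0.
- rewrite (_ : _ - _ = alpha1 P * (alpha1 P * u.1.1 a + alpha2 P * u.1.2 a)); last by ring.
  by rewrite ua mulr0.
- rewrite (_ : _ - _ = alpha2 P * (alpha1 P * u.1.1 a + alpha2 P * u.1.2 a)); last by ring.
  by rewrite ua mulr0.
Qed.

Lemma resolvent_bound : exists2 C : R, 0 <= C & forall u g, cont_pair g ->
  operator u (m *: jet0 u + g) -> jet_bound u (C * ip g g).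
Proof.
have [C C0 HC] := initial_value_bound m.
pose B := C * (phi.1.1 a ^+ 2 + phi.1.2 a ^+ 2 + ip 0 0).
have phiB : jet_bound phi B := HC _ _ phi_ivp.
have B0 : 0 <= B.
  by have := phiB.1 a; rewrite in_itv/= lexx ltW// => /(_ isT); apply: le_trans; rewrite addr_ge0// sqr_ge0.
pose x1 := beta1 P + m * beta1' P; pose x2 := beta2 P + m * beta2' P.
pose k := x1 ^+ 2 + x2 ^+ 2; have k0 : 0 <= k by rewrite addr_ge0// sqr_ge0.
have w3i : 0 <= weight3^-1 by rewrite invr_ge0 ltW.
(* For v = u - s phi, which has zero data at a, s times [char_value phi] is - g.2 - [char_value v].
   Squaring with (x + y)^2 <= 2 x^2 + 2 y^2 bounds s^2 by S times the squared norm of g. *)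
pose S := 2 * (weight3^-1 + k * C) / char_value phi ^+ 2.
have S0 : 0 <= S by rewrite divr_ge0 ?sqr_ge0// mulr_ge0// addr_ge0// mulr_ge0.
have T0 : 0 <= 2 * S * B + 2 * C.
  by apply: addr_ge0; apply: mulr_ge0 => //; exact: mulr_ge0.
exists (2 * S * B + 2 * C) => // u g cg ug.
have [uivp uchar] := operator_initial_value cg ug.
have [_ _ ua _ _] := ug.
set N := ip g g; have N0 : 0 <= N by apply: ip_ge0; exact: cont_square_int.
have [_ [_ g2N]] := sqr_mass_le cg; rewrite -/N in g2N.
have [s [s1 s2]] := left_bc_multiple ua.
pose v := - s *: phi + u.
have vivp : initial_value m v g.
  by have := initial_value_comb (- s) phi_ivp uivp; rewrite scaler0 add0r.
have vB : jet_bound v (C * N).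
  have := HC _ _ vivp; rewrite [X in C * (X ^+ 2 + _ + _)](_ : _ = 0); last first.
    by rewrite /v jets_comb/= s1; ring.
  rewrite [X in C * (_ + X ^+ 2 + _)](_ : _ = 0); last first.
    by rewrite /v jets_comb/= s2; ring.
  by rewrite expr0n !add0r.
have bcb : b \in `[c, b] by rewrite in_itv/= lexx ltW.
have chv : char_value v ^+ 2 <= k * (C * N).
  apply: le_trans (ler_wpM2l k0 (vB.2 b bcb)).
  rewrite (_ : char_value v = x1 * v.2.1 b - x2 * v.2.2 b); last first.
    by rewrite /char_value /rbdry /rbdry' /x1 /x2; ring.
  rewrite /k -subr_ge0 (_ : _ - _ = (x1 * v.2.2 b + x2 * v.2.1 b) ^+ 2); last by ring.
  exact: sqr_ge0.
have sS : s ^+ 2 <= S * N.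
  rewrite /S mulrAC ler_pdivlMr; last by rewrite exprn_even_gt0.
  have sE : s * char_value phi = - g.2 - char_value v.
    by rewrite /v char_comb uchar; ring.
  rewrite -exprMn sE (_ : 2 * _ * N = 2 * (weight3^-1 * N + k * (C * N))); last by ring.
  move: g2N chv; move: (char_value v) (g.2) (weight3^-1 * N) (k * (C * N)) => x y z t yz xt.
  have := sqr_ge0 (- y + x); rewrite !sqrrD; lra.
have final (p d f e : R) : p ^+ 2 + d ^+ 2 <= B -> f ^+ 2 + e ^+ 2 <= C * N ->
    (s * p + f) ^+ 2 + (s * d + e) ^+ 2 <= (2 * S * B + 2 * C) * N.
  move=> pd fe.
  have H1 : s ^+ 2 * (p ^+ 2 + d ^+ 2) <= S * N * B.
    by rewrite ler_pM ?sqr_ge0// addr_ge0// sqr_ge0.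
  rewrite (_ : _ * N = 2 * (S * N * B) + 2 * (C * N)); last by ring.
  exact: sqr_comb_le.
have vE : u = s *: phi + v by rewrite /v addrA scaleNr subrr add0r.
split=> x xI.
  have := final _ _ _ _ (phiB.1 x xI) (vB.1 x xI).
  by rewrite [in X in _ -> X]vE [in X in _ -> X]jets_comb.
have := final _ _ _ _ (phiB.2 x xI) (vB.2 x xI).
by rewrite [in X in _ -> X]vE [in X in _ -> X]jets_comb.
Qed.

(** The indefinite integral of f^2 lies between 0 and its value 0 at r, so its derivative f^2 is
    zero. *)
Lemma Int_sqr_eq0 l r (f : R -> R) : l < r -> cont l r f -> Int l r (fun x => f x * f x) = 0 ->
  forall x, x \in `[l, r] -> f x = 0.
Proof.
move=> lr cf f0; have cff : cont l r (fun x => f x * f x) by exact: within_mul.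
have f20 x : 0 <= f x * f x by rewrite -expr2 sqr_ge0.
have G0 : {in `[l, r], (fun x => Int l x (fun x => f x * f x)) =1 (fun=> 0)}.
  move=> x xlr; apply/eqP; rewrite eq_le; apply/andP; split; last by apply: Rintegral_ge0.
  by rewrite -f0; apply: Int_sub_le => //; exact: within_intg.
have C0 := C1on_ext (C1on_int (ltW lr) cff) G0 (fun x _ => erefl).
have Z := C1on_cst l r (0 : R).
move=> x xlr; have := C1on_uniq lr C0 Z xlr => /eqP.
by rewrite mulf_eq0 orbb => /eqP.
Qed.

Lemma ip_eq0 F : cont_pair F -> ip F F = 0 ->
  [/\ forall x, x \in `[a, c] -> F.1.1 x = 0, forall x, x \in `[c, b] -> F.1.2 x = 0 & F.2 = 0].
Proof.
move=> cF F0; have [H1 [H2 H3]] := sqr_mass_le cF; have [P1 P2 _] := ip_parts_ge0 F.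
have [cF1 cF2] := cF; rewrite F0 !mulr0 in H1 H2 H3; split.
- by apply: Int_sqr_eq0 => //; apply/le_anti; rewrite H1 P1.
- by apply: Int_sqr_eq0 => //; apply/le_anti; rewrite H2 P2.
- by apply/eqP; rewrite -sqrf_eq0 eq_le H3 sqr_ge0.
Qed.

Lemma Int_sqr_le l r (f : R -> R) (e : R) : l <= r -> cont l r f ->
  (forall x, x \in `[l, r] -> f x ^+ 2 <= e) -> Int l r (fun x => f x * f x) <= e * (r - l).
Proof.
move=> lr cf fe.
have -> : e * (r - l) = Int l r (fun=> e).
  have H : C1on l r (fun x => e * x + 0) (fun=> e).
    split; [|exact: within_cst|].
      apply: within_comb; last exact: within_cst.
      by apply: continuous_subspaceT => x; exact: cvg_id.
    by move=> x _; apply: is_derive_eq; rewrite /GRing.scale/=; ring.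
  by rewrite (C1on_ftc lr H); ring.
apply: Int_le; [by apply: within_intg; exact: within_mul|by apply: within_intg; exact: within_cst|].
by move=> x xlr; rewrite -expr2 fe.
Qed.

(** The squared norm of the element with all components equal to 1. *)
Definition total_mass := weight1 * (c - a) + weight2 * (b - c) + weight3.

Lemma total_mass_gt0 : 0 < total_mass.
Proof. by rewrite /total_mass !addr_gt0// mulr_gt0// subr_gt0. Qed.

Lemma ip_unif F (e : R) : cont_pair F ->
  (forall x, x \in `[a, c] -> F.1.1 x ^+ 2 <= e) ->
  (forall x, x \in `[c, b] -> F.1.2 x ^+ 2 <= e) -> F.2 ^+ 2 <= e -> ip F F <= total_mass * e.
Proof.
move=> [c1 c2] h1 h2 h3; have H1 := Int_sqr_le (ltW ac) c1 h1; have H2 := Int_sqr_le (ltW cb) c2 h2.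
rewrite /ip (_ : total_mass * e = weight1 * (e * (c - a)) + weight2 * (e * (b - c)) + weight3 * e); last first.
  by rewrite /total_mass; ring.
rewrite -expr2; apply: lerD; [apply: lerD|]; apply: ler_wpM2l => //; exact: ltW.
Qed.

(** In the constant, 1 accounts for the two functions, and the squares of the primed coefficients
    for the component (u)'_beta, by Cauchy-Schwarz. *)
Lemma jet_bound_ip u (B : R) : cont_pair (jet0 u) -> jet_bound u B ->
  ip (jet0 u) (jet0 u) <= total_mass * (1 + beta1' P ^+ 2 + beta2' P ^+ 2) * B.
Proof.
move=> cu [B1 B2].
have bcb : b \in `[c, b] by rewrite in_itv/= lexx ltW.
have B0 : 0 <= B by apply: le_trans (B2 b bcb); rewrite addr_ge0 ?sqr_ge0.
have k1 : B <= (1 + beta1' P ^+ 2 + beta2' P ^+ 2) * B.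
  by rewrite ler_peMl// -addrA lerDl addr_ge0 ?sqr_ge0.
rewrite -mulrA; apply: ip_unif => //=.
- by move=> x /B1 H; apply: le_trans k1; apply: le_trans H; rewrite lerDl sqr_ge0.
- by move=> x /B2 H; apply: le_trans k1; apply: le_trans H; rewrite lerDl sqr_ge0.
apply: (@le_trans _ _ ((beta1' P ^+ 2 + beta2' P ^+ 2) * B)); last first.
  by rewrite ler_wpM2r// -addrA lerDr.
apply: (@le_trans _ _ ((beta1' P ^+ 2 + beta2' P ^+ 2) * (u.2.1 b ^+ 2 + u.2.2 b ^+ 2))); last first.
  by apply: ler_wpM2l; [rewrite addr_ge0 ?sqr_ge0|exact: B2].
rewrite /rbdry' -subr_ge0 (_ : _ - _ = (beta1' P * u.2.2 b + beta2' P * u.2.1 b) ^+ 2); last by ring.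
exact: sqr_ge0.
Qed.

(** * Completeness of the eigenelements *)

Section Completeness.
Variables (e : nat -> jets) (lam : nat -> R).
Hypothesis e_op : forall n, operator (e n) (lam n *: jet0 (e n)).
Hypothesis lam_m : forall n, lam n != m.
Hypothesis e_all : forall (k : R) u, operator u (k *: jet0 u) ->
  (forall n, ip (jet0 u) (jet0 (e n)) = 0) -> ip (jet0 u) (jet0 u) = 0.

Let Se n : square_int (jet0 (e n)).
Proof. exact: cont_square_int (operator_cont_pair (e_op n)). Qed.

Let orth F := cont_pair F /\ forall n, ip F (jet0 (e n)) = 0.

Let orthS F : orth F -> square_int F.
Proof. by move=> [/cont_square_int]. Qed.

Let orth_comb (s : R) F G : orth F -> orth G -> orth (s *: F + G).
Proof.
move=> [cF F0] [cG G0]; split; first exact: cont_pair_comb.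
by move=> n; rewrite ip_lin ?F0 ?G0 ?mulr0 ?addr0//; exact: cont_square_int.
Qed.

Let square_int0 : square_int 0 := cont_square_int cont_pair0.

(** The resolvent divides the n-th Fourier coefficient by lam n - m, hence preserves orthogonality
    to all eigenelements. *)
Lemma resolvent_orth u g : cont_pair g -> operator u (m *: jet0 u + g) ->
  forall n, (lam n - m) * ip (jet0 u) (jet0 (e n)) = ip g (jet0 (e n)).
Proof.
move=> cg ug n; have Sg := cont_square_int cg.
have Su : square_int (jet0 u) := cont_square_int (operator_cont_pair ug).
have := operator_sym ug (e_op n); rewrite ip_lin// (ipC (jet0 u) (_ *: _)).
rewrite -[_ *: jet0 (e n)]addr0 ip_lin//.
rewrite (_ : ip 0 (jet0 u) = 0); last first.
  by have := ip_lin 1 square_int0 square_int0 Su; rewrite scaler0 addr0 mul1r; lra.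
by rewrite addr0 (ipC (jet0 (e n))) mulrBl => <-; ring.
Qed.

Lemma resolvent_sym u v g h : cont_pair g -> cont_pair h -> operator u (m *: jet0 u + g) ->
  operator v (m *: jet0 v + h) -> ip (jet0 u) h = ip g (jet0 v).
Proof.
move=> cg ch ug vh; have Sg := cont_square_int cg; have Sh := cont_square_int ch.
have Su : square_int (jet0 u) := cont_square_int (operator_cont_pair ug).
have Sv : square_int (jet0 v) := cont_square_int (operator_cont_pair vh).
have := operator_sym ug vh; rewrite ip_lin// (ipC (jet0 u) (_ + _)) ip_lin//.
by rewrite (ipC h) (ipC (jet0 v) (jet0 u)); lra.
Qed.

(** A continuous pair of norm 0 vanishes at every point; then so does its derivative, and the
    equation, continuous in x, leaves g = 0. *)
Lemma resolvent_injective u g : cont_pair g -> operator u (m *: jet0 u + g) ->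
  ip (jet0 u) (jet0 u) = 0 -> ip g g = 0.
Proof.
move=> cg ug u0; have [z1 z2 z3] := ip_eq0 (operator_cont_pair ug) u0.
have [cg1 cg2] := cg.
have zero l r (Q p d f : R -> R) : l < r -> cont l r Q -> cont l r f ->
    (forall x, x \in `[l, r] -> p x = 0) -> sturm l r Q (fun x => m * p x + f x) p d ->
    forall x, x \in `[l, r] -> d x = 0 /\ f x = 0.
  move=> lr cQ cf p0 pd.
  have Z := C1on_cst l r (0 : R).
  have [C1 _] := pd; have [cp _ _] := C1.
  have d0 := C1on_uniq lr (C1on_ext C1 p0 (fun x _ => erefl)) Z.
  have C2 := sturm_C1 (ltW lr) cQ (within_comb cp cf) pd.
  have h0 := C1on_uniq lr (C1on_ext C2 d0 (fun x _ => erefl)) Z.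
  move=> x xlr; split; first exact: d0.
  by have /= := h0 x xlr; rewrite (p0 x xlr) !mulr0 => H; lra.
have [ivp ch] := operator_initial_value cg ug; have [_ S1 S2 _] := ivp.
have Z1 := zero _ _ _ _ _ _ ac cq1 cg1 z1 S1; have Z2 := zero _ _ _ _ _ _ cb cq2 cg2 z2 S2.
apply/le_anti; rewrite ip_ge0 ?andbT; last exact: cont_square_int.
rewrite -(mulr0 total_mass); apply: ip_unif => //.
- by move=> x /Z1[_ ->]; rewrite expr0n.
- by move=> x /Z2[_ ->]; rewrite expr0n.
have bcb : b \in `[c, b] by rewrite in_itv/= lexx ltW.
have := ch; rewrite /char_value /rbdry /rbdry' (Z2 b bcb).1; have /= -> := z2 b bcb.
rewrite !mulr0 subrr mulr0 addr0 => /eqP; rewrite eq_sym oppr_eq0 => /eqP ->.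
by rewrite expr0n.
Qed.

Let small_scale (D t : R) : 0 < D -> 0 < t -> exists2 s : R, 0 < s & D * s ^+ 2 < t.
Proof.
move=> D0 t0; exists (Num.min 1 (t / (2 * D))); first by rewrite lt_min ltr01 divr_gt0// mulr_gt0.
set s := Num.min _ _; have s1 : s <= 1 by rewrite ge_min lexx.
have st : s <= t / (2 * D) by rewrite ge_min lexx orbT.
have s0 : 0 < s by rewrite lt_min ltr01 divr_gt0// mulr_gt0.
apply: (@le_lt_trans _ _ (D * (t / (2 * D)))).
  by rewrite ler_pM2l// expr2 (le_trans _ st)// ler_piMl// ltW.
rewrite (_ : D * _ = t / 2); last by field; exact: lt0r_neq0.
by rewrite ltr_pdivrMr// ltr_pMr// ltr1n.
Qed.

Lemma lip_cont (f : R -> R) (L l r : R) : 0 < L ->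
  (forall x y, `|f x - f y| <= L * `|x - y|) -> cont l r f.
Proof.
move=> L0 fL; apply/withinP => x t _ t0; exists (t / L); first exact: divr_gt0.
move=> y _; rewrite ltr_pdivlMr// mulrC => xy; exact: le_lt_trans (fL x y) xy.
Qed.

Lemma resolvent_compact (g : nat -> hspace) (u : nat -> jets) :
  (forall n, [/\ orth (g n), ip (g n) (g n) <= 1 & operator (u n) (m *: jet0 (u n) + g n)]) ->
  exists2 h, cont_pair h & forall (t : R) (N : nat), 0 < t -> exists2 n, (N <= n)%N &
    ip (-1 *: jet0 (u n) + h) (-1 *: jet0 (u n) + h) < t.
Proof.
move=> Hgu; have [C C0 HC] := resolvent_bound.
have ub n : jet_bound (u n) C.
  have [[cg _] g1 ug] := Hgu n; have [B1 B2] := HC _ _ cg ug.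
  have CC : C * ip (g n) (g n) <= C by rewrite ler_piMr.
  by split=> x xI; [exact: le_trans (B1 x xI) CC|exact: le_trans (B2 x xI) CC].
(* Since |z| <= 1 + z^2, the bound C on u^2 + u'^2 makes L a bound of u and, through u', a Lipschitz
   constant. *)
pose L := 1 + C; have L0 : 0 < L by rewrite ltr_pwDl.
have absL (x y : R) : x ^+ 2 + y ^+ 2 <= C -> `|x| <= L /\ `|y| <= L.
  have aux (z : R) : `|z| <= 1 + z ^+ 2.
    rewrite -(real_normK (num_real z)); move: (`|z|) => w.
    have := sqr_ge0 (w - 2^-1); rewrite sqrrB; lra.
  move=> xy; have := aux x; have := aux y; have := sqr_ge0 x; have := sqr_ge0 y.
  by rewrite /L => h1 h2 h3 h4; split; lra.
have bcb : b \in `[c, b] by rewrite in_itv/= lexx ltW.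
pose L3 := L * (1 + `|beta1' P| + `|beta2' P|).
have LL3 : L <= L3 by rewrite /L3 ler_peMr ?(ltW L0)// -addrA lerDl addr_ge0.
(* The three components of [jet0 (u n)] as one family of functions on the line, the boundary
   component being a constant function, so that a single cluster point serves all three. *)
pose v (n : nat) (i : option bool) (x : R) : R := match i with
  | Some true => (u n).1.1 (clamp a c x) | Some false => (u n).2.1 (clamp c b x)
  | None => rbdry' (u n) end.
have vC n i x : `|v n i x| <= L3.
  have [B1 B2] := ub n; case: i => [[]|] /=.
  - exact: le_trans (absL _ _ (B1 _ (clamp_itv x (ltW ac)))).1 LL3.
  - exact: le_trans (absL _ _ (B2 _ (clamp_itv x (ltW cb)))).1 LL3.
  have [h1 h2] := absL _ _ (B2 b bcb).
  rewrite (le_trans (ler_normB _ _))// !normrM /L3 !mulrDr mulr1 -addrA.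
  rewrite -[leLHS]add0r lerD ?(ltW L0)// (mulrC L) (mulrC L).
  by apply: lerD; rewrite ler_wpM2l.
have vL n i x y : `|v n i x - v n i y| <= L * `|x - y|.
  have [B1 B2] := ub n; have [_ _ ug] := Hgu n; have [_ [[S1 _] [S2 _]] _ _ _] := ug.
  case: i => [[]|] /=.
  - apply: (@le_trans _ _ (L * `|clamp a c x - clamp a c y|)); last by rewrite ler_pM2l// clamp_lip.
    apply: (C1on_lip S1); [|exact: clamp_itv (ltW ac)..].
    by move=> z /B1 H; exact: (absL _ _ H).2.
  - apply: (@le_trans _ _ (L * `|clamp c b x - clamp c b y|)); last by rewrite ler_pM2l// clamp_lip.
    apply: (C1on_lip S2); [|exact: clamp_itv (ltW cb)..].
    by move=> z /B2 H; exact: (absL _ _ H).2.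
  by rewrite subrr normr0 mulr_ge0// ltW.
pose B := `|a| + `|c| + `|b|.
have [h hL hcl] := lipschitz_cluster B L0 vC vL.
have abB x : a <= x -> x <= b -> `|x| <= B.
  move=> ax xb; rewrite ler_norml /B.
  have := ler_norm b; have := lerNnormlW (lexx `|a|); have := normr_ge0 a; have := normr_ge0 b; have := normr_ge0 c; lra.
exists ((h (Some true), h (Some false)), h None 0).
  by split; apply: (lip_cont L0) => x y; exact: hL.
move=> t N t0; have [s s0 st] := small_scale total_mass_gt0 t0.
have [n Nn Hn] := hcl s N s0; exists n => //; apply: le_lt_trans st.
have sq (x y : R) : `|x - y| < s -> (-1 * x + y) ^+ 2 <= s ^+ 2.
  move=> xy; rewrite (_ : _ + y = - (x - y)); last by ring.
  rewrite sqrrN -(real_normK (num_real (x - y))).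
  by rewrite ler_sqr ?nnegrE// ?ltW.
have [_ _ ugn] := Hgu n; have cun := operator_cont_pair ugn.
apply: ip_unif.
- by apply: cont_pair_comb => //; split; apply: (lip_cont L0) => x y; exact: hL.
- move=> x xac; rewrite hspace_comb /=; apply: sq; rewrite -[X in (u n).1.1 X](clamp_id xac).
  by apply: (Hn (Some true)); apply: abB; move: xac; rewrite in_itv/= => /andP[//] _; move: cb; lra.
- move=> x xcb; rewrite hspace_comb /=; apply: sq; rewrite -[X in (u n).2.1 X](clamp_id xcb).
  by apply: (Hn (Some false)); apply: abB; move: xcb; rewrite in_itv/= => /andP[+ //]; move: ac; lra.
rewrite hspace_comb/=; apply: sq; apply: (Hn None 0); rewrite normr0 /B !addr_ge0//.
Qed.

Theorem eigen_complete g : orth g -> ip g g = 0.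
Proof.
move=> og; have [cg g0] := og.
(* The solution is merely chosen for each g; no linearity of the choice is at hand. *)
have /choice[U HU] : forall g, exists u, cont_pair g -> operator u (m *: jet0 u + g).
  move=> f; have [cf|ncf] := pselect (cont_pair f); last by exists 0.
  by have [u Hu] := resolvent_exists cf; exists u.
pose K f := jet0 (U f).
have orthc f : orth f -> cont_pair f by case.
have UO f : orth f -> operator (U f) (m *: K f + f) by move=> /orthc; exact: HU.
have KO f : orth f -> orth (K f).
  move=> of'; split; first exact: operator_cont_pair (UO _ of').
  move=> n; have := resolvent_orth (orthc _ of') (UO _ of') n; rewrite of'.2 => /eqP.
  by rewrite mulf_eq0 subr_eq0 (negbTE (lam_m n))/= => /eqP.
have Ksym x y : orth x -> orth y -> ip (K x) y = ip x (K y).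
  by move=> ox oy; exact: (resolvent_sym (orthc _ ox) (orthc _ oy) (UO _ ox) (UO _ oy)).
have [C C0 HC] := resolvent_bound.
have Kbd : exists C : R, forall x, orth x -> ip (K x) (K x) <= C * ip x x.
  exists (total_mass * (1 + beta1' P ^+ 2 + beta2' P ^+ 2) * C) => x ox.
  rewrite -[leRHS]mulrA; apply: jet_bound_ip; last exact: HC (orthc _ ox) (UO _ ox).
  exact: (KO _ ox).1.
have Kcpt (x : nat -> hspace) : (forall n, orth (x n) /\ ip (x n) (x n) <= 1) ->
    exists2 h, orth h & forall (t : R) N, 0 < t -> exists2 n, (N <= n)%N &
      ip (-1 *: K (x n) + h) (-1 *: K (x n) + h) < t.
  move=> ox; have [n|h ch Hh] := @resolvent_compact x (fun n => U (x n)).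
    by have [h1 h2] := ox n; split=> //; exact: UO.
  (* The limit remains orthogonal to each e n, by Cauchy-Schwarz applied to h - K (x k). *)
  exists h => //; split=> // n; apply/eqP; rewrite -sqrf_eq0 eq_le sqr_ge0 andbT.
  apply/ler_addgt0Pr => t t0; rewrite add0r.
  have N0 := ip_ge0 (Se n); set N := ip (jet0 (e n)) (jet0 (e n)) in N0.
  have N1 : 0 < N + 1 by rewrite ltr_pwDr.
  have [k _ Hk] := Hh (t / (N + 1)) 0%N (divr_gt0 t0 N1).
  have oKk := KO _ (ox k).1; have Sh := cont_square_int ch.
  have := ip_CS square_int_comb ipC ip_lin ip_ge0 (square_int_comb (-1) (orthS oKk) Sh) (Se n).
  rewrite ip_lin//; last exact: orthS.
  rewrite oKk.2 mulr0 add0r -/N => H; apply: (le_trans H).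
  apply: (@le_trans _ _ (t / (N + 1) * N)); first by rewrite ler_wpM2r// ltW.
  by rewrite -mulrA ler_piMr ?(ltW t0)// mulrC ler_pdivrMr// mul1r lerDl.
have [ex|nex] := pselect (exists2 x, orth x & 0 < ip (K x) (K x)).
  have [v [k [ov v0 k0 Hv]]] := compact_symmetric_eigen square_int0 square_int_comb ipC ip_lin ip_ge0 orthS orth_comb KO Ksym Kbd Kcpt ex.
  have oKv := KO _ ov; have cw : cont_pair (- k *: v + K v) by apply: cont_pair_comb; [exact: orthc|exact: orthc].
  have [z1 z2 z3] := ip_eq0 cw Hv; rewrite hspace_comb/= in z1 z2 z3.
  (* K v = k v holds at every point, both sides being continuous. Hence (A - m) K v = v = K v / k,
     an eigenvalue equation for A. *)
  have wop : operator (U v) ((m + k^-1) *: K v).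
    have := UO v ov; rewrite hspace_comb => -[_ [[S1 S1'] [S2 S2']] h1 h2 h3].
    rewrite hspace_scale.
    have kE x y : - k * x + y = 0 -> x = k^-1 * y.
      by move=> H; apply: (mulfI k0); rewrite mulVKf//; lra.
    have [cv1 cv2] := orthc _ oKv.
    split=> //=.
    - by apply: cont_square_int; split; apply: within_mul => //; exact: within_cst.
    - split; split=> //.
        apply: primitive_ext S1' _ _ => // x xI; rewrite /=.
        by rewrite (kE _ _ (z1 x xI)); ring.
      apply: primitive_ext S2' _ _ => // x xI; rewrite /=.
      by rewrite (kE _ _ (z2 x xI)); ring.
    - by rewrite -h3 (kE _ _ z3)/=; ring.
  have := e_all wop oKv.2.
  have Sv := orthS ov; have SKv := orthS oKv.
  have := Hv; rewrite (ip_comb2 square_int_comb ipC ip_lin)// => E1 E2.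
  have := ip_null square_int_comb ipC ip_lin ip_ge0 SKv Sv E2; rewrite ipC => E3.
  move: E1; rewrite E2 -/(K v) E3 mulr0 !addr0 => /eqP; rewrite mulf_eq0 sqrf_eq0 oppr_eq0 (negbTE k0)/=.
  by move=> /eqP v00; move: v0; rewrite v00 ltxx.
apply: (resolvent_injective cg (UO _ og)).
apply/le_anti; rewrite ip_ge0 ?andbT; last exact: orthS (KO _ og).
by rewrite leNgt; apply/negP => H; apply: nex; exists g.
Qed.

Hypothesis e_on : forall i j, ip (jet0 (e i)) (jet0 (e j)) = (i == j)%:R.

Let jets_sum (r : seq nat) (s : nat -> R) :
  [/\ forall x, (\sum_(n <- r) s n *: e n).1.1 x = \sum_(n <- r) s n * (e n).1.1 x,
      forall x, (\sum_(n <- r) s n *: e n).1.2 x = \sum_(n <- r) s n * (e n).1.2 x,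
      forall x, (\sum_(n <- r) s n *: e n).2.1 x = \sum_(n <- r) s n * (e n).2.1 x
    & forall x, (\sum_(n <- r) s n *: e n).2.2 x = \sum_(n <- r) s n * (e n).2.2 x].
Proof.
elim: r => [|i r [h1 h2 h3 h4]]; first by split=> x; rewrite !big_nil.
by split=> x; rewrite !big_cons jets_comb/= ?h1 ?h2 ?h3 ?h4.
Qed.

Lemma operator0 : operator 0 0.
Proof.
have zz l r (Q : R -> R) : sturm l r Q (fun=> 0) (fun=> 0) (fun=> 0).
  have Z := C1on_cst l r (0 : R).
  by split=> //; apply: primitive_ext (C1on_primitive Z) _ _ => // x _; rewrite mulr0 subrr.
split; [exact: square_int0|by split; exact: zz|by rewrite !mulr0 addr0|by split; rewrite !mulr0|].
by rewrite /rbdry/= !mulr0 subrr oppr0.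
Qed.

(** A finite sum of eigenelements as the resolvent of another one, which is continuous, so that
    [resolvent_bound] applies to it. *)
Let operator_sum (r : seq nat) (s : nat -> R) : operator (\sum_(n <- r) s n *: e n)
  (m *: jet0 (\sum_(n <- r) s n *: e n) + \sum_(n <- r) (s n * (lam n - m)) *: jet0 (e n)).
Proof.
elim: r => [|i r IH].
  rewrite !big_nil addr0; have -> : jet0 0 = 0 by rewrite /jet0 /rbdry' /= !mulr0 subrr.
  by rewrite scaler0; exact: operator0.
rewrite !big_cons jet0_comb scalerDr scalerA addrACA -scalerDl.
rewrite (_ : m * s i + s i * (lam i - m) = s i * lam i); last by ring.
by rewrite -scalerA; exact: operator_comb.
Qed.

(** * The expansion of an element of the domain *)

Section Expansion.
Variables (f : jets) (g : hspace).
Hypothesis f_op : operator f g.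

Let cf n := ip (jet0 f) (jet0 (e n)).
Let Sf : square_int (jet0 f) := cont_square_int (operator_cont_pair f_op).
Let Sg : square_int g. Proof. by case: f_op. Qed.

(** This is (A - m) f. It is square integrable, possibly discontinuous, and enters only through
    Bessel's inequality. *)
Let defect : hspace := - m *: jet0 f + g.
Let Sdefect : square_int defect. Proof. exact: square_int_comb. Qed.
Let df n := ip defect (jet0 (e n)).

Let cf_df n : cf n * (lam n - m) = df n.
Proof.
rewrite /df /defect ip_lin// (operator_sym f_op (e_op n)).
rewrite (ipC _ (_ *: _)) -[_ *: jet0 (e n)]addr0 ip_lin//.
by rewrite (ip0l square_int0 ip_lin)// (ipC (jet0 (e n))) -/(cf n); ring.
Qed.

(** The bound depends on the moduli of the coefficients alone, which leaves their signs free. *)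
Let tail_bound : exists2 C : R, 0 <= C & forall (r : seq nat) (s : nat -> R), uniq r ->
  (forall n, `|s n| = `|cf n|) ->
  jet_bound (\sum_(n <- r) s n *: e n) (C * \sum_(n <- r) df n ^+ 2).
Proof.
have [C C0 HC] := resolvent_bound; exists C => // r s ur sE.
have Shs : cont_pair (\sum_(n <- r) (s n * (lam n - m)) *: jet0 (e n)).
  apply: (S_sum cont_pair0 cont_pair_comb) => n; exact: operator_cont_pair (e_op n).
have := HC _ _ Shs (operator_sum r s).
rewrite (ip_onsum square_int0 square_int_comb ipC ip_lin Se e_on)//.
rewrite (eq_bigr (fun n => df n ^+ 2))// => n _.
by rewrite -cf_df !exprMn -(real_normK (num_real (s n))) sE real_normK ?num_real.
Qed.

Let tails (t : R) : 0 < t -> exists N, forall M x, (N <= M)%N ->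
  (x \in `[a, c] -> \sum_(N <= n < M) `|cf n * (e n).1.1 x| <= t /\
                    \sum_(N <= n < M) `|cf n * (e n).1.2 x| <= t) /\
  (x \in `[c, b] -> \sum_(N <= n < M) `|cf n * (e n).2.1 x| <= t /\
                    \sum_(N <= n < M) `|cf n * (e n).2.2 x| <= t).
Proof.
move=> t0; have [C C0 HC] := tail_bound.
have C1 : 0 < C + 1 by rewrite ltr_pwDr.
have t2 : 0 < t ^+ 2 / (C + 1) by rewrite divr_gt0// exprn_gt0.
have [N HN] := @bounded_sum_tail R (fun n => df n ^+ 2) (ip defect defect) (fun n => sqr_ge0 _)
  (fun M => bessel square_int0 square_int_comb ipC ip_lin ip_ge0 Se e_on (iota_uniq _ _) Sdefect) _ t2.
exists N => M x NM.
(* The signs depend on the point x and on the component considered; N was fixed before them, so the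
   estimate is uniform. *)
pose sg (p : nat -> R) n := (-1) ^+ (cf n * p n < 0)%R * cf n.
have sgE p n : `|sg p n| = `|cf n| by rewrite /sg normrMsign.
have sgn p n : sg p n * p n = `|cf n * p n|.
  by rewrite /sg -mulrA; case: ltrP => [/ltr0_norm ->|/ger0_norm ->]; rewrite ?expr1 ?expr0 ?mulN1r ?mul1r.
have sumE p : \sum_(N <= n < M) sg p n * p n = \sum_(N <= n < M) `|cf n * p n|.
  by apply: eq_bigr => n _; exact: sgn.
have CB : C * \sum_(N <= n < M) df n ^+ 2 <= t ^+ 2.
  apply: (@le_trans _ _ (C * (t ^+ 2 / (C + 1)))); first by rewrite ler_wpM2l// HN.
  by rewrite mulrCA ler_piMr ?sqr_ge0// ler_pdivrMr// mul1r lerDl.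
have sq (X Y : R) : X ^+ 2 + Y ^+ 2 <= C * \sum_(N <= n < M) df n ^+ 2 -> X <= t /\ Y <= t.
  move=> H; have {}H := le_trans H CB.
  have X0 := sqr_ge0 X; have Y0 := sqr_ge0 Y.
  by split; apply: (@le_trans _ _ `|_|) (ler_norm _) _;
    rewrite -ler_sqr ?nnegrE ?(ltW t0)// real_normK ?num_real//; lra.
have un : uniq (index_iota N M) by exact: iota_uniq.
split=> xI; split.
- have [B1 _] := HC _ _ un (sgE (fun n => (e n).1.1 x)); have := (sq _ _ (B1 x xI)).1.
  by have [-> _ _ _] := jets_sum (index_iota N M) (sg (fun n => (e n).1.1 x)); rewrite sumE.
- have [B1 _] := HC _ _ un (sgE (fun n => (e n).1.2 x)); have := (sq _ _ (B1 x xI)).2.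
  by have [_ -> _ _] := jets_sum (index_iota N M) (sg (fun n => (e n).1.2 x)); rewrite sumE.
- have [_ B1] := HC _ _ un (sgE (fun n => (e n).2.1 x)); have := (sq _ _ (B1 x xI)).1.
  by have [_ _ -> _] := jets_sum (index_iota N M) (sg (fun n => (e n).2.1 x)); rewrite sumE.
- have [_ B1] := HC _ _ un (sgE (fun n => (e n).2.2 x)); have := (sq _ _ (B1 x xI)).2.
  by have [_ _ _ ->] := jets_sum (index_iota N M) (sg (fun n => (e n).2.2 x)); rewrite sumE.
Qed.

Let limit_C1on l r (p d : nat -> R -> R) w z : (forall n, C1on l r (p n) (d n)) ->
  usum l r (fun n x => cf n * p n x) w -> usum l r (fun n x => cf n * d n x) z -> C1on l r w z.
Proof.
move=> pd uw uz; apply: (@C1on_lim _ l r (fun M x => \sum_(0 <= n < M) cf n * p n x) (fun M x => \sum_(0 <= n < M) cf n * d n x)).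
- elim=> [|M IH].
    by apply: C1on_ext (C1on_cst l r 0) _ _ => x _; rewrite big_geq.
  by apply: C1on_ext (C1on_comb (cf M) (pd M) IH) _ _ => x _; rewrite big_nat_recr//= addrC.
- by move=> x xI; exact: usum_cvg uw xI.
- move=> t t0; have [N HN] := uz t t0; exists N => M NM x xI; exact: (HN M x NM xI).2.
Qed.

Theorem expansion :
  [/\ usum a c (fun n x => cf n * (e n).1.1 x) f.1.1,
      usum a c (fun n x => cf n * (e n).1.2 x) f.1.2,
      usum c b (fun n x => cf n * (e n).2.1 x) f.2.1
    & usum c b (fun n x => cf n * (e n).2.2 x) f.2.2].
Proof.
have [|w11 u11] := @usum_ex R a c (fun n x => cf n * (e n).1.1 x).
  by move=> t /tails[N HN]; exists N => M x NM; case: (HN M x NM) => + _ => /[apply] -[].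
have [|w12 u12] := @usum_ex R a c (fun n x => cf n * (e n).1.2 x).
  by move=> t /tails[N HN]; exists N => M x NM; case: (HN M x NM) => + _ => /[apply] -[].
have [|w21 u21] := @usum_ex R c b (fun n x => cf n * (e n).2.1 x).
  by move=> t /tails[N HN]; exists N => M x NM; case: (HN M x NM) => _ /[apply] -[].
have [|w22 u22] := @usum_ex R c b (fun n x => cf n * (e n).2.2 x).
  by move=> t /tails[N HN]; exists N => M x NM; case: (HN M x NM) => _ /[apply] -[].
have W1 : C1on a c w11 w12.
  by apply: limit_C1on u11 u12 => n; have [_ [[? _] _] _ _ _] := e_op n.
have W2 : C1on c b w21 w22.
  by apply: limit_C1on u21 u22 => n; have [_ [_ [? _]] _ _ _] := e_op n.
pose w : jets := ((w11, w12), (w21, w22)).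
have cw : cont_pair (jet0 w) by split; [case: W1|case: W2].
have cF := operator_cont_pair f_op.
have bcb : b \in `[c, b] by rewrite in_itv/= lexx ltW.
have Sw := cont_square_int cw.
(* The partial sums y have this coefficient once M > n, and converge to w in norm because they
   converge uniformly. Their boundary components converge thanks to the series of derivatives at b,
   which is the role of [u22]. *)
have wn n : ip (jet0 w) (jet0 (e n)) = cf n.
  apply/eqP; rewrite -subr_eq0 -sqrf_eq0 eq_le sqr_ge0 andbT.
  apply/ler_addgt0Pr => t t0; rewrite add0r.
  pose k := 1 + `|beta1' P| + `|beta2' P|.
  have k1 : 1 <= k by rewrite /k -addrA lerDl addr_ge0.
  have k0 : 0 < k by exact: lt_le_trans k1.
  have [s s0 st] := small_scale (mulr_gt0 total_mass_gt0 (exprn_gt0 2 k0)) t0.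
  have [N1 H1] := u11 s s0; have [N2 H2] := u21 s s0; have [N3 H3] := u22 s s0.
  pose M := maxn n.+1 (maxn N1 (maxn N2 N3)).
  have M0 : (n < M)%N by rewrite leq_max leqnn.
  have M1 : (N1 <= M)%N by rewrite !leq_max leqnn orbT.
  have M2 : (N2 <= M)%N by rewrite !leq_max leqnn !orbT.
  have M3 : (N3 <= M)%N by rewrite !leq_max leqnn !orbT.
  pose y : jets := \sum_(0 <= i < M) cf i *: e i.
  have [y1 _ y3 y4] := jets_sum (index_iota 0 M) cf.
  have oy := operator_sum (index_iota 0 M) cf.
  have cy := operator_cont_pair oy; have Sy := cont_square_int cy.
  have yn : ip (jet0 y) (jet0 (e n)) = cf n.
    have -> : jet0 y = \sum_(0 <= i < M) cf i *: jet0 (e i).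
      rewrite /y; elim: (index_iota 0 M) => [|i q IH].
        by rewrite !big_nil /jet0 /rbdry' /= !mulr0 subrr.
      by rewrite !big_cons jet0_comb IH.
    rewrite (ip_sum square_int0 square_int_comb ip_lin)//.
    rewrite (bigD1_seq n)/= ?iota_uniq// ?mem_index_iota// e_on eqxx mulr1 big1 ?addr0// => i ni.
    by rewrite e_on (negbTE ni) mulr0.
  have -> : ip (jet0 w) (jet0 (e n)) - cf n = ip (-1 *: jet0 y + jet0 w) (jet0 (e n)).
    by rewrite ip_lin// yn; ring.
  apply: le_trans (ip_CS square_int_comb ipC ip_lin ip_ge0 (square_int_comb (-1) Sy Sw) (Se n)) _.
  rewrite e_on eqxx mulr1 (le_trans _ (ltW st))// -mulrA -exprMn.
  have sq (x z : R) : `|x - z| <= k * s -> (-1 * x + z) ^+ 2 <= (k * s) ^+ 2.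
    move=> xz; rewrite (_ : _ + z = - (x - z)); last by ring.
    have ks0 : 0 <= k * s by rewrite ltW// mulr_gt0.
    by rewrite sqrrN -(real_normK (num_real (x - z))) ler_sqr ?nnegrE.
  have sks : s <= k * s by rewrite ler_peMl// ltW.
  apply: ip_unif; first exact: cont_pair_comb.
  - move=> x xI; rewrite hspace_comb/=; apply: sq; rewrite y1.
    exact: le_trans (H1 M x M1 xI).2 sks.
  - move=> x xI; rewrite hspace_comb/=; apply: sq; rewrite y3.
    exact: le_trans (H2 M x M2 xI).2 sks.
  rewrite hspace_comb/=; apply: sq; rewrite /rbdry' y3 y4/=.
  have h2 := (H2 M b M2 bcb).2; have h3 := (H3 M b M3 bcb).2; move: h2 h3.
  move: (\sum_(0 <= i < M) cf i * (e i).2.1 b) (\sum_(0 <= i < M) cf i * (e i).2.2 b) (w21 b) (w22 b) => A B A' B' h2 h3.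
  rewrite (_ : _ - _ = beta1' P * (A - A') - beta2' P * (B - B')); last by ring.
  rewrite (le_trans (ler_normB _ _))// !normrM /k !mulrDl mul1r -addrA.
  rewrite -[leLHS]add0r lerD ?(ltW s0)//.
  by apply: lerD; rewrite ler_wpM2l.
(* By completeness this continuous difference is null, so w and f agree on both segments, and their
   derivatives agree by [C1on_uniq]. *)
have od : orth (-1 *: jet0 f + jet0 w).
  split; first exact: cont_pair_comb.
  by move=> n; rewrite ip_lin// wn -/(cf n); ring.
have := eigen_complete od; move=> /(ip_eq0 od.1); rewrite hspace_comb => -[/= z1 z2 _].
have E1 : {in `[a, c], w11 =1 f.1.1} by move=> x /z1; lra.
have E2 : {in `[c, b], w21 =1 f.2.1} by move=> x /z2; lra.
have [_ [[F1 _] [F2 _]] _ _ _] := f_op.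
split; [exact: usum_ext u11 E1| |exact: usum_ext u21 E2|].
- apply: usum_ext u12 _; exact: (C1on_uniq ac (C1on_ext W1 E1 (fun x _ => erefl)) F1).
- apply: usum_ext u22 _; exact: (C1on_uniq cb (C1on_ext W2 E2 (fun x _ => erefl)) F2).
Qed.

End Expansion.

End Completeness.

End Resolvent.

End RealProblem.

(** * From complex functions on J to real functions on the two segments *)

Section Punctured.
Context {R : realType}.
Implicit Types (f d : R -> R) (I : set R).

Definition tends I f (x L : R) : Prop := forall e : R, 0 < e -> exists2 t : R, 0 < t &
  forall y, I y -> `|x - y| < t -> `|f y - L| <= e.

(** The difference quotient is multiplied out, so that y = x needs no exclusion. *)
Definition rel_deriv I f (x d : R) : Prop := forall e : R, 0 < e -> exists2 t : R, 0 < t &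
  forall y, I y -> `|x - y| < t -> `|f y - f x - d * (y - x)| <= e * `|y - x|.

(* Nothing is known of f at k: its value there is replaced by a one-sided limit. *)
Definition ext (k : R) f (L x : R) : R := if x == k then L else f x.

Definition punctured (l r k : R) : set R := [set y | y \in `[l, r] /\ y != k].

Lemma rel_deriv_tends I f (x d : R) : rel_deriv I f x d -> tends I f x (f x).
Proof.
move=> /(_ 1 ltr01)[t t0 H] e e0.
pose k := 1 + `|d|; have k0 : 0 < k by rewrite ltr_pwDl.
exists (Num.min t (e / k)); first by rewrite lt_min t0 divr_gt0.
move=> y Iy; rewrite lt_min => /andP[/(H y Iy) H1]; rewrite ltr_pdivlMr// distrC => H2.
apply: (@le_trans _ _ (`|f y - f x - d * (y - x)| + `|d * (y - x)|)).
  by rewrite (le_trans _ (ler_normD _ _))// subrK.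
by rewrite normrM (le_trans (lerD H1 (lexx _)))// -mulrDl mulrC ltW.
Qed.

Lemma ext_cont (l r k : R) f (L : R) : (forall x, punctured l r k x -> tends (punctured l r k) f x (f x)) ->
  tends (punctured l r k) f k L -> {within `[l, r], continuous (ext k f L)}.
Proof.
move=> cf fL; apply/withinP => x e xlr e0.
have e2 : 0 < e / 2 by rewrite divr_gt0.
have ee : e / 2 < e by rewrite ltr_pdivrMr// ltr_pMr// ltr1n.
have [xk|xk] := eqVneq x k.
  have [t t0 H] := fL _ e2; exists t => // y ylr xy; rewrite /ext xk eqxx distrC.
  case: eqVneq => [_|yk]; first by rewrite subrr normr0.
  by apply: le_lt_trans ee; apply: H => //; rewrite -xk.
have [t t0 H] := cf x (conj xlr xk) _ e2.
exists (Num.min t `|x - k|); first by rewrite lt_min t0 normr_gt0 subr_eq0.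
move=> y ylr; rewrite lt_min => /andP[xy xyk]; rewrite /ext (negbTE xk) distrC.
case: eqVneq => [yk|yk]; first by move: xyk; rewrite yk ltxx.
by apply: le_lt_trans ee; apply: H.
Qed.

Lemma ext_is_derive (l r k : R) f (L x d : R) : k \notin `]l, r[ -> x \in `]l, r[ ->
  rel_deriv (punctured l r k) f x d -> is_derive x 1 (ext k f L) d.
Proof.
move=> kI xI fd; have xk : x != k by apply: contraNneq kI => <-.
apply: is_derive_of_dist => e e0; have [t t0 H] := fd e e0; rewrite /ext (negbTE xk).
near=> y.
have yI : y \in `]l, r[ by near: y; exact: near_itv_oo.
have yk : y != k by apply: contraNneq kI => <-.
rewrite (negbTE yk); apply: H; first by split=> //; exact: subset_itv_oo_cc.
by near: y; exists t.
Unshelve. all: by end_near. Qed.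

(** A family that touches k is pushed off it by clamping to a slightly smaller segment. Endpoints
    move only near k, where f is close to its limit L. *)
Lemma ext_abs_cont (l r k : R) f (L : R) : l < r -> (k = l \/ k = r) ->
  (forall e : R, 0 < e -> exists2 d : R, 0 < d & forall F, itv_family l r F ->
    all (fun p => (p.1 != k) && (p.2 != k)) F -> total_length F < d -> family_variation f F < e) ->
  tends (punctured l r k) f k L -> real_abs_cont l r (ext k f L).
Proof.
move=> lr kE H fL e e0; have [d d0 Hd] := H (e / 2) (divr_gt0 e0 (ltr0n _ 2)).
exists d => // F FI Fd.
pose n : R := (size F)%:R; have n0 : 0 <= n by exact: ler0n.
(* Moving an endpoint costs at most 2 eta, hence 4 eta for each of the n intervals, in total at most
   e / 2. This may depend on the family, since d is already fixed. *)
pose eta := e / (8 * (n + 1)).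
have eta0 : 0 < eta by rewrite divr_gt0// mulr_gt0// ltr_wpDl.
have [t t0 Ht] := fL _ eta0.
pose tt := Num.min (t / 2) ((r - l) / 2).
have tt0 : 0 < tt by rewrite lt_min !divr_gt0// subr_gt0.
have ttt : tt < t by rewrite gt_min ltr_pdivrMr// ltr_pMr// ltr1n.
have ttlr : tt < r - l by rewrite gt_min orbC ltr_pdivrMr// ltr_pMr ?subr_gt0// ltr1n.
have [s [s' [ls sr cK]]] : exists s s', [/\ l <= s <= s', s' <= r & forall y, y \in `[l, r] ->
    clamp s s' y != k /\ (clamp s s' y = y \/ `|k - y| < t /\ `|k - clamp s s' y| < t)].
  case: kE => ->.
    exists (l + tt), r; split=> //; first by apply/andP; split; lra.
    move=> y; rewrite in_itv/= => /andP[ly yr]; rewrite /clamp (min_l yr).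
    have [yt|yt] := leP (l + tt) y; first by split; [apply/eqP; lra|left].
    split; first by apply/eqP; lra.
    by right; split; rewrite ltr_norml; apply/andP; split; lra.
  exists l, (r - tt); split=> //; first (by apply/andP; split; lra); first lra.
  move=> y; rewrite in_itv/= => /andP[ly yr]; rewrite /clamp max_r; last first.
    by rewrite le_min ly; lra.
  have [yt|yt] := leP y (r - tt); first by split; [apply/eqP; lra|left].
  split; first by apply/eqP; lra.
  by right; split; rewrite ltr_norml; apply/andP; split; lra.
have /andP[ls1 ss'] := ls.
have cI y : clamp s s' y \in `[l, r].
  have := clamp_itv y ss'; rewrite !in_itv/= => /andP[h1 h2].
  by rewrite (le_trans ls1 h1) (le_trans h2 sr).
have osc y : y \in `[l, r] -> `|ext k f L y - f (clamp s s' y)| <= 2 * eta.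
  move=> ylr; have [ck [cy|[ky kc]]] := cK y ylr.
    have yk : y != k by rewrite -{1}cy.
    by rewrite cy /ext (negbTE yk) subrr normr0 mulr_ge0// ltW.
  have H1 := Ht _ (conj (cI y) ck) kc.
  have H2 : `|ext k f L y - L| <= eta.
    rewrite /ext; case: eqVneq => yk; first by rewrite subrr normr0 ltW.
    exact: (Ht _ (conj ylr yk) ky).
  rewrite (_ : _ - _ = (ext k f L y - L) - (f (clamp s s' y) - L)); last by ring.
  rewrite (le_trans (ler_normB _ _))//; move: H1 H2; lra.
have /andP[F1 F2] := FI.
pose G := [seq (clamp s s' p.1, clamp s s' p.2) | p <- F].
have GI : itv_family l r G.
  apply/andP; split.
    rewrite all_map; apply: sub_all F1 => p /= /and3P[_ _ p12].
    by rewrite !cI/= clamp_homo.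
  rewrite pairwise_map; apply: sub_pairwise F2 => p q /=; rewrite /apart/=.
  by case/orP => h; apply/orP; [left|right]; exact: clamp_homo.
have Gk : all (fun p => (p.1 != k) && (p.2 != k)) G.
  rewrite all_map; apply: sub_all F1 => p /= /and3P[h1 h2 _].
  by rewrite (cK _ h1).1 (cK _ h2).1.
have Gd : total_length G < d.
  apply: le_lt_trans Fd; rewrite /total_length big_map/= !big_seq; apply: ler_sum => p pF.
  have /and3P[_ _ p12] := allP F1 p pF.
  have := clamp_lip s s' p.2 p.1; rewrite !ger0_norm ?subr_ge0//; exact: clamp_homo.
have Gv := Hd G GI Gk Gd.
have : family_variation (ext k f L) F <= family_variation f G + 4 * eta * n.
  rewrite /family_variation big_map/= /n.
  apply: (@le_trans _ _ (\sum_(p <- F) (`|f (clamp s s' p.2) - f (clamp s s' p.1)| + 4 * eta))).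
    rewrite !big_seq; apply: ler_sum => p pF; have /and3P[h1 h2 _] := allP F1 p pF.
    have := osc _ h1; have := osc _ h2.
    move: (ext k f L p.1) (ext k f L p.2) (f (clamp s s' p.1)) (f (clamp s s' p.2)) => A B A' B' hB hA.
    rewrite (_ : B - A = (B' - A') + ((B - B') - (A - A'))); last by ring.
    apply: le_trans (ler_normD _ _) _; rewrite lerD2l.
    by apply: le_trans (ler_normB _ _) _; move: hA hB; lra.
  by rewrite big_split/= lerD2l big_const_seq count_predT iter_addr_0 mulr_natr.
have : 4 * eta * n <= e / 2.
  rewrite (_ : 4 * eta * n = e / 2 * (n / (n + 1))); last by rewrite /eta; field; lra.
  by rewrite ler_piMr ?divr_ge0 ?(ltW e0)// ler_pdivrMr ?mul1r ?lerDl// ltr_wpDl.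
by move: Gv; lra.
Qed.

End Punctured.

(** * Real and imaginary parts *)

Section ComplexParts.
Context {R : realType}.
Implicit Types (z w : R[i]) (i : bool).
Local Open Scope complex_scope.

Definition part i z : R := if i then complex.Re z else complex.Im z.

Lemma partD i z w : part i (z + w) = part i z + part i w.
Proof. by case: z => z1 z2; case: w => w1 w2; case: i. Qed.

Lemma partN i z : part i (- z) = - part i z.
Proof. by case: z => z1 z2; case: i. Qed.

Lemma partB i z w : part i (z - w) = part i z - part i w.
Proof. by rewrite partD partN. Qed.

Lemma part_scale i (k : R) z : part i (k%:C * z) = k * part i z.
Proof. by case: z => z1 z2; case: i; rewrite /part/=; ring. Qed.

Lemma ReM z w : complex.Re (z * w) = complex.Re z * complex.Re w - complex.Im z * complex.Im w.
Proof. by case: z => z1 z2; case: w. Qed.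

Lemma ImM z w : complex.Im (z * w) = complex.Re z * complex.Im w + complex.Im z * complex.Re w.
Proof. by case: z => z1 z2; case: w. Qed.

Lemma part_inj z w : (forall i, part i z = part i w) -> z = w.
Proof. by move=> H; have := H true; have := H false; case: z w {H} => [z1 z2] [w1 w2] /= -> ->. Qed.

Lemma part_norm_le i z (e : R) : `|z| <= e%:C -> `|part i z| <= e.
Proof.
rewrite normc_def lecR; apply: le_trans; rewrite -sqrtr_sqr ler_wsqrtr//.
by case: i; rewrite /part ?lerDl ?lerDr sqr_ge0.
Qed.

Lemma norm_le_parts z : `|z| <= (`|complex.Re z| + `|complex.Im z|)%:C.
Proof.
rewrite {1}[z]complexE (le_trans (ler_normD _ _))// normrM.
rewrite !normc_def/= !expr0n/= !expr1n !add0r !addr0 !sqrtr_sqr sqrtr1 mul1r.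
by rewrite lecE/= !addr0 eqxx/=.
Qed.

Lemma complex_pos (e : R[i]) : 0 < e -> exists2 e' : R, 0 < e' & e = e'%:C.
Proof.
by case: e => x y; rewrite ltcE/= => /andP[/eqP -> x0]; exists x.
Qed.

Lemma cvg_complexP {T : Type} (F : set_system T) {FF : Filter F} (f : T -> Cplx R) (z : Cplx R) :
  f @ F --> z <-> forall e : R, 0 < e -> \forall t \near F, `|z - f t| <= e%:C.
Proof.
split=> [/cvgrPdist_le H e e0|H]; first by apply: H; rewrite ltcE/= eqxx.
by apply/cvgrPdist_le => e /complex_pos[e' e0 ->]; exact: H.
Qed.

Lemma cvg_part {T : Type} (F : set_system T) {FF : Filter F} i (f : T -> Cplx R) (z : Cplx R) :
  f @ F --> z -> (fun t => part i (f t)) @ F --> part i z.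
Proof.
move=> /cvg_complexP H; apply/cvgrPdist_le => e /H; apply: filterS => t.
by rewrite -partB; exact: part_norm_le.
Qed.

Lemma cvg_of_parts {T : Type} (F : set_system T) {FF : Filter F} (f : T -> Cplx R) (z : Cplx R) :
  (forall i, (fun t => part i (f t)) @ F --> part i z) -> f @ F --> z.
Proof.
move=> H; apply/cvg_complexP => e e0; have e2 : 0 < e / 2 by rewrite divr_gt0.
have /cvgrPdist_le/(_ _ e2) H1 := H true; have /cvgrPdist_le/(_ _ e2) H2 := H false.
apply: filterS2 H1 H2 => t; rewrite /= -!raddfB => h1 h2; apply: le_trans (norm_le_parts _) _.
by rewrite lecR (splitr e) lerD.
Qed.

End ComplexParts.

(** * Limits and derivatives of the parts of a complex function *)

Section Derivatives.
Context {R : realType}.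
Implicit Types (u : R -> Cplx R) (D : set R) (x : R) (i : bool).
Local Open Scope complex_scope.

Lemma part_diff_quot i u (x y : R) :
  part i (diff_quot u x y) = (y - x)^-1 * (part i (u y) - part i (u x)).
Proof. by rewrite /diff_quot part_scale partB. Qed.

Lemma quot_bound (x y p p' d e : R) : y != x ->
  `|d - (y - x)^-1 * (p' - p)| <= e <-> `|p' - p - d * (y - x)| <= e * `|y - x|.
Proof.
move=> yx; have yx0 : y - x != 0 by rewrite subr_eq0.
rewrite (_ : p' - p - d * (y - x) = - ((d - (y - x)^-1 * (p' - p)) * (y - x))); last by field.
by rewrite normrN normrM ler_pM2r ?normr_gt0.
Qed.

Lemma derivable_on_part i D u x : derivable_on D u x ->
  rel_deriv D (fun y => part i (u y)) x (part i (deriv_on D u x)).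
Proof.
move=> cu e e0; have FF : Filter (within D x^') by exact: within_filter.
move: (cvg_part (FF := FF) (i := i) cu) => /cvgrPdist_le/(_ e e0).
rewrite /prop_near1/= /nbhs/= /within/= => -[t /= t0 Ht].
exists t => // y Dy xy; have [->|yx] := eqVneq y x.
  by rewrite !subrr mulr0 subr0 normr0 mulr0.
by apply/quot_bound => //; rewrite -part_diff_quot; exact: (Ht y xy yx Dy).
Qed.

Lemma diff_quot_cvg D u x (z : Cplx R) :
  (forall i, rel_deriv D (fun y => part i (u y)) x (part i z)) ->
  diff_quot u x @ within D x^' --> z.
Proof.
move=> H; apply: cvg_of_parts => i; apply/cvgrPdist_le => e e0.
have [t t0 Ht] := H i e e0; rewrite /prop_near1/= /nbhs/= /within/=; exists t => //= y xy yx Dy.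
by rewrite part_diff_quot; apply/quot_bound => //; exact: Ht.
Qed.

(** x is a limit point of D: the filter defining [deriv_on] is then proper and its [lim] unique. *)
Definition dense_near D x := forall t : R, 0 < t -> exists y, [/\ D y, y != x & `|x - y| < t].

Lemma deriv_onE D u x (z : Cplx R) : dense_near D x ->
  (forall i, rel_deriv D (fun y => part i (u y)) x (part i z)) -> deriv_on D u x = z.
Proof.
move=> Dx /diff_quot_cvg; apply: cvg_lim; first exact: norm_hausdorff.
apply: Build_ProperFilter; rewrite /within/= => -[t /= t0 H].
by have [y [Dy yx xy]] := Dx t t0; exact: (H y xy yx Dy).
Qed.

Lemma left_tends l (x : R) (f : R -> R) L : f @ x^'- --> L -> tends (punctured l x x) f x L.
Proof.
move=> /cvgrPdist_le H e e0; have := H e e0.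
rewrite /prop_near1/= /nbhs/= /at_left /within/= => -[t /= t0 Ht].
exists t => // y [yI yx] xy; rewrite distrC; apply: Ht => //.
by move: yI; rewrite in_itv/= lt_neqAle yx => /andP[].
Qed.

Lemma right_tends r (x : R) (f : R -> R) L : f @ x^'+ --> L -> tends (punctured x r x) f x L.
Proof.
move=> /cvgrPdist_le H e e0; have := H e e0.
rewrite /prop_near1/= /nbhs/= /at_right /within/= => -[t /= t0 Ht].
exists t => // y [yI yx] xy; rewrite distrC; apply: Ht => //.
by move: yI; rewrite in_itv/= lt_neqAle eq_sym yx => /andP[].
Qed.

Lemma within_tends D (f : R -> R) x : {within D, continuous f} -> D x -> tends D f x (f x).
Proof.
move=> /subspace_continuousP H Dx e e0; have /cvgrPdist_le/(_ e e0) := H x Dx.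
rewrite /prop_near1/= /nbhs/= /within/= => -[t /= t0 Ht].
by exists t => // y Dy xy; rewrite distrC; exact: Ht.
Qed.

Lemma tendsS D D' (f : R -> R) x L : D `<=` D' -> tends D' f x L -> tends D f x L.
Proof. by move=> DD' H e /H[t t0 Ht]; exists t => // y /DD'; exact: Ht. Qed.

Lemma rel_derivS D D' (f : R -> R) x d : D `<=` D' -> rel_deriv D' f x d -> rel_deriv D f x d.
Proof. by move=> DD' H e /H[t t0 Ht]; exists t => // y /DD'; exact: Ht. Qed.

Lemma abs_cont_part i D l r k u : punctured l r k `<=` D -> abs_cont D u ->
  forall e : R, 0 < e -> exists2 d : R, 0 < d & forall F, itv_family l r F ->
    all (fun p => (p.1 != k) && (p.2 != k)) F -> total_length F < d ->
    family_variation (fun x => part i (u x)) F < e.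
Proof.
move=> ID H e /H[d d0 Hd]; exists d => // F /andP[F1 F2] Fk Fd.
pose nt (j : 'I_(size F)) := nth (0, 0) F j.
have ntF j : nt j \in F by exact: mem_nth.
have sumE (g : R * R -> R) : \sum_(p <- F) g p = \sum_(j < size F) g (nt j).
  by rewrite (big_nth (0, 0)) big_mkord.
rewrite /total_length sumE in Fd; rewrite /family_variation sumE.
have := Hd _ (fun j => (nt j).1) (fun j => (nt j).2) _ _ Fd.
have /[swap]/[apply] : forall j, [/\ D (nt j).1, D (nt j).2 & (nt j).1 <= (nt j).2].
  move=> j; have /and3P[h1 h2 h3] := allP F1 _ (ntF j); have /andP[k1 k2] := allP Fk _ (ntF j).
  by split=> //; apply: ID.
have /[swap]/[apply] : forall j j', j != j' -> (nt j).2 <= (nt j').1 \/ (nt j').2 <= (nt j).1.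
  have A (j j' : 'I_(size F)) : (j < j')%N -> (nt j).2 <= (nt j').1 \/ (nt j').2 <= (nt j).1.
    move=> jj; have /orP := (pairwiseP (0, 0) F2) j j' (ltn_ord j) (ltn_ord j') jj; exact.
  move=> j j'; rewrite neq_ltn => /orP[/A//|/A]; tauto.
move=> He; rewrite -ltcR; apply: le_lt_trans He; rewrite rmorph_sum/=; apply: ler_sum => j _.
by rewrite -partB; have := normr_ge0 (u (nt j).2 - u (nt j).1); rewrite -(RRe_real (normr_real _)) => _;
  rewrite lecR; apply: part_norm_le; rewrite RRe_real ?normr_real.
Qed.

End Derivatives.

(** * Jets on the two segments of a complex function on J *)

Section Jets.
Context {R : realType} (P : transmission_data R) (hP : admissible P).
Implicit Types (u : R -> Cplx R) (x k : R) (i : bool) (z : R[i]).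
Local Open Scope complex_scope.

Local Notation a := (td_a P).
Local Notation c := (td_c P).
Local Notation b := (td_b P).
Local Notation cont l r f := {within `[l, r], continuous f}.
Local Notation hspace := (((R -> R) * (R -> R)) * R)%type.
Local Notation jets := (((R -> R) * (R -> R)) * ((R -> R) * (R -> R)))%type.
Local Notation "'Int' l r f" := (\int[@lebesgue_measure R]_(t in `[l, r]) f t) (at level 10, l, r, f at level 9).

Let ac : a < c := adm_ac hP.
Let cb : c < b := adm_cb hP.

Definition q1 : R -> R := ext c (td_q P) (lim (td_q P @ c^'-)).
Definition q2 : R -> R := ext c (td_q P) (lim (td_q P @ c^'+)).

Definition jet i u : jets :=
  ((ext c (fun x => part i (u x)) (part i (lim_left P u)),
    ext c (fun x => part i (D_J P u x)) (part i (lim_left P (D_J P u)))),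
   (ext c (fun x => part i (u x)) (part i (lim_right P u)),
    ext c (fun x => part i (D_J P u x)) (part i (lim_right P (D_J P u))))).

Lemma extE k (f : R -> R) L x : x != k -> ext k f L x = f x.
Proof. by rewrite /ext => /negbTE ->. Qed.

Lemma ext_at k (f : R -> R) L : ext k f L k = L.
Proof. by rewrite /ext eqxx. Qed.

Lemma left_sub_J : punctured a c c `<=` J P.
Proof.
by move=> x [xI xc]; left; move: xI; rewrite /= !in_itv/= lt_neqAle xc => /andP[-> ->].
Qed.

Lemma right_sub_J : punctured c b c `<=` J P.
Proof.
by move=> x [xI xc]; right; move: xI; rewrite /= !in_itv/= lt_neqAle eq_sym xc => /andP[-> ->].
Qed.

Lemma J_cases x : J P x -> punctured a c c x \/ punctured c b c x.
Proof.
case=> /=; rewrite in_itv/= => /andP[h1 h2]; [left|right].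
  by split; rewrite ?in_itv/= ?h1 ?ltW// lt_eqF.
by split; rewrite ?in_itv/= ?h2 ?ltW// gt_eqF.
Qed.

Lemma J_dense_near x : J P x -> dense_near (J P) x.
Proof.
move=> Jx t t0; have [[xI xc]|[xI xc]] := J_cases Jx; move: xI; rewrite in_itv/= => /andP[h1 h2].
  have xc' : x < c by rewrite lt_neqAle xc.
  exists (x + Num.min (t / 2) ((c - x) / 2)); set s := Num.min _ _.
  have s0 : 0 < s by rewrite lt_min !divr_gt0// subr_gt0.
  have s1 : s < t by rewrite gt_min ltr_pdivrMr// ltr_pMr// ltr1n.
  have s2 : s < c - x by rewrite gt_min orbC ltr_pdivrMr// ltr_pMr ?subr_gt0// ltr1n.
  split; [|by rewrite gt_eqF// ltrDl|by rewrite opprD addNKr normrN gtr0_norm].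
  by left; rewrite /= in_itv/=; apply/andP; split; lra.
have xc' : c < x by rewrite lt_neqAle eq_sym xc.
exists (x - Num.min (t / 2) ((x - c) / 2)); set s := Num.min _ _.
have s0 : 0 < s by rewrite lt_min !divr_gt0// subr_gt0.
have s1 : s < t by rewrite gt_min ltr_pdivrMr// ltr_pMr// ltr1n.
have s2 : s < x - c by rewrite gt_min orbC ltr_pdivrMr// ltr_pMr ?subr_gt0// ltr1n.
split; [|by rewrite lt_eqF// ltrBlDr ltrDl|by rewrite opprB addrC subrK gtr0_norm].
by right; rewrite /= in_itv/=; apply/andP; split; lra.
Qed.

Lemma q1_cont : cont a c q1.
Proof.
apply: ext_cont => [x [xI xc]|].
  apply: (@tendsS _ _ `[a, c[%classic).
    by move=> y [yI yc]; move: yI; rewrite /= !in_itv/= lt_neqAle yc.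
  apply: within_tends (adm_q_left hP) _.
  by move: xI; rewrite /= !in_itv/= lt_neqAle xc.
by apply: left_tends; have [] := adm_q_limits hP.
Qed.

Lemma q2_cont : cont c b q2.
Proof.
apply: ext_cont => [x [xI xc]|].
  apply: (@tendsS _ _ `]c, b]%classic).
    by move=> y [yI yc]; move: yI; rewrite /= !in_itv/= lt_neqAle eq_sym yc.
  apply: within_tends (adm_q_right hP) _.
  by move: xI; rewrite /= !in_itv/= lt_neqAle eq_sym xc.
by apply: right_tends; have [] := adm_q_limits hP.
Qed.

Lemma cNl : c \notin `]a, c[. Proof. by rewrite in_itv/= ltxx andbF. Qed.
Lemma cNr : c \notin `]c, b[. Proof. by rewrite in_itv/= ltxx. Qed.

Lemma tends_left_lim i u : cvg (u @ c^'-) ->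
  tends (punctured a c c) (fun x => part i (u x)) c (part i (lim_left P u)).
Proof. by move=> cu; apply: left_tends; exact: cvg_part cu. Qed.

Lemma tends_right_lim i u : cvg (u @ c^'+) ->
  tends (punctured c b c) (fun x => part i (u x)) c (part i (lim_right P u)).
Proof. by move=> cu; apply: right_tends; exact: cvg_part cu. Qed.

Lemma jet_C1 i u : (forall x, J P x -> derivable_on (J P) u x) ->
  cont a c (jet i u).1.2 -> cont c b (jet i u).2.2 -> has_limits P u ->
  C1on a c (jet i u).1.1 (jet i u).1.2 /\ C1on c b (jet i u).2.1 (jet i u).2.2.
Proof.
move=> du cd1 cd2 [ul ur].
have du' x : J P x -> rel_deriv (J P) (fun y => part i (u y)) x (part i (D_J P u x)).
  by move=> /du; exact: derivable_on_part.
split; split.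
- apply: ext_cont (tends_left_lim i ul) => x /left_sub_J Jx.
  exact: tendsS left_sub_J (rel_deriv_tends (du' x Jx)).
- exact: cd1.
- move=> x xI; have xc : x != c by apply: contraNneq cNl => xc; rewrite -{1}xc.
  have Jx : J P x by apply: left_sub_J; split=> //; exact: subset_itv_oo_cc.
  by rewrite /= extE//; apply: ext_is_derive cNl xI (rel_derivS left_sub_J (du' x Jx)).
- apply: ext_cont (tends_right_lim i ur) => x /right_sub_J Jx.
  exact: tendsS right_sub_J (rel_deriv_tends (du' x Jx)).
- exact: cd2.
- move=> x xI; have xc : x != c by apply: contraNneq cNr => xc; rewrite -{1}xc.
  have Jx : J P x by apply: right_sub_J; split=> //; exact: subset_itv_oo_cc.
  by rewrite /= extE//; apply: ext_is_derive cNr xI (rel_derivS right_sub_J (du' x Jx)).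
Qed.

(* The data of the real (i = true) or imaginary (i = false) part of z * u. *)
Definition jet_mul i z u : hspace :=
  complex.Re z *: jet0 P (jet i u)
  + (if i then - complex.Im z else complex.Im z) *: jet0 P (jet (~~ i) u).

Lemma part_mul i z w : part i (z * w) =
  complex.Re z * part i w + (if i then - complex.Im z else complex.Im z) * part (~~ i) w.
Proof. by case: i; rewrite /part ?ReM ?ImM ?mulNr. Qed.

Lemma jet_mulE i z u : jet_mul i z u =
  ((fun x => complex.Re z * (jet i u).1.1 x + (if i then - complex.Im z else complex.Im z) * (jet (~~ i) u).1.1 x,
    fun x => complex.Re z * (jet i u).2.1 x + (if i then - complex.Im z else complex.Im z) * (jet (~~ i) u).2.1 x),
   complex.Re z * rbdry' P (jet i u) + (if i then - complex.Im z else complex.Im z) * rbdry' P (jet (~~ i) u)).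
Proof. by rewrite /jet_mul hspace_comb hspace_scale. Qed.

Lemma solves_tends i z u x : solves P z u -> J P x ->
  tends (J P) (fun y => part i (D_J P u y)) x (part i (D_J P u x)).
Proof. by move=> su Jx; have [_ /(derivable_on_part i)/rel_deriv_tends] := su x Jx. Qed.

(** For a classical solution u'' is continuous up to c, so u' is C^1 on each closed segment and the
    integrated equation follows. A complex z mixes the two parts of u, hence [jet_mul]. *)
Lemma solution_sturm i z u : solves P z u -> has_limits P u -> has_limits P (D_J P u) ->
  sturm a c q1 (jet_mul i z u).1.1 (jet i u).1.1 (jet i u).1.2 /\
  sturm c b q2 (jet_mul i z u).1.2 (jet i u).2.1 (jet i u).2.2.
Proof.
move=> su lu ldu.
have C1 j : C1on a c (jet j u).1.1 (jet j u).1.2 /\ C1on c b (jet j u).2.1 (jet j u).2.2.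
  have [dl dr] := ldu; apply: (jet_C1 _ _ _ lu).
  - by move=> x Jx; have [] := su x Jx.
  - apply: ext_cont (tends_left_lim j dl) => x /left_sub_J Jx.
    exact: tendsS left_sub_J (solves_tends j su Jx).
  - apply: ext_cont (tends_right_lim j dr) => x /right_sub_J Jx.
    exact: tendsS right_sub_J (solves_tends j su Jx).
have [[[c1 _ _] _] [[c1' _ _] _]] := (C1 true, C1 false).
have ddu x : J P x -> rel_deriv (J P) (fun y => part i (D_J P u y)) x
    (td_q P x * part i (u x) - part i (z * u x)).
  move=> Jx; have [_ d2 tx] := su x Jx; have := derivable_on_part i d2.
  rewrite -tx /tau partD partN part_scale; congr rel_deriv; rewrite /D_J; ring.
rewrite jet_mulE; split; (split; first exact: (C1 i).1 || exact: (C1 i).2).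
  apply: C1on_primitive; have [[cp cd _] _] := C1 i; split=> //.
    apply: within_sub; first by apply: within_mul => //; exact: q1_cont.
    apply: within_comb; first by have [[]] := C1 i.
    by apply: within_mul; [exact: within_cst|have [[]] := C1 (~~ i)].
  move=> x xI; have xc : x != c by apply: contraNneq cNl => xc; rewrite -{1}xc.
  have Jx : J P x by apply: left_sub_J; split=> //; exact: subset_itv_oo_cc.
  have := ext_is_derive (part i (lim_left P (D_J P u))) cNl xI (rel_derivS left_sub_J (ddu x Jx)).
  by rewrite part_mul /q1 /= !extE.
apply: C1on_primitive; have [_ [cp cd _]] := C1 i; split=> //.
  apply: within_sub; first by apply: within_mul => //; exact: q2_cont.
  apply: within_comb; first by have [_ []] := C1 i.
  by apply: within_mul; [exact: within_cst|have [_ []] := C1 (~~ i)].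
move=> x xI; have xc : x != c by apply: contraNneq cNr => xc; rewrite -{1}xc.
have Jx : J P x by apply: right_sub_J; split=> //; exact: subset_itv_oo_cc.
have := ext_is_derive (part i (lim_right P (D_J P u))) cNr xI (rel_derivS right_sub_J (ddu x Jx)).
by rewrite part_mul /q2 /= !extE.
Qed.

Lemma a_neq_c : a != c. Proof. by rewrite lt_eqF. Qed.
Lemma b_neq_c : b != c. Proof. by rewrite gt_eqF. Qed.

Lemma Ja : J P a. Proof. by left; rewrite /= in_itv/= lexx. Qed.
Lemma Jb : J P b. Proof. by right; rewrite /= in_itv/= lexx andbT. Qed.

Lemma rbdry'_jet i u : rbdry' P (jet i u) = part i (bdry' P u).
Proof. by rewrite /rbdry' /bdry' /= !extE ?b_neq_c// partB !part_scale. Qed.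

Lemma rbdry_jet i u : rbdry P (jet i u) = part i (bdry P u).
Proof. by rewrite /rbdry /bdry /= !extE ?b_neq_c// partB !part_scale. Qed.

Lemma transmission_interface i u : transmission P u -> interface P (jet i u).
Proof.
by move=> [_ _ h1 h2]; split; rewrite /= !ext_at -!part_scale ?h1 ?h2.
Qed.

Lemma left_bc_jet i u : left_bc P u ->
  alpha1 P * (jet i u).1.1 a + alpha2 P * (jet i u).1.2 a = 0.
Proof.
by move=> h; rewrite /= !extE ?a_neq_c// -!part_scale -partD h; case: i.
Qed.

Lemma right_bc_jet i z u : right_bc P z u -> (jet_mul i z u).2 = - rbdry P (jet i u).
Proof.
move=> h; rewrite jet_mulE/= !rbdry'_jet rbdry_jet -part_mul -partN; congr (part i _).
apply/eqP; rewrite -subr_eq0 opprK; apply/eqP; rewrite -[RHS]h /bdry /bdry'; ring.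
Qed.

Lemma eigen_operator i z u : solves P z u -> transmission P u -> left_bc P u -> right_bc P z u ->
  operator P q1 q2 (jet i u) (jet_mul i z u).
Proof.
move=> su tu lu ru; have [lim1 lim2 _ _] := tu.
split; [|exact: solution_sturm|exact: left_bc_jet|exact: transmission_interface|exact: right_bc_jet].
apply: cont_square_int; rewrite jet_mulE; split=> /=.
  have [[[c1 _ _] _] _] := solution_sturm i su lim1 lim2.
  have [[[c2 _ _] _] _] := solution_sturm (~~ i) su lim1 lim2.
  by apply: within_comb => //; apply: within_mul => //; exact: within_cst.
have [_ [[c1 _ _] _]] := solution_sturm i su lim1 lim2.
have [_ [[c2 _ _] _]] := solution_sturm (~~ i) su lim1 lim2.
by apply: within_comb => //; apply: within_mul => //; exact: within_cst.
Qed.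

Lemma jet_eq0 u : (forall i, cont_pair P (jet0 P (jet i u))) ->
  (forall i, ip P (jet0 P (jet i u)) (jet0 P (jet i u)) = 0) -> forall x, J P x -> u x = 0.
Proof.
move=> cu u0 x Jx; apply: part_inj => i; rewrite (_ : part i 0 = 0); last by case: i.
have [z1 z2 _] := ip_eq0 hP (cu i) (u0 i).
have [[xI xc]|[xI xc]] := J_cases Jx.
  by have := z1 x xI; rewrite /= extE.
by have := z2 x xI; rewrite /= extE.
Qed.

(** Symmetry is applied to the real and imaginary parts of u: the terms with Re z cancel, and Im z
    times the sum of the two squared norms is 0. *)
Lemma eigenvalue_real z : is_eigenvalue P z -> z = (complex.Re z)%:C.
Proof.
move=> [u [su tu lu ru [x Jx ux]]].
have o1 := eigen_operator true su tu lu ru; have o2 := eigen_operator false su tu lu ru.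
have c1 := operator_cont_pair o1; have c2 := operator_cont_pair o2.
have S1 := cont_square_int c1; have S2 := cont_square_int c2.
have := operator_sym hP q1_cont q2_cont o1 o2; rewrite /jet_mul/=.
have S0 : square_int P (0 : hspace) := cont_square_int (cont_pair0 P).
have Sc (k : R) F : square_int P F -> square_int P (k *: F).
  by move=> SF; rewrite -[_ *: F]addr0; exact: square_int_comb.
rewrite (ip_lin _ S1)//; last exact: Sc.
rewrite [RHS]ipC (ip_lin _ S2)//; last exact: Sc.
rewrite -[- complex.Im z *: _]addr0 -[complex.Im z *: _]addr0 !ip_lin// !(ip0l S0 (@ip_lin _ P))//.
rewrite (ipC P (jet0 P (jet false u)) (jet0 P (jet true u))) !addr0 => H.
have H' : complex.Im z * (ip P (jet0 P (jet true u)) (jet0 P (jet true u)) + ip P (jet0 P (jet false u)) (jet0 P (jet false u))) = 0.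
  by move: H; move: (ip P _ _) (ip P _ _) (ip P _ _) => A B C H; lra.
have g1 := ip_ge0 hP S1; have g2 := ip_ge0 hP S2.
move/eqP: H'; rewrite mulf_eq0 => /orP[/eqP z0|].
  by apply: part_inj => -[]//=; rewrite /part z0.
rewrite paddr_eq0// => /andP[/eqP e1 /eqP e2].
by case: ux; apply: (jet_eq0 (u := u)) Jx => -[].
Qed.

End Jets.

Section RealDerivatives.
Context {R : realType}.
Local Open Scope complex_scope.
Implicit Types (D : set R) (x : R).

Lemma rel_deriv_ext D (f g : R -> R) x d : D x -> rel_deriv D f x d ->
  (forall y, D y -> f y = g y) -> rel_deriv D g x d.
Proof. by move=> Dx fd fg e /fd[t t0 H]; exists t => // y Dy; rewrite -!fg//; exact: H. Qed.

Lemma rel_deriv_scale D (f : R -> R) x d (k : R) : rel_deriv D f x d ->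
  rel_deriv D (fun y => k * f y) x (k * d).
Proof.
move=> fd e e0; have k0 : 0 < 1 + `|k| by rewrite ltr_pwDl.
have [t t0 H] := fd (e / (1 + `|k|)) (divr_gt0 e0 k0); exists t => // y Dy xy.
rewrite (_ : _ - _ = k * (f y - f x - d * (y - x))); last by ring.
rewrite normrM; apply: (@le_trans _ _ ((1 + `|k|) * `|f y - f x - d * (y - x)|)).
  by rewrite ler_wpM2r// lerDr.
apply: le_trans (ler_wpM2l (ltW k0) (H y Dy xy)) _.
by rewrite mulrA [X in X * _ <= _](_ : _ = e)//; field; exact: lt0r_neq0.
Qed.

(** Serves both [psi] and the terms of the series, which on J are complex constants times a real
    function. *)
Lemma deriv_real D (v w : R -> Cplx R) (z : Cplx R) x : dense_near D x -> D x -> derivable_on D w x ->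
  (forall y, D y -> v y = z * (part true (w y))%:C) ->
  deriv_on D v x = z * (part true (deriv_on D w x))%:C.
Proof.
move=> Dx Jx /(derivable_on_part true) dw vw; apply: (deriv_onE Dx) => i.
rewrite mulrC part_scale mulrC.
apply: rel_deriv_ext Jx (rel_deriv_scale (part i z) dw) _ => y Dy.
by rewrite vw// [in RHS]mulrC part_scale mulrC.
Qed.

End RealDerivatives.

(** * The fundamental solution for real lambda *)

Section Fundamental.
Context {R : realType} (P : transmission_data R) (hP : admissible P).
Variable phi : R -> R[i] -> Cplx R.
Local Open Scope complex_scope.
Hypothesis hphi : forall z : R[i], fundamental_solution P z (phi ^~ z).

Local Notation a := (td_a P).
Local Notation c := (td_c P).
Local Notation b := (td_b P).
Local Notation cont l r f := {within `[l, r], continuous f}.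
Local Notation hspace := (((R -> R) * (R -> R)) * R)%type.
Local Notation jets := (((R -> R) * (R -> R)) * ((R -> R) * (R -> R)))%type.
Local Notation "'Int' l r f" := (\int[@lebesgue_measure R]_(t in `[l, r]) f t) (at level 10, l, r, f at level 9).
Local Notation norm2 F := (ip P F F).

Let ac : a < c := adm_ac hP.
Let cb : c < b := adm_cb hP.
Let S0 : square_int P (0 : hspace) := cont_square_int (cont_pair0 P).

Let sol (k : R) := phi ^~ k%:C.
Let Phi (k : R) := jet P true (sol k).

Let ip00 : ip P 0 0 = 0.
Proof. exact: (ip0l S0 (@ip_lin _ P)). Qed.

Lemma fund_ivp i k : initial_value P (q1 P) (q2 P) k (jet P i (sol k)) 0.
Proof.
have [su _ [lim1 lim2] l1 l2] := hphi k%:C; have [[d1 _] [d2 _]] := (adm_delta hP, adm_delta hP).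
have [S1 S2] := solution_sturm hP i su lim1 lim2.
have ct j : (if j then - complex.Im k%:C else complex.Im k%:C) = 0 by case: j; rewrite /= ?oppr0.
rewrite jet_mulE ct /= in S1 S2.
split; [exact: cont_pair0| | |].
- have [H1 H2] := S1; split=> //; apply: primitive_ext H2 _ _ => // x _.
  by rewrite /= mul0r.
- have [H1 H2] := S2; split=> //; apply: primitive_ext H2 _ _ => // x _.
  by rewrite /= mul0r.
- split; rewrite /= !ext_at.
    by rewrite l1 part_scale mulrA mulrCA mulfV ?mulr1//; exact/eqP.
  have [_ d2'] := adm_delta hP.
  by rewrite l2 part_scale mulrA mulrCA mulfV ?mulr1//; exact/eqP.
Qed.

Lemma fund_a k : (Phi k).1.1 a = alpha2 P /\ (Phi k).1.2 a = - alpha1 P.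
Proof.
have [_ [u1 u2] _ _ _] := hphi k%:C.
by rewrite /Phi /= !extE ?a_neq_c// /sol u1 u2.
Qed.

Lemma jet_bound0 u : jet_bound P u 0 ->
  [/\ forall x, x \in `[a, c] -> u.1.1 x = 0, forall x, x \in `[a, c] -> u.1.2 x = 0,
      forall x, x \in `[c, b] -> u.2.1 x = 0 & forall x, x \in `[c, b] -> u.2.2 x = 0].
Proof.
have sq (s t : R) : s ^+ 2 + t ^+ 2 <= 0 -> s = 0 /\ t = 0.
  have := sqr_ge0 s; have := sqr_ge0 t => h1 h2 h3.
  by split; apply/eqP; rewrite -sqrf_eq0 eq_le; apply/andP; split=> //; lra.
by move=> [B1 B2]; split=> x xI; [have [] := sq _ _ (B1 x xI)|have [] := sq _ _ (B1 x xI)|have [] := sq _ _ (B2 x xI)|have [] := sq _ _ (B2 x xI)].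
Qed.

Lemma ivp_zero k u : initial_value P (q1 P) (q2 P) k u 0 -> u.1.1 a = 0 -> u.1.2 a = 0 ->
  jet_bound P u 0.
Proof.
move=> ui u1 u2; have [C _ HC] := initial_value_bound hP (q1_cont hP) (q2_cont hP) k.
by have := HC _ _ ui; rewrite u1 u2 ip00 expr0n/= !addr0 mulr0.
Qed.

(** For real lambda the imaginary part solves the same problem with zero data at a, and the a priori
    bound makes it vanish. *)
Lemma fund_im k x : J P x -> part false (phi x k%:C) = 0 /\ part false (D_J P (sol k) x) = 0.
Proof.
move=> Jx; have [_ [u1 u2] _ _ _] := hphi k%:C.
have [|z1 z2 z3 z4] := @jet_bound0 (jet P false (sol k)).
  apply: (ivp_zero (fund_ivp false k)); rewrite /= extE ?a_neq_c// /sol.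
    by rewrite u1.
  by rewrite u2 /part/= oppr0.
have [[xI xc]|[xI xc]] := J_cases Jx.
  by have := z1 x xI; have := z2 x xI; rewrite /= !extE.
by have := z3 x xI; have := z4 x xI; rewrite /= !extE.
Qed.

(** Otherwise its Cauchy data alpha2 and - alpha1 at a would both be 0. *)
Lemma fund_nontrivial k : exists2 x, J P x & phi x k%:C <> 0.
Proof.
apply: contrapT => H.
have z x : J P x -> phi x k%:C = 0 by move=> Jx; apply: contrapT => ne; apply: H; exists x.
have [_ [u1 u2] _ _ _] := hphi k%:C.
have Jaa := Ja hP.
have d0 : D_J P (sol k) a = 0.
  rewrite /D_J; apply: (deriv_onE (J_dense_near Jaa)) => i e e0; exists 1 => // y Jy _.
  rewrite /sol (z y Jy) (z a Jaa) subrr (_ : part i 0 = 0); last by case: i.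
  by rewrite mul0r subr0 normr0 mulr_ge0// ltW.
apply: (adm_alpha hP); have e2 := z a Jaa; rewrite u1 in e2; rewrite u2 in d0.
case: e2 => ->; case: d0 => /eqP; rewrite oppr_eq0 => /eqP -> _; reflexivity.
Qed.

Lemma fund_cont_pair k : cont_pair P (jet0 P (Phi k)).
Proof. by have [_ [[h1 _ _] _] [[h2 _ _] _] _] := fund_ivp true k. Qed.

Lemma fund_norm_gt0 k : 0 < norm2 (jet0 P (Phi k)).
Proof.
have cP := fund_cont_pair k.
rewrite lt_def ip_ge0// ?andbT; last exact: cont_square_int.
apply/eqP => n0; have [x Jx ux] := fund_nontrivial k.
have [z1 z2 _] := ip_eq0 hP cP n0; apply: ux; apply: part_inj => -[]; last exact: (fund_im k Jx).1.
have [[xI xc]|[xI xc]] := J_cases Jx.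
  by have := z1 x xI; rewrite /= extE.
by have := z2 x xI; rewrite /= extE.
Qed.

Lemma fund_char_eigen k : char_value P k (Phi k) = 0 -> is_eigenvalue P k%:C.
Proof.
move=> ch; have [su [u1 u2] [lim1 lim2] l1 l2] := hphi k%:C.
have [d1 d2] := adm_delta hP.
have dE (g d : R) (z : Cplx R) : d <> 0 -> g%:C * z = d%:C * ((g / d)%:C * z).
  move=> d0; rewrite mulrA -rmorphM/= mulrCA mulfV ?mulr1//; exact/eqP.
exists (sol k); split; [exact: su| | | |].
- split; [exact: lim1|exact: lim2| |].
    by rewrite -/(lim_right P (sol k)) l1; exact: dE.
  by rewrite -/(lim_right P (D_J P (sol k))) l2; exact: dE.
- rewrite /left_bc /sol u1 u2; apply: part_inj => i; rewrite partD !part_scale.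
  by case: i; rewrite /part/=; ring.
- have [h1 h2] := fund_im k (Jb hP).
  apply: part_inj => i; rewrite partB -!rmorphM -!rmorphD/= !part_scale.
  case: i; last by rewrite h1 h2 /part/=; ring.
  rewrite (_ : part true 0 = 0)//; move: ch; rewrite /char_value /rbdry /rbdry' /= !extE ?b_neq_c// => ch.
  rewrite -[RHS]ch; ring.
- exact: fund_nontrivial.
Qed.

(** Simplicity of the eigenvalues. With s given by the condition at a, v - s phi has zero data at a,
    hence vanishes; since v satisfies the condition at b, so does s phi. *)
Lemma eigen_multiple k v : operator P (q1 P) (q2 P) v (k *: jet0 P v) ->
  exists s : R, s * char_value P k (Phi k) = 0 /\
    norm2 (- s *: jet0 P (Phi k) + jet0 P v) = 0.
Proof.
move=> ov; have [_ _ va _ _] := ov; have [s [s1 s2]] := left_bc_multiple hP (fund_a k) va.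
have ov0 : operator P (q1 P) (q2 P) v (k *: jet0 P v + 0) by rewrite addr0.
have [vi vc] := operator_initial_value (cont_pair0 P) ov0; exists s.
have yi := initial_value_comb (- s) (fund_ivp true k) vi; rewrite scaler0 addr0 in yi.
have B : jet_bound P (- s *: Phi k + v) 0.
  by apply: (ivp_zero yi); rewrite jets_comb/= -/(sol k) -/(Phi k) ?s1 ?s2 mulNr addNr.
have [_ _ z3 z4] := jet_bound0 B.
have bcb : b \in `[c, b] by rewrite in_itv/= lexx ltW.
split.
  have := char_comb P k (- s) (Phi k) v; rewrite vc oppr0 addr0.
  rewrite {1}/char_value /rbdry /rbdry' (z3 b bcb) (z4 b bcb) !mulr0 subrr mulr0 addr0.
  by move=> /eqP; rewrite eq_sym mulNr oppr_eq0 => /eqP.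
have cy : cont_pair P (jet0 P (- s *: Phi k + v)).
  by have [_ [[h1 _ _] _] [[h2 _ _] _] _] := yi.
rewrite -jet0_comb; apply/le_anti; rewrite ip_ge0// ?andbT; last exact: cont_square_int.
by have := jet_bound_ip hP cy B; rewrite mulr0.
Qed.

Lemma char_of_operator k v : operator P (q1 P) (q2 P) v (k *: jet0 P v) ->
  norm2 (jet0 P v) != 0 -> char_value P k (Phi k) = 0.
Proof.
move=> ov v0; have [s [s1 s2]] := eigen_multiple ov; apply/eqP.
move/eqP: s1; rewrite mulf_eq0 => /orP[/eqP s0|//].
by move: v0; rewrite s0 oppr0 scale0r add0r in s2; rewrite s2 eqxx.
Qed.

Lemma char_operator k : char_value P k (Phi k) = 0 ->
  operator P (q1 P) (q2 P) (Phi k) (k *: jet0 P (Phi k)).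
Proof.
move=> ch; rewrite -[k *: _]addr0; apply: initial_value_operator; first exact: fund_ivp.
  by rewrite (fund_a k).1 (fund_a k).2; ring.
by rewrite ch oppr0.
Qed.

Lemma eigen_char k : is_eigenvalue P k%:C -> char_value P k (Phi k) = 0.
Proof.
move=> [u [su tu lu ru [x Jx ux]]].
have E i : operator P (q1 P) (q2 P) (jet P i u) (k *: jet0 P (jet P i u)).
  have := eigen_operator hP i su tu lu ru; rewrite /jet_mul.
  by rewrite (_ : (if i then _ else _) = 0) ?scale0r ?addr0//; case: i; rewrite /= ?oppr0.
have [z1|n1] := eqVneq (norm2 (jet0 P (jet P true u))) 0; last exact: char_of_operator (E true) n1.
have [z2|n2] := eqVneq (norm2 (jet0 P (jet P false u))) 0; last exact: char_of_operator (E false) n2.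
case: ux; apply: (jet_eq0 hP (u := u)) Jx => -[] //; exact: operator_cont_pair (E _).
Qed.

Lemma eigen_orth0 k v : operator P (q1 P) (q2 P) v (k *: jet0 P v) ->
  ip P (jet0 P v) (jet0 P (Phi k)) = 0 -> norm2 (jet0 P v) = 0.
Proof.
move=> ov v0; have [s [_ s2]] := eigen_multiple ov.
have Sv := cont_square_int (operator_cont_pair ov); have SP := cont_square_int (fund_cont_pair k).
have Sy := square_int_comb (- s) SP Sv.
have := ip_null (@square_int_comb _ P) (@ipC _ P) (@ip_lin _ P) (@ip_ge0 _ P hP) Sy Sv s2.
by rewrite ip_lin// (ipC P _ (jet0 P v)) v0 mulr0 add0r.
Qed.

(** The value of f at c is arbitrary, so both integrals are taken over the half-open interval. *)
Lemma Int_left_eq (f g : R -> R) : (forall x, x \in `[a, c] -> x != c -> f x = g x) ->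
  cont a c g -> Int a c f = Int a c g.
Proof.
move=> fg cg; have gi : (@lebesgue_measure R).-integrable `[a, c[ (EFin \o g).
  by apply: integrableS (within_intg cg) => //; apply: subset_itvl; rewrite bnd_simp.
have fgo x : x \in `[a, c[ -> f x = g x.
  by rewrite in_itv/= lt_neqAle => /and3P[h1 h2 h3]; apply: fg; rewrite // in_itv/= h1 h3.
rewrite -!Rintegral_itv_bndo_bndc//.
  by apply: eq_Rintegral => x; rewrite inE => /fgo.
by apply: eq_integrable gi => // x; rewrite inE => /fgo /= ->.
Qed.

Lemma Int_right_eq (f g : R -> R) : (forall x, x \in `[c, b] -> x != c -> f x = g x) ->
  cont c b g -> Int c b f = Int c b g.
Proof.
move=> fg cg; have gi : (@lebesgue_measure R).-integrable `]c, b] (EFin \o g).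
  by apply: integrableS (within_intg cg) => //; apply: subset_itvr; rewrite bnd_simp.
have fgo x : x \in `]c, b] -> f x = g x.
  by rewrite in_itv/= lt_neqAle eq_sym => /andP[/andP[h1 h2] h3]; apply: fg; rewrite // in_itv/= h2 h3.
rewrite -!Rintegral_itv_obnd_cbnd//.
  by apply: eq_Rintegral => x; rewrite inE => /fgo.
by apply: eq_integrable gi => // x; rewrite inE => /fgo /= ->.
Qed.

Lemma part_pairing i (u v : R -> Cplx R) (y : jets) :
  cont_pair P (jet0 P (jet P i u)) -> cont_pair P (jet0 P y) ->
  (forall x, x \in `[a, c] -> x != c -> v x = (y.1.1 x)%:C) ->
  (forall x, x \in `[c, b] -> x != c -> v x = (y.2.1 x)%:C) ->
  bdry' P v = (rbdry' P y)%:C -> part i (expansion_coef P u v) = ip P (jet0 P (jet P i u)) (jet0 P y).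
Proof.
move=> [c1 c2] [c3 c4] vl vr vb.
rewrite /expansion_coef -[_%:C * bdry' P u * _]mulrA !partD !part_scale vb [bdry' P u * _]mulrC part_scale.
rewrite /ip -/(weight1 P) -/(weight2 P) -/(weight3 P).
have partI j D h : part j (Cintegral D h) = (\int[@lebesgue_measure R]_(x in D) part j (h x))%R.
  by case: j.
rewrite !partI (@Int_left_eq _ (fun x => (jet0 P (jet P i u)).1.1 x * (jet0 P y).1.1 x)); last first.
- exact: within_mul.
- by move=> x xI xc; rewrite vl// mulrC part_scale mulrC /= extE.
rewrite (@Int_right_eq _ (fun x => (jet0 P (jet P i u)).1.2 x * (jet0 P y).1.2 x)); last first.
- exact: within_mul.
- by move=> x xI xc; rewrite vr// mulrC part_scale mulrC /= extE.
rewrite /jet0/= rbdry'_jet//; ring.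
Qed.

Lemma norm1_fund k : norm1 P (eigenelement P phi k%:C) = Num.sqrt (norm2 (jet0 P (Phi k))).
Proof.
have [c1 c2] := fund_cont_pair k.
rewrite /norm1 /inner1 /eigenelement/= -!/(part true _) !partD !part_scale.
rewrite !gtr0_norm ?(adm_gamma12 hP) ?(adm_delta12 hP)// /ip -/(weight1 P) -/(weight2 P) -/(weight3 P).
have ReC (z : R[i]) : part true (z * z^*) = part true z * part true z + part false z * part false z.
  by case: z => z1 z2; rewrite /part/=; ring.
have partI D h : part true (Cintegral D h) = (\int[@lebesgue_measure R]_(x in D) part true (h x))%R by [].
rewrite !partI (@Int_left_eq (fun x => part true (phi x k%:C * (phi x k%:C)^*)) (fun x => (jet0 P (Phi k)).1.1 x * (jet0 P (Phi k)).1.1 x)); last first.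
- exact: within_mul.
- move=> x xI xc; rewrite ReC (fund_im k _).1; last by apply: left_sub_J; split.
  by rewrite /= !extE// mulr0 addr0.
rewrite (@Int_right_eq (fun x => part true (phi x k%:C * (phi x k%:C)^*)) (fun x => (jet0 P (Phi k)).1.2 x * (jet0 P (Phi k)).1.2 x)); last first.
- exact: within_mul.
- move=> x xI xc; rewrite ReC (fund_im k _).1; last by apply: right_sub_J; split.
  by rewrite /= !extE// mulr0 addr0.
rewrite ReC -!(rbdry'_jet hP) [rbdry' P (jet P false _)](_ : _ = 0) ?mulr0 ?addr0//.
have [h1 h2] := fund_im k (Jb hP).
by rewrite rbdry'_jet// /bdry' partB !part_scale h1 h2 !mulr0 subrr.
Qed.

End Fundamental.

(** * Square integrability of the parts *)

Section SquareIntegrable.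
Context {R : realType}.
Local Notation mu := (@lebesgue_measure R).
Local Open Scope complex_scope.

Lemma ae_neq (k : R) : {ae mu, forall x, x != k}.
Proof.
exists [set k]; split; [exact: measurable_set1|exact: lebesgue_measure_set1|].
by move=> x /=; have [->|//] := eqVneq x k; move=> _.
Qed.

Lemma L2on_ae (l r : R) (h k : R -> R) : measurable_fun `[l, r] h -> L2on l r k ->
  {ae mu, forall x, x \in `]l, r[ -> h x = k x} -> L2on l r h.
Proof.
move=> mh [mk ik] hk; split=> //; apply/integrableP; split.
  by apply/measurable_EFinP; exact: measurable_funX.
have /integrableP[_] := ik; congr (_ < _)%E; apply: ge0_ae_eq_integral => //.
- by apply: measurableT_comp => //; apply/measurable_EFinP; exact: measurable_funX.
- by apply: measurableT_comp => //; apply/measurable_EFinP; exact: measurable_funX.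
apply: filterS3 (ae_neq l) (ae_neq r) hk; first exact: (ae_filter_ringOfSetsType mu).
move=> x xl xr hkx; rewrite /= in_itv/= => /andP[h1 h2]; rewrite hkx//.
by rewrite in_itv/= !lt_neqAle h1 h2 eq_sym xl xr.
Qed.

Lemma L2on_part i (l r a b : R) (g : R -> Cplx R) : measurable_fun setT (fun x => complex.Re (g x)) ->
  measurable_fun setT (fun x => complex.Im (g x)) ->
  (\int[mu]_(x in `[a, b]) (complex.Re (`|g x| ^+ 2))%:E < +oo)%E ->
  `[l, r]%classic `<=` `[a, b]%classic -> L2on l r (fun x => part i (g x)).
Proof.
move=> mR mI gfin sub.
have mp : measurable_fun setT (fun x => part i (g x)) by case: i.
have mpl : measurable_fun `[l, r] (fun x => part i (g x)) by exact: measurable_funTS.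
have E x : complex.Re (`|g x| ^+ 2) = complex.Re (g x) ^+ 2 + complex.Im (g x) ^+ 2.
  by rewrite -add_Re2_Im2.
have mg D : measurable_fun D (fun x => (complex.Re (`|g x| ^+ 2))%:E).
  apply/measurable_EFinP; apply: measurable_funTS.
  under eq_fun do rewrite E.
  by apply: measurable_funD; exact: measurable_funX.
have g0 x : (0 <= (complex.Re (`|g x| ^+ 2))%:E)%E by rewrite lee_fin E addr_ge0 ?sqr_ge0.
split=> //; apply/integrableP; split; first by apply/measurable_EFinP; exact: measurable_funX.
apply: le_lt_trans gfin.
apply: (@le_trans _ _ (\int[mu]_(x in `[l, r]) (complex.Re (`|g x| ^+ 2))%:E)%E).
  apply: ge0_le_integral => //.
    by apply: measurableT_comp => //; apply/measurable_EFinP; exact: measurable_funX.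
    exact: mg.
  move=> x _; rewrite E /= lee_fin ger0_norm ?sqr_ge0//.
  by case: i {mp mpl}; rewrite /part ?lerDl ?lerDr sqr_ge0.
by apply: ge0_subset_integral => //; exact: mg.
Qed.

End SquareIntegrable.

(** * Elements of D(A) in integrated form *)

Section DomainOperator.
Context {R : realType} (P : transmission_data R) (hP : admissible P).
Local Open Scope complex_scope.
Local Notation mu := (@lebesgue_measure R).
Local Notation a := (td_a P).
Local Notation c := (td_c P).
Local Notation b := (td_b P).
Let ac : a < c := adm_ac hP.
Let cb : c < b := adm_cb hP.

(* D_J is a limit in the complex plane: both parts of u' have to be differentiable at x. *)
Lemma second_derivative_ae l r (u : R -> Cplx R) (L : bool -> R) (d : bool -> R -> R) :
  punctured l r c `<=` J P -> c \notin `]l, r[ ->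
  (forall i, primitive_on l r (ext c (fun x => part i (D_J P u x)) (L i)) (d i)) ->
  {ae mu, forall x, x \in `]l, r[ -> forall i, part i (D_J P (D_J P u) x) = d i x}.
Proof.
move=> IJ cI ud.
have [A1 A2] := (primitive_derive (ud true), primitive_derive (ud false)).
apply: filterS2 A1 A2; first exact: (ae_filter_ringOfSetsType mu).
move=> x D1 D2 xI i.
have xc : x != c by apply: contraNneq cI => xc; rewrite -{1}xc.
have Jx : J P x by apply: IJ; split=> //; exact: subset_itv_oo_cc.
rewrite /D_J (@deriv_onE _ (J P) (deriv_on (J P) u) x ((d true x) +i* (d false x)) (J_dense_near Jx)); first by case: i.
move=> j; have D : is_derive x 1 (ext c (fun x => part j (D_J P u x)) (L j)) (d j x).
  by case: j; [exact: D1|exact: D2].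
have -> : part j (d true x +i* d false x) = d j x by case: j {D}.
move=> e e0; have /= := filterI (dist_of_is_derive D e0) (near_itv_oo xI).
move=> [t /= t0 H]; exists t => // y Jy xy; have [H1 yI] := H y xy.
have yc : y != c by apply: contraNneq cI => yc; rewrite -{1}yc.
by move: H1; rewrite !extE.
Qed.

(** The right-hand side is built from the density of f', which is measurable, whereas tau f is only
    almost everywhere equal to a Borel function. The two agree almost everywhere, which transfers
    square integrability. *)
Lemma dom_operator i (f : R -> Cplx R) : dom_A P (f, bdry' P f) ->
  exists g, operator P (q1 P) (q2 P) (jet P i f) g.
Proof.
move=> [_ df [_ _ ac1 ac2] [g [mR mI fg gfin]] [lf tf]]; rewrite /= in df ac1 ac2 fg lf tf.
have [[fl fr] [dl dr] _ _] := tf.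
have r1 j : real_abs_cont a c (jet P j f).1.2.
  apply: (@ext_abs_cont _ a c c (fun x => part j (D_J P f x)) (part j (lim_left P (D_J P f)))) => //;
    [by right| |exact: tends_left_lim].
  apply: abs_cont_part ac1 => x [xI xc]; move: xI; rewrite /= !in_itv/= => /andP[h1 h2].
  by rewrite h1 lt_neqAle xc h2.
have r2 j : real_abs_cont c b (jet P j f).2.2.
  apply: (@ext_abs_cont _ c b c (fun x => part j (D_J P f x)) (part j (lim_right P (D_J P f)))) => //;
    [by left| |exact: tends_right_lim].
  apply: abs_cont_part ac2 => x [xI xc]; move: xI; rewrite /= !in_itv/= => /andP[h1 h2].
  by rewrite h2 lt_neqAle eq_sym xc h1.
have C1 := jet_C1 df (abs_cont_within (r1 i)) (abs_cont_within (r2 i)) (conj fl fr).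
have /choice[d1 Hd1] : forall j, exists d, primitive_on a c (jet P j f).1.2 d.
  by move=> j; exact: abs_cont_primitive (ltW ac) (r1 j).
have /choice[d2 Hd2] : forall j, exists d, primitive_on c b (jet P j f).2.2 d.
  by move=> j; exact: abs_cont_primitive (ltW cb) (r2 j).
have ae1 := second_derivative_ae (@left_sub_J _ P) (@cNl _ P) Hd1.
have ae2 := second_derivative_ae (@right_sub_J _ P) (@cNr _ P) Hd2.
exists ((fun x => q1 P x * (jet P i f).1.1 x - d1 i x, fun x => q2 P x * (jet P i f).2.1 x - d2 i x),
  - rbdry P (jet P i f)).
have [C11 C12] := C1; have [c1 _ _] := C11; have [c2 _ _] := C12.
split=> //; [split|split; split|exact: left_bc_jet|exact: transmission_interface] => //=.
- apply: (L2on_ae _ (L2on_part i mR mI gfin _)).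
  + apply: measurable_funB; last exact: intg_measurable (Hd1 i).1.
    by apply: within_measurable; apply: within_mul => //; exact: q1_cont.
  + by apply: subset_itvl; rewrite bnd_simp ltW.
  apply: filterS2 ae1 fg; first exact: (ae_filter_ringOfSetsType mu).
  move=> x H1 H2 xI.
  have xc : x != c by apply: contraNneq (@cNl _ P) => xc; rewrite -{1}xc.
  rewrite -H2; last first.
    by move: xI; rewrite /= !in_itv/= => /andP[h1 h2]; rewrite ltW//= ltW// (lt_trans h2).
  by rewrite /tau partD partN part_scale H1// /q1 !extE// addrC.
- apply: (L2on_ae _ (L2on_part i mR mI gfin _)).
  + apply: measurable_funB; last exact: intg_measurable (Hd2 i).1.
    by apply: within_measurable; apply: within_mul => //; exact: q2_cont.
  + by apply: subset_itvr; rewrite bnd_simp ltW.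
  apply: filterS2 ae2 fg; first exact: (ae_filter_ringOfSetsType mu).
  move=> x H1 H2 xI.
  have xc : x != c by apply: contraNneq (@cNr _ P) => xc; rewrite -{1}xc.
  rewrite -H2; last first.
    by move: xI; rewrite /= !in_itv/= => /andP[h1 h2]; rewrite [x <= b]ltW// andbT ltW// (lt_trans ac).
  by rewrite /tau partD partN part_scale H1// /q2 !extE// addrC.
- by apply: primitive_ext (Hd1 i) _ _ => // x _; rewrite opprB addrC subrK.
- by apply: primitive_ext (Hd2 i) _ _ => // x _; rewrite opprB addrC subrK.
Qed.

End DomainOperator.

(** * From series of parts to complex series *)

Section ComplexSums.
Context {R : realType}.
Local Open Scope complex_scope.
Variables (E : set R) (s : nat -> R -> Cplx R) (F : R -> Cplx R).

Hypothesis sF : forall i (t : R), 0 < t -> exists N, forall M x, (N <= M)%N -> E x ->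
  \sum_(N <= n < M) `|part i (s n x)| <= t /\
  `|\sum_(0 <= n < M) part i (s n x) - part i (F x)| <= t.

Let part_sum i M x : part i (series (fun n => s n x) M) = \sum_(0 <= n < M) part i (s n x).
Proof.
rewrite /series/=; elim: (index_iota 0 M) => [|n r IH]; first by rewrite !big_nil; case: i.
by rewrite !big_cons partD IH.
Qed.

Let unif (t : R) : 0 < t -> exists N, forall M x, (N <= M)%N -> E x ->
  `|F x - series (fun n => s n x) M| <= t%:C.
Proof.
move=> t0; have t2 : 0 < t / 2 by rewrite divr_gt0.
have [N1 H1] := sF true t2; have [N2 H2] := sF false t2.
exists (maxn N1 N2) => M x; rewrite geq_max => /andP[M1 M2] Ex.
rewrite distrC; apply: le_trans (norm_le_parts _) _; rewrite lecR (splitr t).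
rewrite -[complex.Re _]/(part true _) -[complex.Im _]/(part false _) !partB !part_sum.
by rewrite lerD ?(H1 M x M1 Ex).2 ?(H2 M x M2 Ex).2.
Qed.

Lemma sum_on_parts : sum_on E s F.
Proof.
move=> x Ex; apply/cvg_complexP => t /unif[N HN]; exists N => // M NM; exact: HN.
Qed.

Lemma unif_sum_on_parts : unif_sum_on E s F.
Proof.
move=> A /uniform_nbhs[V [/= entV VA]].
have [e /complex_pos[e' e0 ->] eV] : exists2 e : R[i], 0 < e & forall z w : Cplx R, `|z - w| < e -> V (z, w).
  move: entV; rewrite -entourage_ballE => -[e /= e0 eV]; exists e => // z w zw; apply: eV => //.
have e2 : 0 < e' / 2 by rewrite divr_gt0.
have [N HN] := unif e2; exists N => // M NM; apply: VA => y Ey; apply: eV.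
by apply: le_lt_trans (HN M y NM Ey) _; rewrite ltcR ltr_pdivrMr// ltr_pMr// ltr1n.
Qed.

Lemma abs_cvg_on_parts : abs_cvg_on E s.
Proof.
move=> x Ex; pose nrm n : R := complex.Re `|s n x|.
have nrmE n : `|s n x| = (nrm n)%:C by rewrite /nrm RRe_real// normr_real.
have nrm0 n : 0 <= nrm n by rewrite -lecR -nrmE normr_ge0.
have nrm_le n : nrm n <= `|part true (s n x)| + `|part false (s n x)|.
  by rewrite -lecR -nrmE; exact: norm_le_parts.
have [N1 H1] := sF true ltr01; have [N2 H2] := sF false ltr01.
have cv : cvgn (fun M => \sum_(0 <= n < M) nrm n).
  apply: nondecreasing_is_cvgn.
    by move=> i j ij; rewrite (big_cat_nat _ ij)//= lerDl sumr_ge0.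
  exists (\sum_(0 <= n < maxn N1 N2) nrm n + 2) => _ [M _ <-].
  have [NM|/ltnW MN] := leqP (maxn N1 N2) M; last first.
    by rewrite (big_cat_nat _ MN)//= -addrA lerDl addr_ge0// sumr_ge0.
  rewrite (big_cat_nat _ NM)//= lerD2l.
  apply: (@le_trans _ _ (\sum_(maxn N1 N2 <= n < M) (`|part true (s n x)| + `|part false (s n x)|))).
    exact: ler_sum.
  rewrite big_split/= [leRHS](_ : 2 = 1 + 1)//; move: NM; rewrite geq_max => /andP[M1 M2].
  have tl N i (Nm : (N <= maxn N1 N2)%N) (mM : (maxn N1 N2 <= M)%N) :
      \sum_(N <= n < M) `|part i (s n x)| <= 1 -> \sum_(maxn N1 N2 <= n < M) `|part i (s n x)| <= 1.
    by apply: le_trans; rewrite [leRHS](big_cat_nat Nm mM)//= lerDr sumr_ge0.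
  have mM : (maxn N1 N2 <= M)%N by rewrite geq_max M1.
  apply: lerD; first exact: tl (leq_maxl _ _) mM (H1 M x M1 Ex).1.
  exact: tl (leq_maxr _ _) mM (H2 M x M2 Ex).1.
have E' M : [normed series (fun n => s n x)] M = (\sum_(0 <= n < M) nrm n)%:C.
  by rewrite rmorph_sum/=; apply: eq_bigr => n _; exact: nrmE.
have /cvgrPdist_le H : (fun M => \sum_(0 <= n < M) nrm n) @ \oo --> limn (fun M => \sum_(0 <= n < M) nrm n) by exact: cv.
apply/cvg_ex; exists (limn (fun M => \sum_(0 <= n < M) nrm n))%:C.
apply/cvgrPdist_le => e /complex_pos[e' e0 ->]; have := H e' e0; apply: filterS => M HM.
by rewrite E' -rmorphB/= normc_def/= expr0n addr0 sqrtr_sqr lecR.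
Qed.

End ComplexSums.

(** If the sequence took every real value, ]0, 1[ would be countable and so of measure 0. *)
Lemma real_avoid {R : realType} (u : nat -> R) : exists m : R, forall n, u n != m.
Proof.
apply: contrapT => H.
have : countable (`]0, 1[%classic : set R).
  apply: sub_countable (card_image_le u setT); apply: subset_card_le => m _.
  apply: contrapT => nm; apply: H; exists m => n.
  by apply/eqP => unm; apply: nm; exists n.
move=> /countable_lebesgue_measure0; rewrite lebesgue_measure_itv/= lte_fin ltr01 sube0.
by move=> /eqP; rewrite eqe oner_eq0.
Qed.

(** * The expansion on J *)

Section Assembly.
Context {R : realType} (P : transmission_data R) (hP : admissible P).
Local Open Scope complex_scope.
Local Notation a := (td_a P).
Local Notation c := (td_c P).
Local Notation b := (td_b P).
Local Notation jets := (((R -> R) * (R -> R)) * ((R -> R) * (R -> R)))%type.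
Local Notation hspace := (((R -> R) * (R -> R)) * R)%type.
Variable phi : R -> R[i] -> Cplx R.
Hypothesis hphi : forall z : R[i], fundamental_solution P z (phi ^~ z).
Variable lam : nat -> R[i].
Hypothesis lam_inj : injective lam.
Hypothesis lam_enum : forall z : R[i], is_eigenvalue P z <-> exists n, lam n = z.
Variable f : R -> Cplx R.
Hypothesis hf : dom_A P (f, bdry' P f).

Let k n := complex.Re (lam n).

Let lamE n : lam n = (k n)%:C.
Proof. by apply: (eigenvalue_real hP); apply/lam_enum; exists n. Qed.

Let Phi (m : R) := jet P true (phi ^~ m%:C).
Let nrm n := Num.sqrt (ip P (jet0 P (Phi (k n))) (jet0 P (Phi (k n)))).

Let nrm_gt0 n : 0 < nrm n.
Proof. by rewrite sqrtr_gt0; exact: fund_norm_gt0. Qed.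

Let e n : jets := (nrm n)^-1 *: Phi (k n).

Let eE n : e n = ((fun x => (nrm n)^-1 * (Phi (k n)).1.1 x, fun x => (nrm n)^-1 * (Phi (k n)).1.2 x),
  (fun x => (nrm n)^-1 * (Phi (k n)).2.1 x, fun x => (nrm n)^-1 * (Phi (k n)).2.2 x)).
Proof. rewrite /e /GRing.scale/=; reflexivity. Qed.

Let jet0_e n : jet0 P (e n) = (nrm n)^-1 *: jet0 P (Phi (k n)).
Proof.
rewrite /e -[_ *: Phi _]addr0 jet0_comb (_ : jet0 P 0 = 0) ?addr0//.
by rewrite /jet0 /rbdry' /= !mulr0 subrr.
Qed.

Let Phi_op n : operator P (q1 P) (q2 P) (Phi (k n)) (k n *: jet0 P (Phi (k n))).
Proof.
apply: (char_operator hP hphi); apply: (eigen_char hP hphi); rewrite -lamE.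
by apply/lam_enum; exists n.
Qed.

Let e_op n : operator P (q1 P) (q2 P) (e n) (k n *: jet0 P (e n)).
Proof.
rewrite jet0_e scalerA mulrC -scalerA /e.
by have := operator_comb (nrm n)^-1 (Phi_op n) (operator0 P (q1 P) (q2 P)); rewrite !addr0.
Qed.

Let e_sq n : square_int P (jet0 P (e n)).
Proof. exact: cont_square_int (operator_cont_pair (e_op n)). Qed.

Let Phi_sq n : square_int P (jet0 P (Phi (k n))).
Proof. exact: cont_square_int (operator_cont_pair (Phi_op n)). Qed.

Let S0 : square_int P (0 : hspace) := cont_square_int (cont_pair0 P).

Let ip_scalel (s : R) (F G : hspace) : square_int P F -> square_int P G -> ip P (s *: F) G = s * ip P F G.
Proof. by move=> SF SG; rewrite -[_ *: F]addr0 ip_lin// (ip0l S0 (@ip_lin _ P))// addr0. Qed.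

(** By symmetry, elements of distinct eigenvalues are orthogonal; the enumeration being without
    repetition, distinct indices have distinct eigenvalues. *)
Let e_on i j : ip P (jet0 P (e i)) (jet0 P (e j)) = (i == j)%:R.
Proof.
have [<-|ij] := eqVneq i j.
  rewrite {2}jet0_e ipC ip_scalel// ipC jet0_e ip_scalel//.
  rewrite -[X in _ * (_ * X)]sqr_sqrtr ?ip_ge0// -/(nrm i) expr2.
  by rewrite mulKf ?mulVf ?gt_eqF.
have := operator_sym hP (q1_cont hP) (q2_cont hP) (e_op i) (e_op j).
rewrite ip_scalel// [RHS]ipC ip_scalel// (ipC P (jet0 P (e j))) => /eqP.
rewrite -subr_eq0 -mulrBl mulf_eq0 subr_eq0 => /orP[/eqP kk|/eqP //].
by case/eqP: ij; apply: lam_inj; rewrite lamE kk -lamE.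
Qed.

(** A nontrivial u makes m an eigenvalue, hence some lam n, whose eigenspace is spanned by phi(.,
    lam n). *)
Let e_all (m : R) u : operator P (q1 P) (q2 P) u (m *: jet0 P u) ->
  (forall n, ip P (jet0 P u) (jet0 P (e n)) = 0) -> ip P (jet0 P u) (jet0 P u) = 0.
Proof.
move=> ou ue; apply/eqP; apply: contrapT => /negP u0.
have ch := char_of_operator hP hphi ou u0.
have [n lamn] := (lam_enum m%:C).1 (fund_char_eigen hP hphi ch).
have kn : k n = m by rewrite /k lamn.
case/eqP: u0; apply: (eigen_orth0 hP hphi ou); rewrite -kn.
have Su := cont_square_int (operator_cont_pair ou).
have := ue n; rewrite jet0_e ipC ip_scalel// ipC => /eqP.
by rewrite mulf_eq0 invr_eq0 gt_eqF//= => /eqP.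
Qed.

Let psi_E n x : J P x -> psi P phi lam n x = ((nrm n)^-1)%:C * (part true (phi x (lam n)))%:C.
Proof.
move=> Jx; rewrite /psi lamE (norm1_fund hP hphi) -/(Phi _) -/(nrm n) mulrC -fmorphV.
congr (_ * _); apply: part_inj => -[]//; exact: (fund_im hP hphi (k n) Jx).1.
Qed.

Let phi_derivable n x : J P x -> derivable_on (J P) (phi ^~ (lam n)) x.
Proof. by move=> Jx; have [/(_ x Jx)[]] := hphi (lam n). Qed.

Let D_psi n x : J P x -> D_J P (psi P phi lam n) x = ((nrm n)^-1)%:C * (part true (D_J P (phi ^~ (lam n)) x))%:C.
Proof.
move=> Jx; have H := @deriv_real _ (J P) (psi P phi lam n) (phi ^~ (lam n)) ((nrm n)^-1)%:C x (J_dense_near Jx) Jx (phi_derivable Jx).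
by apply: H => y; exact: psi_E.
Qed.

Let coef n := expansion_coef P f (psi P phi lam n).

Let f_cont i : cont_pair P (jet0 P (jet P i f)).
Proof. by have [g /operator_cont_pair] := dom_operator hP i hf. Qed.

Let coefE i n : part i (coef n) = ip P (jet0 P (jet P i f)) (jet0 P (e n)).
Proof.
rewrite /coef; apply: (part_pairing hP (f_cont i) (operator_cont_pair (e_op n))).
- move=> x xI xc; rewrite psi_E ?eE/= ?extE ?lamE ?rmorphM//.
  by apply: left_sub_J; split.
- move=> x xI xc; rewrite psi_E ?eE/= ?extE ?lamE ?rmorphM//.
  by apply: right_sub_J; split.
rewrite /bdry' /rbdry' eE /= !extE ?b_neq_c// psi_E ?D_psi ?lamE; [|exact: Jb..].
by rewrite -!rmorphM -rmorphB.
Qed.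

(** Used twice: p1 and p2 are the restrictions of psi_n to the two segments, and then those of its
    derivative. *)
Let usum_J (S : nat -> R -> Cplx R) (F : R -> Cplx R) (p1 p2 : nat -> R -> R) (g1 g2 : bool -> R -> R) :
  (forall i n x, punctured a c c x -> part i (S n x) = part i (coef n) * p1 n x) ->
  (forall i n x, punctured c b c x -> part i (S n x) = part i (coef n) * p2 n x) ->
  (forall i x, punctured a c c x -> part i (F x) = g1 i x) ->
  (forall i x, punctured c b c x -> part i (F x) = g2 i x) ->
  (forall i, usum a c (fun n x => part i (coef n) * p1 n x) (g1 i)) ->
  (forall i, usum c b (fun n x => part i (coef n) * p2 n x) (g2 i)) ->
  [/\ sum_on (J P) S F, abs_cvg_on (J P) S & unif_sum_on (J P) S F].
Proof.
move=> S1 S2 F1 F2 U1 U2.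
suff H i (t : R) : 0 < t -> exists N, forall M x, (N <= M)%N -> J P x ->
    \sum_(N <= n < M) `|part i (S n x)| <= t /\
    `|\sum_(0 <= n < M) part i (S n x) - part i (F x)| <= t.
  by split; [exact: sum_on_parts|exact: abs_cvg_on_parts H|exact: unif_sum_on_parts].
move=> t0; have [N1 H1] := U1 i t t0; have [N2 H2] := U2 i t t0.
exists (maxn N1 N2) => M x NM; move: (NM); rewrite geq_max => /andP[M1 M2].
have tl N (g : nat -> R) : (N <= maxn N1 N2)%N ->
    \sum_(N <= n < M) `|g n| <= t -> \sum_(maxn N1 N2 <= n < M) `|g n| <= t.
  by move=> Nm; apply: le_trans; rewrite [leRHS](big_cat_nat Nm NM)//= lerDr sumr_ge0.
move=> /J_cases[] Ix; have [xI _] := Ix.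
  rewrite F1//; have [h1 h2] := H1 M x M1 xI; split.
    rewrite (eq_bigr (fun n => `|part i (coef n) * p1 n x|)) => [|n _]; last by rewrite S1.
    exact: tl (leq_maxl _ _) h1.
  by rewrite (eq_bigr (fun n => part i (coef n) * p1 n x)) => [|n _]; last by rewrite S1.
rewrite F2//; have [h1 h2] := H2 M x M2 xI; split.
  rewrite (eq_bigr (fun n => `|part i (coef n) * p2 n x|)) => [|n _]; last by rewrite S2.
  exact: tl (leq_maxr _ _) h1.
by rewrite (eq_bigr (fun n => part i (coef n) * p2 n x)) => [|n _]; last by rewrite S2.
Qed.

Let part_mulr i (z : R[i]) (r : R) : part i (z * r%:C) = part i z * r.
Proof. by rewrite mulrC part_scale mulrC. Qed.

Theorem expansion_J :
  let s n x := coef n * psi P phi lam n x in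
  let s' n := D_J P (s n) in
  [/\ sum_on (J P) s f, abs_cvg_on (J P) s & unif_sum_on (J P) s f] /\
  [/\ sum_on (J P) s' (D_J P f), abs_cvg_on (J P) s' & unif_sum_on (J P) s' (D_J P f)].
Proof.
move=> s s'.
have sE n x : J P x -> s n x = coef n * ((nrm n)^-1)%:C * (part true (phi x (lam n)))%:C.
  by move=> Jx; rewrite /s psi_E// mulrA.
have s'E n x : J P x -> s' n x = coef n * ((nrm n)^-1)%:C * (part true (D_J P (phi ^~ (lam n)) x))%:C.
  move=> Jx; have H := @deriv_real _ (J P) (s n) (phi ^~ (lam n)) (coef n * ((nrm n)^-1)%:C) x (J_dense_near Jx) Jx (phi_derivable Jx).
  by apply: H => y; exact: sE.
have [m lam_m] := real_avoid k.
have ivp := fund_ivp hP hphi true m.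
have ch : char_value P m (Phi m) != 0.
  apply/eqP => /(fund_char_eigen hP hphi) /lam_enum[n lamn].
  by have := lam_m n; rewrite /k lamn eqxx.
have U i : [/\ usum a c (fun n x => part i (coef n) * (e n).1.1 x) (jet P i f).1.1,
    usum a c (fun n x => part i (coef n) * (e n).1.2 x) (jet P i f).1.2,
    usum c b (fun n x => part i (coef n) * (e n).2.1 x) (jet P i f).2.1
  & usum c b (fun n x => part i (coef n) * (e n).2.2 x) (jet P i f).2.2].
  have [g fg] := dom_operator hP i hf.
  have := expansion hP (q1_cont hP) (q2_cont hP) ivp (fund_a hP hphi m) ch e_op lam_m e_all e_on fg.
  have cE (p : nat -> R -> R) : (fun n x => ip P (jet0 P (jet P i f)) (jet0 P (e n)) * p n x) =
      (fun n x => part i (coef n) * p n x) by apply/funext => n; apply/funext => x; rewrite coefE.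
  by rewrite !cE.
split.
  apply: (@usum_J _ _ (fun n => (e n).1.1) (fun n => (e n).2.1) (fun i => (jet P i f).1.1) (fun i => (jet P i f).2.1)).
  - move=> i n x Ix; have [_ xc] := Ix; rewrite sE; last exact: left_sub_J.
    by rewrite !part_mulr eE /= extE// lamE mulrA.
  - move=> i n x Ix; have [_ xc] := Ix; rewrite sE; last exact: right_sub_J.
    by rewrite !part_mulr eE /= extE// lamE mulrA.
  - by move=> i x [_ xc]; rewrite /= extE.
  - by move=> i x [_ xc]; rewrite /= extE.
  - by move=> i; have [] := U i.
  - by move=> i; have [] := U i.
apply: (@usum_J _ _ (fun n => (e n).1.2) (fun n => (e n).2.2) (fun i => (jet P i f).1.2) (fun i => (jet P i f).2.2)).
- move=> i n x Ix; have [_ xc] := Ix; rewrite s'E; last exact: left_sub_J.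
  by rewrite !part_mulr eE /= extE// lamE mulrA.
- move=> i n x Ix; have [_ xc] := Ix; rewrite s'E; last exact: right_sub_J.
  by rewrite !part_mulr eE /= extE// lamE mulrA.
- by move=> i x [_ xc]; rewrite /= extE.
- by move=> i x [_ xc]; rewrite /= extE.
- by move=> i; have [] := U i.
- by move=> i; have [] := U i.
Qed.

End Assembly.

Local Open Scope complex_scope.

Theorem theorem5p2 (R : realType) (P : transmission_data R)
    (hP : admissible P)
    (phi : R -> R[i] -> Cplx R)
    (hphi : forall z : R[i], fundamental_solution P z (phi ^~ z))
    (lam : nat -> R[i])
    (lam_inj : injective lam)
    (lam_enum : forall z : R[i], is_eigenvalue P z <-> exists n, lam n = z)
    (f : R -> Cplx R)
    (hf : dom_A P (f, bdry' P f)) :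
  let coef n := expansion_coef P f (psi P phi lam n) in
  let s n x := coef n * psi P phi lam n x in
  let s' n := D_J P (s n) in
  [/\ sum_on (J P) s f, abs_cvg_on (J P) s & unif_sum_on (J P) s f] /\
  [/\ sum_on (J P) s' (D_J P f), abs_cvg_on (J P) s' & unif_sum_on (J P) s' (D_J P f)].
Proof. exact: expansion_J. Qed.
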